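(* Let $K$ be a field and let $S'\rightarrow S$ be a finite étale cover of $K$-schemes of finite type, with $S$ connected. Let $L/K$ be a field extension with $L$ a local field. Then there are finite groups $H_1,\dots, H_n$ and a finite covering of $S(L)$ by disjoint open sets $(U_i)_{i\in\{1,\dots, n\}}$ such that, for all $i\in \{1,\dots, n\}$ and $s\in S(L)$, $$s\in U_i\iff \operatorname{Gal} (L(S'_s(\overline{L}))/L)\simeq H_i.$$
   Context: $S(L)$ carries the analytic topology induced by the topology of the local field $L$. $\overline{L}$ is a separable closure of $L$ and $G_L=\operatorname{Gal}(\overline{L}/L)$. For $s\in S(L)$, $S'_s=S'\times_S s$ is the fibre of $S'$ at $s$, a finite étale $L$-scheme, and $L(S'_s(\overline{L}))$ is the field of definition of its geometric points, i.e. the finite Galois extension of $L$ fixed by the kernel of the action of $G_L$ on the finite set $S'_s(\overline{L})$. *)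

(* Defs.v *)
From HB Require Import structures.
From mathcomp Require Import all_boot all_algebra all_fingroup all_field.
From mathcomp Require Import all_classical all_reals all_analysis.

Set Implicit Arguments.
Unset Strict Implicit.
Unset Printing Implicit Defensive.

Import GRing.Theory.
Local Open Scope classical_set_scope.
Local Open Scope ring_scope.

(* [comPzRingType] rather than [comNzRingType]: the ring of sections over the
   empty set is the zero ring. *)

Definition invertible (A : comPzRingType) (a : A) := exists b, a * b = 1.

Definition prime_ideal (A : comPzRingType) (p : set A) :=
  [/\ p 0, forall a b, p a -> p b -> p (a + b),
      forall a b, p b -> p (a * b), ~ p 1 &
      forall a b, p (a * b) -> p a \/ p b].

Definition is_localization_away (A B : comPzRingType)
    (phi : {rmorphism A -> B}) (a : A) :=
  [/\ invertible (phi a),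
      forall b, exists x n, b * phi a ^+ n = phi x &
      forall x, phi x = 0 -> exists n, a ^+ n * x = 0].

(* Expressions denoting the elements of A[X_0, ..., X_(n-1)]. *)
Inductive pexpr (A : Type) (n : nat) : Type :=
| PCst of A
| PVar of 'I_n
| PAdd of pexpr A n & pexpr A n
| PMul of pexpr A n & pexpr A n.

Fixpoint peval (A B : comPzRingType) (phi : A -> B) n (b : 'I_n -> B)
    (e : pexpr A n) : B :=
  match e with
  | PCst a => phi a
  | PVar i => b i
  | PAdd e1 e2 => peval phi b e1 + peval phi b e2
  | PMul e1 e2 => peval phi b e1 * peval phi b e2
  end.

Definition finite_type_alg (A B : comPzRingType) (phi : A -> B) :=
  exists n (b : 'I_n -> B), forall y, exists e, y = peval phi b e.

(* B is isomorphic to A[X_0, ..., X_(n-1)] / (r_0, ..., r_(m-1)), expressed by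
   the universal property of that quotient. *)
Definition finite_presentation_alg (A B : comPzRingType)
    (phi : {rmorphism A -> B}) :=
  exists n (b : 'I_n -> B) m (r : 'I_m -> pexpr A n),
    (forall k, peval phi b (r k) = 0) /\
    forall (C : comPzRingType) (psi : {rmorphism A -> C}) (c : 'I_n -> C),
      (forall k, peval psi c (r k) = 0) ->
      (exists w : {rmorphism B -> C},
         (forall a, w (phi a) = psi a) /\ (forall i, w (b i) = c i)) /\
      (forall w w' : {rmorphism B -> C},
         (forall a, w (phi a) = psi a) -> (forall i, w (b i) = c i) ->
         (forall a, w' (phi a) = psi a) -> (forall i, w' (b i) = c i) ->
         w =1 w').

Definition finite_alg (A B : comPzRingType) (phi : {rmorphism A -> B}) :=
  exists n (b : 'I_n -> B), forall y, exists c : 'I_n -> A,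
    y = \sum_(i < n) phi (c i) * b i.

(* Unique infinitesimal lifting: D is the quotient of C by an ideal of
   square zero. *)
Definition formally_etale (A B : comPzRingType) (phi : {rmorphism A -> B}) :=
  forall (C D : comPzRingType) (q : {rmorphism C -> D})
    (u : {rmorphism A -> C}) (v : {rmorphism B -> D}),
    (forall d, exists c, q c = d) ->
    (forall x y, q x = 0 -> q y = 0 -> x * y = 0) ->
    (forall a, q (u a) = v (phi a)) ->
    (exists w : {rmorphism B -> C},
       (forall a, w (phi a) = u a) /\ (forall b, q (w b) = v b)) /\
    (forall w w' : {rmorphism B -> C},
       (forall a, w (phi a) = u a) -> (forall b, q (w b) = v b) ->
       (forall a, w' (phi a) = u a) -> (forall b, q (w' b) = v b) ->
       w =1 w').

Definition etale_alg (A B : comPzRingType) (phi : {rmorphism A -> B}) :=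
  finite_presentation_alg phi /\ formally_etale phi.

Identity Coercion set_funclass : set >-> Funclass.

Record opens (X : topologicalType) := Opens {
  opens_set :> set X;
  opens_open : open opens_set }.

Definition opens_full (X : topologicalType) : opens X := Opens (@openT X).

Lemma opens_preim_subproof (X Y : topologicalType) (f : X -> Y)
  (fc : continuous f) (V : opens Y) : open (f @^-1` V).
Proof. by apply: open_comp; [move=> x _; exact: fc | exact: opens_open]. Qed.

Definition opens_preim (X Y : topologicalType) (f : X -> Y)
  (fc : continuous f) (V : opens Y) : opens X :=
  Opens (opens_preim_subproof fc V).

(* In the gluing axiom, agreement on every open W contained in V i and V j is
   agreement on their intersection. *)
Record ringed_space := RingedSpace {
  rs_space :> topologicalType;
  sec : opens rs_space -> comPzRingType;
  res : forall U V : opens rs_space, V `<=` U -> {rmorphism sec U -> sec V};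
  res_id : forall (U : opens rs_space) (h : U `<=` U) (s : sec U), res h s = s;
  res_comp : forall (U V W : opens rs_space) (hVU : V `<=` U) (hWV : W `<=` V) (hWU : W `<=` U)
    (s : sec U), res hWV (res hVU s) = res hWU s;
  sec_separated : forall (I : Type) (U : opens rs_space)
    (V : I -> opens rs_space)
    (hV : forall i, V i `<=` U), (forall x, U x -> exists i, V i x) ->
    forall s t : sec U, (forall i, res (hV i) s = res (hV i) t) -> s = t;
  sec_glue : forall (I : Type) (U : opens rs_space)
    (V : I -> opens rs_space)
    (hV : forall i, V i `<=` U), (forall x, U x -> exists i, V i x) ->
    forall s : forall i, sec (V i),
    (forall i j (W : opens rs_space) (hi : W `<=` V i) (hj : W `<=` V j),
       res hi (s i) = res hj (s j)) ->
    exists t : sec U, forall i, res (hV i) t = s i }.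

Arguments sec : clear implicits.
Arguments res X [U V] h : rename.

Section RingedSpace.
Variable X : ringed_space.

(* The germ of s at x is a unit of the stalk at x. *)
Definition invertible_at (U : opens X) (s : sec X U) (x : X) :=
  exists (V : opens X) (h : V `<=` U), V x /\ invertible (res X h s).

(* All stalks are local rings: 0 is not a unit, and the sum of two nonunits is
   a nonunit. *)
Definition locally_ringed :=
  forall (x : X) (U : opens X), U x ->
    ~ invertible_at (0 : sec X U) x /\
    forall s t : sec X U,
      invertible_at (s + t) x -> invertible_at s x \/ invertible_at t x.

(* The inverse image of the maximal ideal of the stalk at x. *)
Definition vanishing_ideal (U : opens X) (x : X) : set (sec X U) :=
  [set s | ~ invertible_at s x].

Arguments vanishing_ideal : clear implicits.

Definition nonvanishing (U : opens X) (a : sec X U) : set X :=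
  [set x | U x /\ invertible_at a x].

(* (U, O_U) is Spec A for A := sec X U: its points are the prime ideals of A,
   the sets D(a) are a basis of its topology, and the sections over D(a) are
   the localization A_a. *)
Definition affine (U : opens X) :=
  [/\ forall p : set (sec X U), prime_ideal p ->
        exists2 x, U x & p = vanishing_ideal U x,
      forall x y, U x -> U y ->
        vanishing_ideal U x = vanishing_ideal U y -> x = y,
      forall (V : opens X) x, V `<=` U -> V x ->
        exists a : sec X U, nonvanishing a x /\ nonvanishing a `<=` V &
      forall (a : sec X U) (V : opens X) (h : V `<=` U),
        V = nonvanishing a :> set X -> is_localization_away (res X h) a].

End RingedSpace.

Arguments vanishing_ideal : clear implicits.

Record scheme := Scheme {
  sch_space :> ringed_space;
  sch_local : locally_ringed sch_space;
  sch_affine : forall x : sch_space,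
    exists2 U : opens sch_space, affine U & U x }.

(* The structure morphism to Spec K is given as a ring morphism from K to the
   ring of global sections. *)
Record kscheme (K : fieldType) := KScheme {
  ksch_scheme :> scheme;
  ksch_str : {rmorphism K -> sec ksch_scheme (opens_full ksch_scheme)} }.

Definition scal (K : fieldType) (X : kscheme K) (U : opens X)
    : {rmorphism K -> sec X U} :=
  @res X (opens_full X) U (@subsetT _ U) \o ksch_str X.

(* [mor_local]: the induced morphisms on stalks are local. *)
Record kmorphism (K : fieldType) (X Y : kscheme K) := KMorphism {
  mor_fun :> X -> Y;
  mor_cont : continuous mor_fun;
  mor_sec : forall V : opens Y,
    {rmorphism sec Y V -> sec X (opens_preim mor_cont V)};
  mor_res : forall (V W : opens Y) (h : W `<=` V)
    (h' : opens_preim mor_cont W `<=` opens_preim mor_cont V) (s : sec Y V),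
    mor_sec W (res Y h s) = res X h' (mor_sec V s);
  mor_local : forall (V : opens Y) (s : sec Y V) (x : X), V (mor_fun x) ->
    invertible_at (mor_sec V s) x -> invertible_at s (mor_fun x);
  mor_scal : forall (V : opens Y) (c : K),
    mor_sec V (scal V c) = scal (opens_preim mor_cont V) c }.

Arguments mor_cont {K X Y} f : rename.

Definition finite_type (K : fieldType) (X : kscheme K) :=
  exists n (U : 'I_n -> opens X),
    (forall x : X, exists i, U i x) /\
    (forall i, affine (U i) /\ finite_type_alg (scal (U i))).

(* f is affine, with finite etale algebras over the members of an affine cover
   of Y; surjectivity is not required. *)
Definition finite_etale (K : fieldType) (X Y : kscheme K)
    (f : kmorphism X Y) :=
  forall y : Y, exists U : opens Y,
    [/\ U y, affine U, affine (opens_preim (mor_cont f) U),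
        finite_alg (mor_sec f U) & etale_alg (mor_sec f U)].

(* Morphisms Spec F -> X over Spec K, for F a field extension of K via j: such
   a morphism is a point x of X together with a local morphism of K-algebras
   from the stalk at x to F. *)
Record kpoint (K : fieldType) (X : kscheme K) (F : fieldType)
    (j : {rmorphism K -> F}) := KPoint {
  pt : X;
  ev : forall U : opens X, U pt -> {rmorphism sec X U -> F};
  ev_res : forall (U V : opens X) (h : V `<=` U) (hU : U pt) (hV : V pt)
    (s : sec X U), ev hV (res X h s) = ev hU s;
  ev_local : forall (U : opens X) (hU : U pt) (s : sec X U),
    ev hU s != 0 -> invertible_at s pt;
  ev_scal : forall (U : opens X) (hU : U pt) (c : K),
    ev hU (scal U c) = j c }.

Section PointMaps.
Variables (K : fieldType) (X : kscheme K).

(* Composition with the morphism Spec E -> Spec F induced by g. *)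
Section BaseChange.
Variables (F E : fieldType) (j : {rmorphism K -> F}) (j' : {rmorphism K -> E}).
Variables (g : {rmorphism F -> E}) (gj : forall c, g (j c) = j' c).
Variable x : kpoint X j.

Definition point_base_ev (U : opens X) (h : U (pt x)) :
  {rmorphism sec X U -> E} := g \o ev h.

Lemma point_base_res (U V : opens X) (h : V `<=` U) (hU : U (pt x))
  (hV : V (pt x)) (s : sec X U) :
  point_base_ev hV (res X h s) = point_base_ev hU s.
Proof. by rewrite /point_base_ev /= (ev_res h hU). Qed.

Lemma point_base_local (U : opens X) (hU : U (pt x)) (s : sec X U) :
  point_base_ev hU s != 0 -> invertible_at s (pt x).
Proof. by rewrite /point_base_ev /= fmorph_eq0; exact: ev_local. Qed.

Lemma point_base_scal (U : opens X) (hU : U (pt x)) (c : K) :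
  point_base_ev hU (scal U c) = j' c.
Proof. by rewrite /point_base_ev /= -gj (ev_scal hU). Qed.

Definition point_base : kpoint X j' :=
  KPoint point_base_res point_base_local point_base_scal.
End BaseChange.

Section Image.
Variables (Y : kscheme K) (f : kmorphism X Y).
Variables (F : fieldType) (j : {rmorphism K -> F}) (x : kpoint X j).

Definition point_image_ev (V : opens Y) (h : V (f (pt x))) :
  {rmorphism sec Y V -> F} :=
  @ev _ _ _ _ x (opens_preim (mor_cont f) V) h \o mor_sec f V.

Lemma point_image_res (U V : opens Y) (h : V `<=` U) (hU : U (f (pt x)))
  (hV : V (f (pt x))) (s : sec Y U) :
  point_image_ev hV (res Y h s) = point_image_ev hU s.
Proof.
have h' : opens_preim (mor_cont f) V `<=` opens_preim (mor_cont f) U.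
  by move=> z; exact: h.
by rewrite /point_image_ev /= (mor_res h h'); exact: ev_res.
Qed.

Lemma point_image_local (V : opens Y) (hV : V (f (pt x))) (s : sec Y V) :
  point_image_ev hV s != 0 -> invertible_at s (f (pt x)).
Proof. by move=> /ev_local; exact: mor_local. Qed.

Lemma point_image_scal (V : opens Y) (hV : V (f (pt x))) (c : K) :
  point_image_ev hV (scal V c) = j c.
Proof. by rewrite /point_image_ev /= mor_scal; exact: ev_scal. Qed.

Definition point_image : kpoint Y j :=
  KPoint point_image_res point_image_local point_image_scal.
End Image.

End PointMaps.

(* A local field is a field with a nontrivial absolute value for which it is
   locally compact. Archimedean absolute values are allowed. *)
HB.mixin Record isLocalField (R : realType) L
    of GRing.Field L & Topological L := {
  absv : L -> R;
  absv_ge0 : forall x, 0 <= absv x;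
  absv_eq0 : forall x, absv x = 0 <-> x = 0;
  absvM : forall x y, absv (x * y) = absv x * absv y;
  absvD : forall x y, absv (x + y) <= absv x + absv y;
  absv_nontrivial : exists x, x != 0 /\ absv x != 1;
  absv_nbhs : forall (x : L) (A : set L),
    nbhs x A <-> exists2 e : R, 0 < e & forall y, absv (x - y) < e -> A y;
  local_field_compact : locally_compact [set: L] }.

#[short(type="localFieldType")]
HB.structure Definition LocalField (R : realType) :=
  {L of GRing.Field L & Topological L & isLocalField R L}.

HB.instance Definition _ (K : fieldType) (X : kscheme K) (F : fieldType)
  (j : {rmorphism K -> F}) := gen_eqMixin (kpoint X j).
HB.instance Definition _ (K : fieldType) (X : kscheme K) (F : fieldType)
  (j : {rmorphism K -> F}) := gen_choiceMixin (kpoint X j).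

(* The analytic topology on X(L) is the coarsest one such that, for all open
   subschemes U of X, U(L) is open in X(L) and every section of O_X over U is
   continuous as a function from U(L) to L. *)
Definition analytic_subbase (K : fieldType) (X : kscheme K) (R : realType)
    (L : localFieldType R) (j : {rmorphism K -> L}) : set (set (kpoint X j)) :=
  [set P | exists (U : opens X) (a : sec X U) (W : set L),
     open W /\ P = [set s | exists h : U (pt s), W (ev h a)]].

HB.instance Definition _ (K : fieldType) (X : kscheme K) (R : realType)
  (L : localFieldType R) (j : {rmorphism K -> L}) :=
  isSubBaseTopological.Build (kpoint X j) (analytic_subbase (j := j)) id.

Definition separable_closure (L E : fieldType) (iota : {rmorphism L -> E}) :=
  (forall x : E, exists p : {poly L},
     [/\ irreducible_poly p, separable_poly p & root (map_poly iota p) x]) /\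
  (forall p : {poly E}, separable_poly p -> (1 < size p)%N ->
     exists x, root p x).

Record field_aut (L E : fieldType) (iota : {rmorphism L -> E}) := FieldAut {
  aut_fun :> {rmorphism E -> E};
  aut_inv : {rmorphism E -> E};
  autK : cancel aut_fun aut_inv;
  autVK : cancel aut_inv aut_fun;
  aut_fix : forall c, aut_fun (iota c) = iota c }.

HB.instance Definition _ (L E : fieldType) (iota : {rmorphism L -> E}) :=
  gen_eqMixin (field_aut iota).
HB.instance Definition _ (L E : fieldType) (iota : {rmorphism L -> E}) :=
  gen_choiceMixin (field_aut iota).

Lemma rmorph_ext (A B : pzSemiRingType) (f g : {rmorphism A -> B}) :
  f =1 g -> f = g.
Proof.
move=> fg; have {}fg : (f : A -> B) = g by exact: funext.
case: f g fg => [f [[hf] [hf']]] [g [[hg] [hg']]] /= fg; subst g.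
rewrite (Prop_irrelevance hf hg).
by rewrite (Prop_irrelevance hf' hg').
Qed.

Section FieldAutGroup.
Variables (L E : fieldType) (iota : {rmorphism L -> E}).
Implicit Types sg tau : field_aut iota.

Lemma field_aut_ext sg tau : sg =1 tau -> sg = tau.
Proof.
case: sg tau => [f f' fK f'K fL] [g g' gK g'K gL] /= fg.
have e : f = g by exact: rmorph_ext.
subst g.
have e' : f' = g'.
  by apply: rmorph_ext => x; apply: (can_inj fK); rewrite f'K g'K.
subst g'; congr FieldAut; exact: Prop_irrelevance.
Qed.

Lemma field_aut1K : cancel (idfun : E -> E) idfun. Proof. by []. Qed.

Definition field_aut1 : field_aut iota :=
  @FieldAut L E iota idfun idfun field_aut1K field_aut1K (fun=> erefl).

Lemma field_autM_fix sg tau c : (sg \o tau) (iota c) = iota c.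
Proof. by rewrite /= !aut_fix. Qed.

Definition field_autM sg tau : field_aut iota :=
  @FieldAut L E iota (sg \o tau) (aut_inv tau \o aut_inv sg)
    (can_comp (autK sg) (autK tau)) (can_comp (autVK tau) (autVK sg))
    (field_autM_fix sg tau).

Lemma field_autV_fix sg c : aut_inv sg (iota c) = iota c.
Proof. by rewrite -{1}(aut_fix sg c) autK. Qed.

Definition field_autV sg : field_aut iota :=
  FieldAut (autVK sg) (autK sg) (field_autV_fix sg).

Lemma field_autMA : associative field_autM.
Proof. by move=> r s t; apply: field_aut_ext. Qed.

Lemma field_aut1M : left_id field_aut1 field_autM.
Proof. by move=> s; apply: field_aut_ext. Qed.

Lemma field_autM1 : right_id field_aut1 field_autM.
Proof. by move=> s; apply: field_aut_ext. Qed.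

Lemma field_autVM : left_inverse field_aut1 field_autV field_autM.
Proof. by move=> s; apply: field_aut_ext => x; exact: autK. Qed.

Lemma field_autMV : right_inverse field_aut1 field_autV field_autM.
Proof. by move=> s; apply: field_aut_ext => x; exact: autVK. Qed.

HB.instance Definition _ := isGroup.Build (field_aut iota)
  field_autMA field_aut1M field_autM1 field_autVM field_autMV.

End FieldAutGroup.

Section FixedField.
Variables (L E : fieldType) (iota : {rmorphism L -> E}).
Variable P : set (field_aut iota).

Definition fixed_pred : {pred E} :=
  [pred x : E | `[< forall sg, P sg -> sg x = x >]].

Lemma fixed_predP x :
  reflect (forall sg, P sg -> sg x = x) (x \in fixed_pred).
Proof. exact: asboolP. Qed.

Lemma fixed_divring_closed : divring_closed fixed_pred.
Proof.
split.
- by apply/fixed_predP => sg _; rewrite rmorph1.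
- move=> x y /fixed_predP hx /fixed_predP hy; apply/fixed_predP => sg Psg.
  by rewrite rmorphB /= hx ?hy.
- move=> x y /fixed_predP hx /fixed_predP hy; apply/fixed_predP => sg Psg.
  by rewrite rmorphM fmorphV /= hx ?hy.
Qed.

HB.instance Definition _ :=
  GRing.isDivringClosed.Build E fixed_pred fixed_divring_closed.

Record fixed_field := FixedField {
  fixed_val : E;
  fixed_valP : fixed_val \in fixed_pred }.

HB.instance Definition _ := [isSub for fixed_val].
HB.instance Definition _ := [Choice of fixed_field by <:].
HB.instance Definition _ := [SubChoice_isSubIntegralDomain of fixed_field by <:].
HB.instance Definition _ := [SubIntegralDomain_isSubField of fixed_field by <:].

Lemma fixed_base (c : L) : iota c \in fixed_pred.
Proof. by apply/fixed_predP => sg _; exact: aut_fix. Qed.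

Definition fixed_inj (c : L) : fixed_field := FixedField (fixed_base c).

Lemma fixed_inj_zmod_morphism : zmod_morphism fixed_inj.
Proof. by move=> x y; apply: val_inj; rewrite /= rmorphB. Qed.

Lemma fixed_inj_monoid_morphism : monoid_morphism fixed_inj.
Proof.
split; first by apply: val_inj; rewrite /= rmorph1.
by move=> x y; apply: val_inj; rewrite /= rmorphM.
Qed.

HB.instance Definition _ :=
  GRing.isZmodMorphism.Build L fixed_field fixed_inj fixed_inj_zmod_morphism.
HB.instance Definition _ :=
  GRing.isMonoidMorphism.Build L fixed_field fixed_inj
    fixed_inj_monoid_morphism.

End FixedField.

Section GeometricFibre.
Variables (K : fieldType) (S' S : kscheme K) (f : kmorphism S' S).
Variables (L Lbar : fieldType) (j : {rmorphism K -> L}).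
Variable iota : {rmorphism L -> Lbar}.
Variable s : kpoint S j.

Definition geom_point : kpoint S (iota \o j) :=
  @point_base K S L Lbar j (iota \o j) iota (fun=> erefl) s.

(* S'_s(Lbar): by the universal property of the fibre product, the geometric
   points of the fibre at s are the Lbar-points of S' above s. *)
Definition geom_fibre : set (kpoint S' (iota \o j)) :=
  [set x | point_image f x = geom_point].

Definition galois_act (sg : field_aut iota) (x : kpoint S' (iota \o j)) :
    kpoint S' (iota \o j) :=
  @point_base K S' Lbar Lbar (iota \o j) (iota \o j) sg
    (fun c => aut_fix sg (j c)) x.

Definition galois_act_kernel : set (field_aut iota) :=
  [set sg | forall x, geom_fibre x -> galois_act sg x = x].

(* Gal(L(S'_s(Lbar)) / L): the field L(S'_s(Lbar)) is the fixed field of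
   [galois_act_kernel]. *)
Definition fibre_galois_group : groupType :=
  field_aut (fixed_inj galois_act_kernel).

End GeometricFibre.

Definition group_isomorphic (G H : groupType) :=
  exists phi : G -> H, bijective phi /\ {morph phi : x y / (x * y)%g}.

(* Main.v *)
(* For an affine open U of S over which S' is given by a finite etale algebra
   A -> B, the points of U(L) are morphisms alpha : A -> L, and the geometric
   fibre at alpha is the set of morphisms B -> Lbar over alpha. The kernel of the
   Galois action on this set is locally constant in alpha. Indeed let psi_1, ...,
   psi_d be the fibre at alpha_0 and let M be the subring of Lbar generated by L
   and the psi_i(B), a finite-dimensional normed L-algebra. For alpha near
   alpha_0:
   - B being formally smooth and L complete, Newton's method deforms each psi_i
     to a point over alpha with values in M;
   - B being unramified, d is the dimension of the fibre algebra at alpha_0. This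
     dimension is upper semicontinuous, and bounds the number of geometric
     points, so there are no other points over alpha. Hence an automorphism
     trivial on M acts trivially on the fibre at alpha;
   - conversely, an automorphism acting trivially on the fibre at alpha moves each
     psi_i to a nearby psi_j, because its norm on M is bounded independently of
     the automorphism. Hence it fixes psi_i.
   No extension of the absolute value to Lbar is involved. Finally, the Galois
   group at alpha embeds into the symmetric group of the fibre, whose cardinality
   is bounded since S is quasi-compact, so finitely many groups occur. *)

Require Import Defs.
From HB Require Import structures.
From mathcomp Require Import all_boot all_order all_algebra all_fingroup.
From mathcomp Require Import all_field.
From mathcomp Require Import all_classical all_reals all_analysis.
From mathcomp Require Import ring lra zify.

Set Implicit Arguments.
Unset Strict Implicit.
Unset Printing Implicit Defensive.

Import Order.TTheory GRing.Theory Num.Theory.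
Local Open Scope classical_set_scope.
Local Open Scope ring_scope.

(** * Fibres of unramified algebras over a field *)

(** [finite_alg] provides generators of B but no basis, so the fibre algebra at alpha is handled as
    L^N modulo the specialized relations. If r relations are independent at alpha_0, they remain so
    nearby, and N - r bounds the number of points over alpha. Etaleness enters twice. As the absence
    of derivations into fields, it makes the fibre algebra at alpha_0 reduced after every field
    extension, hence diagonalizable over Lbar, so that exactly N - r points lie over alpha_0. As a
    lifting B -> A[X]/I^2, it gives polynomial formulas valid in every A-algebra, so one Newton step
    serves all alpha near alpha_0. The norm on M is only submultiplicative and need not be Galois
    invariant; the constant K of [compositum_normed] takes the place of invariance when the size of
    the neighbourhood is fixed. *)

Lemma min_rankP (F : fieldType) (d : nat) (P : 'M[F]_d -> Prop) (W : 'M[F]_d) :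
  P W -> exists2 W0, P W0 & forall W', P W' -> (W' <= W0)%MS -> (W0 <= W')%MS.
Proof.
elim: {W}_.+1 {-2}W (ltnSn (\rank W)) => // k IH W rW PW.
have [minW|] := pselect (forall W', P W' -> (W' <= W)%MS -> (W <= W')%MS).
  by exists W.
move=> /existsNP[W' /not_implyP[PW' /not_implyP[W'W /negP nWW']]].
apply: (IH W') => //; rewrite ltnS in rW; apply: leq_trans rW.
by apply: rank_ltmx; rewrite ltmxE W'W.
Qed.

Lemma max_rankP (F : fieldType) (d : nat) (P : 'M[F]_d -> Prop) (W : 'M[F]_d) :
  P W -> exists2 W0, P W0 & forall W', P W' -> (W0 <= W')%MS -> (W' <= W0)%MS.
Proof.
elim: {W}_.+1 {-2}W (ltnSn (d - \rank W)) => // k IH W rW PW.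
have [maxW|] := pselect (forall W', P W' -> (W <= W')%MS -> (W' <= W)%MS).
  by exists W.
move=> /existsNP[W' /not_implyP[PW' /not_implyP[WW' /negP nW'W]]].
have ltr : (\rank W < \rank W')%N by apply: rank_ltmx; rewrite ltmxE WW'.
apply: (IH W') => //; rewrite ltnS in rW; apply: leq_trans rW.
by apply: ltn_sub2l => //; apply: leq_trans ltr (rank_leq_row _).
Qed.

Section NilpotentCocycle.
Variables (F : fieldType) (d N : nat).
Variables (g : 'I_N -> 'M[F]_d.+1) (n : 'M[F]_d.+1) (t : 'I_N -> F).
Hypothesis g_comm : forall i k, g i *m g k = g k *m g i.
Hypothesis n_span : n = \sum_i t i *: g i.
Hypothesis n_sq0 : n *m n = 0.
Hypothesis n_neq0 : n != 0.
Hypothesis g_split : forall i, exists rs : seq F,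
  char_poly (g i) = \prod_(r <- rs) ('X - r%:P).

Let stab (W : 'M[F]_d.+1) := [forall i, stablemx W (g i)].

Let stab_mul (W X : 'M[F]_d.+1) :
  (forall i, X *m g i = g i *m X) -> stab W -> stab (W *m X).
Proof.
move=> Xg /forallP sW; apply/forallP => i.
by rewrite -mulmxA Xg mulmxA submxMr.
Qed.

Let horner_comm i p k :
  horner_mx (g i) p *m g k = g k *m horner_mx (g i) p.
Proof. exact: (comm_horner_mx p (g_comm i k)). Qed.

Let horner_le (W : 'M[F]_d.+1) i p : stab W -> (W *m horner_mx (g i) p <= W)%MS.
Proof. by move=> /forallP sW; exact: horner_mx_stable. Qed.

Let CH (W : 'M[F]_d.+1) i : W *m horner_mx (g i) (char_poly (g i)) = 0.
Proof.
have -> : horner_mx (g i) (char_poly (g i)) = 0 :> 'M[F]_d.+1.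
  exact: Cayley_Hamilton.
by rewrite mulmx0.
Qed.

Let n_comm k : n *m g k = g k *m n.
Proof.
rewrite n_span mulmx_suml mulmx_sumr; apply: eq_bigr => i _.
by rewrite -scalemxAl -scalemxAr g_comm.
Qed.

Let horner_n i p : horner_mx (g i) p *m n = n *m horner_mx (g i) p.
Proof. by apply: (comm_horner_mx p); rewrite /comm_mx n_comm. Qed.

(* On the span of the [g i], [x |-> w (x - chi x) l] is a nonzero derivation
   over the character chi. It is found on a stable subspace W minimal for
   W n <> 0: minimality forces each [g i] to have a single eigenvalue on W. *)
Lemma nilpotent_cocycle : exists (chi : 'I_N -> F) (v w : 'rV[F]_d.+1)
    (l : 'cV[F]_d.+1),
  [/\ v != 0, forall i, v *m g i = chi i *: v,
      forall i k, w *m (g i - (chi i)%:M) *m (g k - (chi k)%:M) *m l = 0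
    & exists i, w *m (g i - (chi i)%:M) *m l != 0].
Proof.
pose P (W : 'M[F]_d.+1) := stab W /\ W *m n != 0.
have P1 : P 1%:M.
  by split; [apply/forallP => i; apply: submx1 | rewrite mul1mx].
have [W [sW Wn] minW] := min_rankP P1.
(* Minimality of W: a polynomial in [g i] that does not kill W n maps W onto W. *)
have minH i p : W *m horner_mx (g i) p *m n != 0 ->
    (W <= W *m horner_mx (g i) p)%MS.
  move=> nz; apply: minW; last exact: horner_le.
  by split=> //; apply: stab_mul => // k; exact: horner_comm.
have gE i a : g i - a%:M = horner_mx (g i) ('X - a%:P).
  by rewrite rmorphB /= horner_mx_X horner_mx_C.
(* If W (g i - a) n were nonzero for every a, minimality would allow the factors of the
   characteristic polynomial to be applied one after the other, against Cayley-Hamilton. *)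
have root_ex i : exists a, W *m (g i - a%:M) *m n = 0.
  apply: contrapT => /forallNP no.
  have [rs rsE] := g_split i.
  suff: W *m horner_mx (g i) (char_poly (g i)) *m n != 0.
    by rewrite CH mul0mx eqxx.
  rewrite {}rsE; elim: rs => [|r rs IH].
    by rewrite big_nil rmorph1 mulmx1.
  rewrite big_cons mulrC rmorphM /= mulmxA; apply/eqP => e0.
  have := no r; rewrite gE; apply; apply/eqP; rewrite -submx0 -e0.
  by apply: submxMr; apply: submxMr; exact: minH.
have [chi chiP] := choice root_ex.
have eig i : W *m n *m g i = chi i *: (W *m n).
  have := chiP i; rewrite mulmxBr mulmxBl => /eqP; rewrite subr_eq0 => /eqP.
  by rewrite -!mulmxA n_comm !mulmxA => ->; rewrite mul_mx_scalar -scalemxAl.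
(* The characteristic polynomial is q (X - chi i)^k with q nonzero at chi i. On W n, q acts by a
   nonzero scalar, so it maps W onto itself, and the other factor must kill W. *)
have nilW i : exists k, W *m horner_mx (g i) (('X - (chi i)%:P) ^+ k) = 0.
  have [k [q]] := multiplicity_XsubC (char_poly (g i)) (chi i).
  rewrite monic_neq0 ?char_poly_monic //= => nq pE; exists k.
  have eigp p : W *m n *m horner_mx (g i) p = p.[chi i] *: (W *m n).
    elim/poly_ind: p => [|p c IH].
      by rewrite rmorph0 horner0 scale0r mulmx0.
    rewrite rmorphD rmorphM /= horner_mx_X horner_mx_C hornerMXaddC mulmxDr.
    rewrite -mulmxE mulmxA IH -scalemxAl eig scalerA mul_mx_scalar.
    by rewrite -scalerDl.
  have le := minH i q; apply/eqP; rewrite -submx0.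
  apply: submx_trans (submxMr _ (le _)) _.
    by rewrite -mulmxA horner_n mulmxA eigp scaler_eq0 negb_or Wn andbT.
  have := CH W i; rewrite pE rmorphM /= -mulmxE mulmxA => ->; exact: sub0mx.
pose c i := g i - (chi i)%:M.
have c_comm i k : c i *m g k = g k *m c i by rewrite /c gE horner_comm.
(* Y is m W for the ideal m generated by the [c i]. What is sought is a subspace Z that contains m Y
   but not Y. *)
pose Y := (\sum_i <<W *m c i>>)%MS.
have stabY : stab Y.
  apply/forallP => k; apply: stablemx_sums => i.
  rewrite (eqmx_stable _ (genmxE _)).
  by have /forallP := stab_mul (c_comm i) sW; apply.
have Yc i : (Y *m c i <= Y)%MS.
  rewrite /c gE; exact: horner_le.
have YW : (Y <= W)%MS.
  by apply/sumsmx_subP => i _; rewrite genmxE /c gE horner_le.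
(* If Y = 0, then n, a combination of the [g i], acts on W by a scalar of square zero, so W n =
   0. *)
have Y0 : Y != 0.
  apply/eqP => Y0.
  have Wg i : W *m g i = chi i *: W.
    have : (W *m c i <= Y)%MS by rewrite -(genmxE (W *m c i)) (sumsmx_sup i).
    rewrite Y0 submx0 mulmxBr subr_eq0 => /eqP ->.
    by rewrite mul_mx_scalar.
  have Wnn : W *m n = (\sum_i t i * chi i) *: W.
    rewrite n_span mulmx_sumr scaler_suml; apply: eq_bigr => i _.
    by rewrite -scalemxAr Wg scalerA.
  have := Wn; have : W *m n *m n == 0 by rewrite -mulmxA n_sq0 mulmx0.
  rewrite Wnn -scalemxAl Wnn scalerA scaler_eq0 mulf_eq0 orbb.
  by rewrite scaler_eq0 => ->.
pose Q (Z : 'M[F]_d.+1) := [/\ stab Z, (Z <= Y)%MS & ~~ (Y <= Z)%MS].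
have Q0 : Q 0.
  split; last by rewrite submx0.
    by apply/forallP => i; apply: stable0mx.
  exact: sub0mx.
have [Z [sZ ZY nYZ] maxZ] := max_rankP Q0.
(* Nakayama: otherwise Y = Z + Y c_i by maximality of Z, and iteration gives Y = Z + Y c_i^k, which
   is Z once c_i^k kills W. *)
have YcZ i : (Y *m c i <= Z)%MS.
  have Zc : (Z *m c i <= Z)%MS by rewrite /c gE horner_le.
  have sZY : stab (Z + Y *m c i)%MS.
    apply/forallP => k; apply: stableDmx; first by move/forallP: sZ.
    by have /forallP := stab_mul (c_comm i) stabY; apply.
  have leY : (Z + Y *m c i <= Y)%MS by rewrite addsmx_sub ZY Yc.
  have [le|nle] := boolP (Y <= Z + Y *m c i)%MS; last first.
    have : (Z + Y *m c i <= Z)%MS by apply: maxZ; rewrite ?addsmxSl.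
    by apply: submx_trans; apply: addsmxSr.
  have leK k : (Y <= Z + Y *m horner_mx (g i) (('X - (chi i)%:P) ^+ k))%MS.
    elim: k => [|k IH]; first by rewrite rmorph1 mulmx1 addsmxSr.
    apply: (submx_trans le); rewrite addsmx_sub addsmxSl /=.
    apply: submx_trans (submxMr _ IH) _; rewrite addsmxMr addsmx_sub.
    rewrite (submx_trans Zc) ?addsmxSl //= exprSr rmorphM /= -gE.
    by rewrite mulmxA addsmxSr.
  have [k Wk] := nilW i; case/negP: nYZ.
  apply: submx_trans (leK k) _; rewrite addsmx_sub submx_refl /=.
  by apply: submx_trans (submxMr _ YW) _; rewrite Wk sub0mx.
have [i nWZ] : exists i, ~~ (W *m c i <= Z)%MS.
  apply/existsP; rewrite -negb_forall; apply: contra nYZ => /forallP h.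
  by apply/sumsmx_subP => i _; rewrite genmxE.
have [r nr] : exists r, ~~ (row r W *m c i <= Z)%MS.
  apply/existsP; rewrite -negb_forall; apply: contra nWZ => /forallP h.
  by apply/row_subP => r; rewrite row_mul.
have : row r W *m c i *m cokermx Z != 0 by rewrite -submxE.
case/rowV0Pn => u /submxP[x ->] {u} nz.
(* The linear form l is a column of the cokernel of Z: it kills Z, hence m Y, but not w c_i. *)
have [k nzk] : exists k, (row r W *m c i *m cokermx Z) 0 k != 0.
  apply/existsP; rewrite -negb_forall; apply: contra nr => /forallP h.
  rewrite submxE; apply/eqP/rowP => k; rewrite [RHS]mxE; exact/eqP.
have [s vs] : exists s, row s (W *m n) != 0.
  apply/existsP; rewrite -negb_forall; apply: contra Wn => /forallP h.
  by apply/eqP/row_matrixP => s; rewrite row0; exact/eqP.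
exists chi, (row s (W *m n)), (row r W), (col k (cokermx Z)); split => //.
- by move=> a; rewrite -row_mul eig linearZ.
- move=> a b; rewrite -/(c a) -/(c b).
  have h : (row r W *m c a *m c b <= Z)%MS.
    apply: submx_trans (YcZ b); apply: submxMr.
    apply: (submx_trans (submxMr _ (row_sub r W))).
    by rewrite -(genmxE (W *m c a)) (sumsmx_sup a).
  move: h; rewrite submxE => /eqP h.
  by rewrite colE mulmxA h mul0mx.
- exists i; rewrite colE mulmxA -colE; apply: contra nzk => /eqP/matrixP/(_ 0 0).
  by rewrite !mxE => e; apply/eqP; rewrite -[RHS]e.
Qed.

End NilpotentCocycle.

(** A tag on f from which the instances below recover the two proofs; it turns a function built
    inside a proof into a ring morphism. *)
Definition fun_rmorph (A B : pzRingType) (f : A -> B)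
  (fB : zmod_morphism f) (fM : monoid_morphism f) := f.

HB.instance Definition _ (A B : pzRingType) (f : A -> B)
  (fB : zmod_morphism f) (fM : monoid_morphism f) :=
  GRing.isZmodMorphism.Build A B (fun_rmorph fB fM) fB.
HB.instance Definition _ (A B : pzRingType) (f : A -> B)
  (fB : zmod_morphism f) (fM : monoid_morphism f) :=
  GRing.isMonoidMorphism.Build A B (fun_rmorph fB fM) fM.

Lemma splitting_field_ex (F : fieldType) (p : {poly F}) : p \is monic ->
  exists (E : fieldType) (kappa : {rmorphism F -> E}) (rs : seq E),
    map_poly kappa p = \prod_(r <- rs) ('X - r%:P).
Proof.
have [k] := ubnP (size p); elim: k => // k IH in F p * => sp mp.
have [sp1|sp1] := leqP (size p) 1.
  exists F, idfun, [::]; rewrite big_nil map_poly_id //.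
  by move: mp; rewrite (size1_polyC sp1) monicE lead_coefC => /eqP ->.
have [q qirr qp] : exists2 q : {poly F}, irreducible_poly q & q %| p.
  have [k'] := ubnP (size p); elim: k' {sp mp IH} p sp1 => // k' IH p sp1 sp.
  have [irr|] := pselect (irreducible_poly p); first by exists p.
  move=> /not_andP[/(_ sp1)//|/existsNP[q /not_implyP[sq /not_implyP[qp]]]].
  have p0 : p != 0 by rewrite -size_poly_gt0 ltnW.
  have q0 : q != 0 by apply: contraTneq qp => ->; rewrite dvd0p.
  move=> /negP npq; have [||q' q'irr q'q] := IH q.
  - by rewrite ltn_neqAle eq_sym sq size_poly_gt0.
  - rewrite ltnS in sp; apply: leq_trans sp.
    rewrite ltn_neqAle dvdp_leq // andbT; apply: contra npq => /eqP sqp.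
    by rewrite -(dvdp_size_eqp qp) sqp.
  by exists q' => //; apply: dvdp_trans qp.
have [E dE [z qz _]] := irredp_FAdjoin qirr.
have pz : root (map_poly (in_alg E) p) z.
  by apply: root_dvdp qz; rewrite dvdp_map.
have [p1 p1E] := factor_theorem _ _ pz.
have mp1 : p1 \is monic.
  have : map_poly (in_alg E) p \is monic by rewrite map_monic.
  by rewrite p1E monicMr // monicXsubC.
have [|E' [kap [rs rsE]]] := IH E p1 _ mp1.
  rewrite ltnS in sp; apply: leq_trans sp.
  rewrite -(size_map_poly (in_alg E) p) p1E size_Mmonic ?monicXsubC ?monic_neq0 //.
  by rewrite size_XsubC addn2.
exists E', (kap \o in_alg E), (kap z :: rs).
rewrite map_poly_comp p1E rmorphM /= rsE big_cons mulrC.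
by rewrite rmorphB /= map_polyX map_polyC.
Qed.

Section FibreModule.
Variables (A B : comPzRingType) (phi : {rmorphism A -> B}).
Variables (N : nat) (g : 'I_N -> B).
Hypothesis g_gen : forall y, exists c : 'I_N -> A, y = \sum_(i < N) phi (c i) * g i.
Variables (L : fieldType) (alpha : {rmorphism A -> L}).

Definition relation (c : 'I_N -> A) := \sum_i phi (c i) * g i = 0.

(** A is not assumed noetherian, so the module of relations may need infinitely many generators.
    Only its span in L^N matters, and a family whose span has maximal rank generates that. *)
Lemma max_relations : exists r (rho : 'I_r -> 'I_N -> A),
  [/\ forall i, relation (rho i), row_free (\matrix_(i, k) alpha (rho i k)) &
      forall c, relation c ->
        (\row_k alpha (c k) <= \matrix_(i, k) alpha (rho i k))%MS].
Proof.
pose P (W : 'M[L]_N) := exists r (rho : 'I_r -> 'I_N -> A),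
  (forall i, relation (rho i)) /\ (W :=: \matrix_(i, k) alpha (rho i k))%MS.
have P0 : P 0.
  exists 0, (fun=> fun=> 0); split=> [[]//|].
  by apply/eqmxP; rewrite sub0mx /=; apply/row_subP => -[].
have [W [r [rho [rel eqW]]] maxW] := max_rankP P0.
set M := \matrix_(i, k) _ in eqW.
have eqM : (rowsub (maxrankfun M) M :=: M)%MS := eq_maxrowsub M.
exists (\rank M), (fun i => rho (maxrankfun M i)).
have -> : \matrix_(i, k) alpha (rho (maxrankfun M i) k) = rowsub (maxrankfun M) M.
  by apply/matrixP => i k; rewrite !mxE.
split=> // [|c cr]; first exact: maxrowsub_free.
rewrite eqM -eqW.
(* Adjoining c to the family cannot enlarge its span, by maximality. *)
pose rho' (i : 'I_(r + 1)) := match fintype.split i with inl i => rho i | inr _ => c end.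
have e' : \matrix_(i, k) alpha (rho' i k) = col_mx M (\row_k alpha (c k)).
  apply/matrixP => i k; rewrite !mxE /rho'.
  by case: (fintype.split i) => a; rewrite !mxE.
have PW' : P <<col_mx M (\row_k alpha (c k))>>%MS.
  exists (r + 1)%N, rho'; split; last by rewrite e'; exact: genmxE.
  by move=> i; rewrite /rho'; case: (fintype.split i).
have := maxW _ PW'; rewrite !genmxE eqW -addsmxE addsmxSl => /(_ isT).
by apply: submx_trans; rewrite -addsmxE addsmxSr.
Qed.

(* [M b] is multiplication by b on the fibre, presented as the quotient P of
   L^N by the specialized relations; q is the class of 1. *)
Lemma fibre_representation : exists r (rho : 'I_r -> 'I_N -> A) d
    (M : B -> 'M[L]_d) (q : 'rV_d) (P : 'M[L]_(N, d)),
  [/\ [/\ (r + d = N)%N, forall i, relation (rho i) &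
        row_free (\matrix_(i, k) alpha (rho i k))],
      [/\ {morph M : x y / x + y}, {morph M : x y / x * y >-> x *m y} &
        forall a, M (phi a) = (alpha a)%:M],
      forall i, q *m M (g i) = row i P & row_full P].
Proof.
have [r [rho [rel free maxr]]] := max_relations.
set Rm := \matrix_(i, k) _ in free maxr.
pose C := cokermx Rm.
pose P := col_base C; pose S := pinvmx P.
have SP : S *m P = 1%:M by apply: mulVpmx; exact: col_base_full.
(* P is the quotient map of L^N by the span of the relations, and S is a section of it. *)
have leP m (U : 'M[L]_(m, N)) : (U <= Rm)%MS = (U *m P == 0).
  rewrite submxE -/C -[C in LHS]mulmx_base mulmxA.
  by rewrite -(mul0mx _ (row_base C)) (inj_eq (row_free_inj (row_base_free C))).
have relP c : relation c -> \row_k alpha (c k) *m P = 0.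
  by move=> /maxr; rewrite leP => /eqP.
have congP c c' : \sum_i phi (c i) * g i = \sum_i phi (c' i) * g i ->
    \row_k alpha (c k) *m P = \row_k alpha (c' k) *m P.
  move=> e; apply/eqP; rewrite -subr_eq0 -mulmxBl; apply/eqP.
  have -> : \row_k alpha (c k) - \row_k alpha (c' k) =
            \row_k alpha (c k - c' k).
    by apply/rowP => k; rewrite !mxE rmorphB.
  apply: relP; rewrite /relation.
  under eq_bigr => i _ do rewrite rmorphB mulrBl.
  by rewrite sumrB e subrr.
have [m mP] : {m : B -> 'I_N -> 'I_N -> A |
    forall b k, b * g k = \sum_l phi (m b k l) * g l}.
  have h (bk : B * 'I_N) : exists c : 'I_N -> A,
    bk.1 * g bk.2 = \sum_l phi (c l) * g l by exact: g_gen.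
  by have [f fP] := choice h; exists (fun b k => f (b, k)) => b k; rewrite (fP (b, k)).
pose Mm b : 'M[L]_N := \matrix_(k, l) alpha (m b k l).
have rowMm b k : row k (Mm b) = \row_l alpha (m b k l).
  by apply/rowP => l; rewrite !mxE.
have Mm_row b (c : 'I_N -> A) :
  \row_k alpha (c k) *m Mm b = \row_l alpha (\sum_k c k * m b k l).
  by apply/rowP => l; rewrite !mxE rmorph_sum; apply: eq_bigr => k _; rewrite !mxE rmorphM.
have mulsum b (c : 'I_N -> A) :
    \sum_l phi (\sum_k c k * m b k l) * g l = b * \sum_k phi (c k) * g k.
  under eq_bigr => l _ do rewrite rmorph_sum mulr_suml.
  rewrite exchange_big mulr_sumr; apply: eq_bigr => k _ /=.
  rewrite mulrCA mP mulr_sumr; apply: eq_bigr => l _.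
  by rewrite rmorphM mulrA.
(* Multiplication by b preserves the span of the relations, so [Mm b] descends to the quotient. *)
have stP b p (U : 'M[L]_(p, N)) : U *m P = 0 -> U *m Mm b *m P = 0.
  move=> /eqP; rewrite -leP => /submxP[X ->].
  suff e : Rm *m Mm b *m P = 0 by rewrite -2!mulmxA [Rm *m _]mulmxA e mulmx0.
  apply/row_matrixP => i; rewrite row0 row_mul row_mul.
  have -> : row i Rm = \row_k alpha (rho i k) by apply/rowP => k; rewrite !mxE.
  by rewrite Mm_row; apply: relP; rewrite /relation mulsum rel mulr0.
pose M b := S *m Mm b *m P.
have PM b : Mm b *m P = P *m M b.
  apply/eqP; rewrite -subr_eq0 /M 2!mulmxA -mulmxBl -[X in X - _]mul1mx.
  rewrite -mulmxBl; apply/eqP/stP.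
  by rewrite mulmxBl mul1mx -mulmxA SP mulmx1 subrr.
have Minj b X : Mm b *m P = P *m X -> M b = X.
  by move=> e; rewrite /M -mulmxA e mulmxA SP mul1mx.
have [e eP] := g_gen 1.
exists r, rho, (\rank C), M, (\row_k alpha (e k) *m P), P; split.
- have rk : \rank Rm = r by apply/eqP.
  by split=> //; rewrite mxrank_coker rk subnKC // -[X in (X <= _)%N]rk rank_leq_col.
- split.
  + move=> x y; apply: Minj; rewrite mulmxDr -!PM -mulmxDl.
    apply/row_matrixP => k; rewrite !row_mul linearD /= !rowMm.
    have -> : \row_l alpha (m x k l) + \row_l alpha (m y k l) =
              \row_l alpha (m x k l + m y k l).
      by apply/rowP => l; rewrite !mxE rmorphD.
    apply: congP; rewrite -mP mulrDl !mP -big_split /=.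
    by apply: eq_bigr => l _; rewrite rmorphD mulrDl.
  + move=> x y; apply: Minj; rewrite mulmxA -PM -mulmxA -PM mulmxA.
    apply/row_matrixP => k; rewrite !row_mul !rowMm Mm_row.
    by apply: congP; rewrite mulsum -!mP mulrCA mulrA.
  + move=> a; apply: Minj; rewrite mul_mx_scalar.
    apply/row_matrixP => k.
    have -> : alpha a *: P = (alpha a *: 1%:M) *m P by rewrite -scalemxAl mul1mx.
    rewrite 2!row_mul rowMm.
    have -> : row k (alpha a *: 1%:M) = \row_l alpha (a * (k == l)%:R).
      by apply/rowP => l; rewrite !mxE rmorphM rmorph_nat.
    apply: congP; rewrite -mP (bigD1 k) //= eqxx mulr1 big1 ?addr0 // => l.
    by rewrite eq_sym => /negPf ->; rewrite mulr0 rmorph0 mul0r.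
- move=> i; rewrite -mulmxA -PM mulmxA Mm_row.
  have -> : row i P = \row_l alpha ((i == l)%:R) *m P.
    rewrite -[in LHS](mul1mx P) row_mul; congr (_ *m _).
    by apply/rowP => l; rewrite !mxE rmorph_nat.
  apply: congP; rewrite mulsum -eP mulr1 (bigD1 i) //= eqxx rmorph1 mul1r.
  rewrite big1 ?addr0 // => l.
  by rewrite eq_sym => /negPf ->; rewrite rmorph0 mul0r.
- exact: col_base_full.
Qed.

End FibreModule.

(** Vanishing of the differentials of B over A at every field-valued point of B. *)
Definition no_derivation (A B : comPzRingType) (phi : {rmorphism A -> B}) :=
  forall (E : fieldType) (chi : {rmorphism B -> E}) (delta : B -> E),
    zmod_morphism delta ->
    (forall x y, delta (x * y) = chi x * delta y + chi y * delta x) ->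
    (forall a, delta (phi a) = 0) -> forall b, delta b = 0.

Section UnramifiedFibre.
Variables (A B : comPzRingType) (phi : {rmorphism A -> B}).
Variables (N : nat) (g : 'I_N -> B).
Hypothesis g_gen : forall y, exists c : 'I_N -> A, y = \sum_(i < N) phi (c i) * g i.
Hypothesis phi_unr : no_derivation phi.
Variables (L : fieldType) (alpha : {rmorphism A -> L}).

Section Representation.
Variables (d : nat) (M : B -> 'M[L]_d.+1).
Hypothesis MD : {morph M : x y / x + y}.
Hypothesis MM : {morph M : x y / x * y >-> x *m y}.
Hypothesis Mphi : forall a, M (phi a) = (alpha a)%:M.

Let M_comm x y : M x *m M y = M y *m M x.
Proof. by rewrite -!MM mulrC. Qed.

Let M_lin (c : 'I_N -> A) :
  M (\sum_i phi (c i) * g i) = \sum_i alpha (c i) *: M (g i).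
Proof.
have M0 : M 0 = 0 by rewrite -(rmorph0 phi) Mphi rmorph0 raddf0.
rewrite (big_morph _ MD M0); apply: eq_bigr => i _.
by rewrite MM Mphi mul_scalar_mx.
Qed.

Section Extension.
Variables (E : fieldType) (kappa : {rmorphism L -> E}).
Let G b : 'M[E]_d.+1 := map_mx kappa (M b).

Hypothesis G_split : forall i, exists rs : seq E,
  char_poly (G (g i)) = \prod_(r <- rs) ('X - r%:P).

Let GM x y : G (x * y) = G x *m G y. Proof. by rewrite /G MM map_mxM. Qed.

Let G_lin (c : 'I_N -> A) :
  G (\sum_i phi (c i) * g i) = \sum_i kappa (alpha (c i)) *: G (g i).
Proof.
rewrite /G M_lin map_mx_sum /=; apply: eq_bigr => i _; exact: map_mxZ.
Qed.

Let G_comm x y : G x *m G y = G y *m G x.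
Proof. by rewrite -!GM mulrC. Qed.

(** The span of the [G (g i)] is a subalgebra, so polynomials in [G b] qualify as the nilpotent of
    [nilpotent_cocycle]. *)
Lemma horner_span b (p : {poly E}) :
  exists t : 'I_N -> E, horner_mx (G b) p = \sum_i t i *: G (g i).
Proof.
elim/poly_ind: p => [|p a [t IH]].
  exists (fun=> 0); rewrite rmorph0 big1 // => i _; exact: scale0r.
have sp x : exists t : 'I_N -> E, G x = \sum_i t i *: G (g i).
  have [c ->] := g_gen x; exists (fun i => kappa (alpha (c i))); exact: G_lin.
have [t1 t1E] := sp 1.
have [tb tbE] := choice (fun i => sp (g i * b)).
exists (fun k => \sum_i t i * tb i k + a * t1 k).
rewrite rmorphD rmorphM /= horner_mx_X horner_mx_C IH -mulmxE mulmx_suml.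
have -> : a%:M = a *: G 1.
  have -> : G 1 = 1%:M by rewrite /G -(rmorph1 phi) Mphi rmorph1 map_mx1.
  by rewrite scalemx1.
rewrite t1E scaler_sumr; under [RHS]eq_bigr do rewrite scalerDl.
rewrite big_split /=; congr (_ + _).
  under [RHS]eq_bigr => k _ do rewrite scaler_suml.
  rewrite exchange_big; apply: eq_bigr => i _ /=.
  rewrite -scalemxAl -GM tbE scaler_sumr; apply: eq_bigr => k _.
  by rewrite scalerA.
by apply: eq_bigr => i _; rewrite scalerA.
Qed.

(** A nonzero element of square zero would yield, through [nilpotent_cocycle], a character X of B
    and a derivation D over X that vanishes on A but not on some generator. *)
Lemma unramified_reduced b p :
  horner_mx (G b) p *m horner_mx (G b) p = 0 -> horner_mx (G b) p = 0.
Proof.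
move=> sq0; apply/eqP; case: (boolP (_ == _)) => // nz.
have [t tE] := horner_span b p.
have [chi [v [w [l [v0 vE wl [i0 nzi]]]]]] :=
  nilpotent_cocycle (fun i k => G_comm (g i) (g k)) tE sq0 nz G_split.
have [c cE] := choice g_gen.
pose X b := \sum_i kappa (alpha (c b i)) * chi i.
have GE x : G x = \sum_i kappa (alpha (c x i)) *: G (g i).
  by rewrite {1}(cE x) G_lin.
(* The common eigenvector v makes X independent of the chosen coefficients [c], and the morphism
   laws of X can be read off from its action on v. *)
have vX x : v *m G x = X x *: v.
  rewrite GE mulmx_sumr scaler_suml; apply: eq_bigr => i _.
  by rewrite -scalemxAr vE scalerA.
have vinj s s' : s *: v = s' *: v -> s = s'.
  move=> /eqP; rewrite -subr_eq0 -scalerBl scaler_eq0 (negPf v0) orbF.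
  by rewrite subr_eq0 => /eqP.
have GB x y : G (x - y) = G x - G y.
  rewrite /G -map_mxB; congr map_mx; apply/eqP.
  by rewrite eq_sym subr_eq -MD subrK.
have XB : zmod_morphism X.
  by move=> x y; apply: vinj; rewrite -vX GB mulmxBr !vX scalerBl.
have Xphi a : X (phi a) = kappa (alpha a).
  by apply: vinj; rewrite -vX /G Mphi map_scalar_mx mul_mx_scalar.
have XM : monoid_morphism X.
  split; first by rewrite -(rmorph1 phi) Xphi !rmorph1.
  by move=> x y; apply: vinj; rewrite -vX GM mulmxA vX -scalemxAl vX scalerA.
pose D x := (w *m (G x - (X x)%:M) *m l) 0 0.
have GX x : G x - (X x)%:M = \sum_i kappa (alpha (c x i)) *: (G (g i) - (chi i)%:M).
  rewrite GE /X -scalemx1 scaler_suml -sumrB; apply: eq_bigr => i _.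
  by rewrite scalerBr -scalerA scalemx1.
have ww x y : w *m (G x - (X x)%:M) *m (G y - (X y)%:M) *m l = 0.
  rewrite !GX mulmx_sumr !mulmx_suml big1 // => i _.
  rewrite mulmx_sumr !mulmx_suml big1 // => k _.
  by rewrite -!(scalemxAl, scalemxAr) wl !scaler0.
have DB : zmod_morphism D.
  move=> x y; rewrite /D GB XB.
  have -> : G x - G y - (X x - X y)%:M = (G x - (X x)%:M) - (G y - (X y)%:M).
    by rewrite raddfB /= opprB !opprD opprK !addrA addrAC [X in X + _]addrAC.
  by rewrite mulmxBr mulmxBl [LHS]mxE [X in _ + X]mxE.
have DM x y : D (x * y) = X x * D y + X y * D x.
  have e : G (x * y) - (X (x * y))%:M =
      (G x - (X x)%:M) *m (G y - (X y)%:M) +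
      (X x *: (G y - (X y)%:M) + X y *: (G x - (X x)%:M)).
    rewrite XM.2 GM mulmxBl !mulmxBr !mul_mx_scalar !mul_scalar_mx.
    rewrite !scalerBr !scale_scalar_mx [X y * X x]mulrC.
    by rewrite addrA subrK addrA subrK.
  rewrite /D e mulmxDr mulmxDl mulmxA ww add0r mulmxDr mulmxDl.
  by rewrite -!scalemxAr -!scalemxAl mxE; congr (_ + _); rewrite mxE.
have Dphi a : D (phi a) = 0.
  by rewrite /D Xphi /G Mphi map_scalar_mx subrr mulmx0 mul0mx mxE.
have := phi_unr (chi := fun_rmorph XB XM) DB DM Dphi (g i0).
have Xg : X (g i0) = chi i0 by apply: vinj; rewrite -vX vE.
rewrite /D Xg => e; case/eqP: nzi; apply/matrixP => i k.
by rewrite !ord1 e mxE.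
Qed.

End Extension.

(* A double root of the minimal polynomial would give a nonzero nilpotent after
   a splitting extension. *)
Lemma mxminpoly_separable b : separable_poly (mxminpoly (M b)).
Proof.
(* One extension has to split the minimal polynomial of [M b] and all the characteristic
   polynomials, hence the product. *)
pose p0 := mxminpoly (M b) * \prod_i char_poly (M (g i)).
have mp : mxminpoly (M b) \is monic by exact: mxminpoly_monic.
have mp0 : p0 \is monic.
  by rewrite monicMl // monic_prod // => i _; exact: char_poly_monic.
have [E [kap [rs rsE]]] := splitting_field_ex mp0.
have spl (q : {poly L}) : q \is monic -> q %| p0 ->
    exists rs, map_poly kap q = \prod_(r <- rs) ('X - r%:P).
  move=> mq qp; have : map_poly kap q %| \prod_(r <- rs) ('X - r%:P).
    by rewrite -rsE dvdp_map.
  move=> /dvdp_prod_XsubC[m]; rewrite eqp_monic ?map_monic ?monic_prod_XsubC //.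
  by move=> /eqP ->; eexists.
have Gspl i : exists rs : seq E,
    char_poly (map_mx kap (M (g i))) = \prod_(r <- rs) ('X - r%:P).
  rewrite -map_char_poly; apply: spl; first exact: char_poly_monic.
  by rewrite /p0 (bigD1 i) //= mulrCA dvdp_mulr.
have [us usE] : exists rs, map_poly kap (mxminpoly (M b)) = \prod_(r <- rs) ('X - r%:P).
  by apply: spl => //; exact: dvdp_mulr.
rewrite -(separable_map kap) usE separable_prod_XsubC.
apply: contraT => nu.
have [r [q pE]] : exists r q, \prod_(r <- us) ('X - r%:P) = ('X - r%:P) * (('X - r%:P) * q).
  elim: us {usE} nu => //= x us IH; rewrite negb_and negbK big_cons.
  case/orP=> [xus|/IH[r [q ->]]]; last first.
    by exists r, (('X - x%:P) * q); rewrite mulrCA [('X - x%:P) * (_ * _)]mulrCA.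
  exists x; rewrite (perm_big _ (perm_to_rem xus)) big_cons /=.
  by eexists.
pose h := ('X - r%:P) * q.
have minE : mxminpoly (map_mx kap (M b)) = ('X - r%:P) * h.
  by rewrite mxminpoly_map usE.
have h0 : h != 0.
  apply/eqP => e; have := mxminpoly_monic (map_mx kap (M b)).
  by rewrite minE e mulr0 monicE lead_coef0 eq_sym oner_eq0.
have hh : horner_mx (map_mx kap (M b)) h *m horner_mx (map_mx kap (M b)) h = 0.
  rewrite mulmxE -rmorphM; apply/eqP; rewrite -dvd_mxminpoly minE.
  have -> : h * h = ('X - r%:P) * h * q by rewrite {2}/h mulrCA mulrA.
  exact: dvdp_mulr.
have /eqP := unramified_reduced Gspl hh.
rewrite -dvd_mxminpoly minE => /dvdp_leq -/(_ h0).
by rewrite size_monicM ?monicXsubC // size_XsubC /= ltnn.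
Qed.

End Representation.
End UnramifiedFibre.

Lemma separable_split (F : fieldType)
  (F_closed : forall p : {poly F}, separable_poly p -> (1 < size p)%N ->
     exists x, root p x) (p : {poly F}) :
  separable_poly p -> p \is monic ->
  exists2 rs, uniq rs & p = \prod_(r <- rs) ('X - r%:P).
Proof.
have [k] := ubnP (size p); elim: k p => // k IH p sz sp mp.
suff [rs pE] : exists rs, p = \prod_(r <- rs) ('X - r%:P).
  by exists rs => //; rewrite -separable_prod_XsubC -pE.
have [sp1|sp1] := leqP (size p) 1.
  exists [::]; rewrite big_nil.
  by move: mp; rewrite (size1_polyC sp1) monicE lead_coefC => /eqP ->.
have [x /factor_theorem[q pE]] := F_closed p sp sp1.
have mq : q \is monic by move: mp; rewrite pE monicMr // monicXsubC.
have [|||rs _ qE] := IH q => //.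
- rewrite ltnS in sz; apply: leq_trans sz.
  by rewrite pE size_Mmonic ?monicXsubC ?monic_neq0 // size_XsubC addn2.
- by apply: dvdp_separable sp; rewrite pE dvdp_mulr.
by exists (x :: rs); rewrite big_cons pE qE mulrC.
Qed.

(* The multiplication matrices are simultaneously diagonalizable; since 1 is a
   cyclic vector, the characters on the diagonal are pairwise distinct. *)
Lemma unramified_fibre_points (A B : comPzRingType) (phi : {rmorphism A -> B})
    (N : nat) (g : 'I_N -> B)
    (g_gen : forall y, exists c : 'I_N -> A, y = \sum_(i < N) phi (c i) * g i)
    (phi_unr : no_derivation phi)
    (L F : fieldType) (alpha : {rmorphism A -> L}) (iota : {rmorphism L -> F})
    (F_closed : forall p : {poly F}, separable_poly p -> (1 < size p)%N ->
       exists x, root p x) :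
  exists r (rho : 'I_r -> 'I_N -> A) d (psi : 'I_d -> {rmorphism B -> F}),
  [/\ (r + d = N)%N, forall i, relation phi g (rho i),
      row_free (\matrix_(i, k) alpha (rho i k)),
      forall t a, psi t (phi a) = iota (alpha a) &
      forall t t', psi t =1 psi t' -> t = t'].
Proof.
have [r [rho [d [M [q [P [[rdN rel free] [MD MM Mphi] qM Pfull]]]]]]] :=
  fibre_representation g_gen alpha.
(* Matrices of size 0 form no nonzero ring, so the zero fibre, which has no points, is treated
   apart. *)
exists r, rho, d; case: d => [|d] in M q P rdN MD MM Mphi qM Pfull *.
  have psi0 : 'I_0 -> {rmorphism B -> F} by case.
  by exists psi0; split => // -[].
pose G b : 'M[F]_d.+1 := map_mx iota (M b).
have GM x y : G (x * y) = G x *m G y by rewrite /G MM map_mxM.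
have G_comm x y : G x *m G y = G y *m G x by rewrite -!GM mulrC.
have [T Tu Tdiag] : codiagonalizable [seq G (g i) | i <- enum 'I_N].
  apply/codiagonalizableP; split.
    by move=> _ _ /mapP[i _ ->] /mapP[k _ ->]; exact: G_comm.
  move=> _ /mapP[i _ ->]; apply/diagonalizableP.
  have sep := mxminpoly_separable g_gen phi_unr MD MM Mphi (g i).
  have [||rs urs rsE] := @separable_split _ F_closed (mxminpoly (G (g i))).
  - by rewrite /G mxminpoly_map separable_map.
  - exact: mxminpoly_monic.
  by exists rs => //; rewrite rsE.
pose D b := T *m G b *m invmx T.
have DE b : D b = T *m G b *m invmx T by [].
have Dg i s t : s != t -> D (g i) s t = 0.
  move=> st; have GA : G (g i) \in [seq G (g i) | i <- enum 'I_N].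
    by apply/mapP; exists i; rewrite ?mem_enum.
  by have /(diagonalizable_forP _ Tu) := allP Tdiag _ GA; apply.
have DD x y : D (x + y) = D x + D y.
  by rewrite /D /G MD map_mxD mulmxDr mulmxDl.
have DB x y : D (x - y) = D x - D y.
  by apply/eqP; rewrite eq_sym subr_eq -DD subrK.
have DM x y : D (x * y) = D x *m D y.
  by rewrite /D GM !mulmxA mulmxKV.
have Dphi a : D (phi a) = (iota (alpha a))%:M.
  by rewrite /D /G Mphi map_scalar_mx mul_mx_scalar -scalemxAl mulmxV // scalemx1.
have D0 : D 0 = 0 by rewrite -(subrr 0) DB subrr.
have D_off b s t : s != t -> D b s t = 0.
  move=> st; have [c ->] := g_gen b.
  rewrite (big_morph D DD D0) summxE big1 // => i _.
  by rewrite DM Dphi mul_scalar_mx mxE Dg ?mulr0.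
have psiB t : zmod_morphism (fun b => D b t t).
  by move=> x y; rewrite DB !mxE.
have psiM t : monoid_morphism (fun b => D b t t).
  split; first by rewrite -(rmorph1 phi) Dphi !rmorph1 mxE eqxx.
  move=> x y; rewrite DM mxE (bigD1 t) //= big1 ?addr0 // => s st.
  by rewrite D_off ?mul0r // eq_sym.
exists (fun t => fun_rmorph (psiB t) (psiM t)); split => //.
  by move=> t a; rewrite /= /fun_rmorph Dphi mxE eqxx.
move=> t t' e; apply/eqP; apply: contraT => tt'.
(* In the diagonalizing basis, column s of P' is q'_s times the vector of the values psi_s (g i).
   Equal characters would make two columns proportional, whereas P' has full column rank. *)
pose q' := map_mx iota q *m invmx T.
pose P' := map_mx iota P *m invmx T.
have P'E i s : P' i s = q' 0 s * D (g i) s s.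
  have -> : P' i s = (row i P') 0 s by rewrite [RHS]mxE.
  have -> : row i P' = q' *m D (g i).
    by rewrite /P' row_mul -map_row -qM map_mxM /q' /D !mulmxA mulmxKV.
  rewrite mxE (bigD1 s) //= big1 ?addr0 // => s' ss'.
  by rewrite D_off ?mulr0.
have P'inj (u : 'cV_d.+1) : P' *m u = 0 -> u = 0.
  have e1 : (T *m pinvmx (map_mx iota P)) *m P' = 1%:M.
    rewrite /P' mulmxA -[_ *m map_mx iota P]mulmxA mulVpmx ?row_full_map //.
    by rewrite mulmx1 mulmxV.
  by move=> e0; rewrite -[u]mul1mx -e1 -[_ *m u]mulmxA e0 mulmx0.
move: q' P' P'E P'inj => q' P' P'E P'inj.
have q't s : q' 0 s != 0.
  apply/eqP => e0; have Pd : P' *m delta_mx s 0 = 0 :> 'cV_N.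
    by apply/matrixP => i k; rewrite ord1 -colE !mxE P'E e0 mul0r.
  have /matrixP/(_ s 0) := P'inj _ Pd.
  by rewrite !mxE !eqxx => /eqP; rewrite oner_eq0.
have Pd : P' *m (q' 0 t' *: delta_mx t 0 - q' 0 t *: delta_mx t' 0) = 0 :> 'cV_N.
  apply/matrixP => i k; rewrite ord1 mulmxBr -!scalemxAr -!colE !mxE !P'E.
  by have := e (g i); rewrite /= /fun_rmorph => ->; rewrite mulrCA subrr.
have /matrixP/(_ t 0) := P'inj _ Pd.
rewrite !mxE !eqxx (negPf tt') /= mulr1 mulr0 subr0 => /eqP.
by rewrite (negPf (q't t')).
Qed.

(** * Derivations and independence of characters *)

Section DualNumbers.
Variable E : comPzRingType.

(** The ring E[eps]/(eps^2); the new name keeps its multiplication apart from the componentwise one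
    on pairs. *)
Definition dual_number := (E * E)%type.
HB.instance Definition _ := GRing.Zmodule.on dual_number.

Definition dual_mul (x y : dual_number) : dual_number :=
  (x.1 * y.1, x.1 * y.2 + y.1 * x.2).

Lemma dual_mulA : associative dual_mul.
Proof.
move=> [a b] [c d] [e f]; rewrite /dual_mul /=; congr (_, _); ring.
Qed.

Lemma dual_mulC : commutative dual_mul.
Proof. by move=> [a b] [c d]; rewrite /dual_mul /= mulrC addrC. Qed.

Lemma dual_mul1 : left_id ((1, 0) : dual_number) dual_mul.
Proof. by move=> [a b]; rewrite /dual_mul /= !mul1r mulr0 addr0. Qed.

Lemma dual_mulDl : left_distributive dual_mul +%R.
Proof.
move=> [a b] [c d] [e f]; rewrite /dual_mul /=; congr (_, _); first exact: mulrDl.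
by rewrite mulrDl mulrDr addrACA.
Qed.

HB.instance Definition _ := GRing.Zmodule_isComPzRing.Build dual_number
  dual_mulA dual_mulC dual_mul1 dual_mulDl.

Lemma dual_fst_zmod : zmod_morphism (fst : dual_number -> E).
Proof. by move=> [a b] [c d]. Qed.
Lemma dual_fst_monoid : monoid_morphism (fst : dual_number -> E).
Proof. by split=> // -[a b] [c d]. Qed.

End DualNumbers.

(** Both chi + eps delta and chi lift chi to the dual numbers and agree on A, so uniqueness of the
    lifting forces delta = 0. *)
Lemma formally_etale_no_derivation (A B : comPzRingType)
  (phi : {rmorphism A -> B}) : formally_etale phi -> no_derivation phi.
Proof.
move=> et E chi delta dB dM dphi b.
have d1 : delta 1 = 0 by rewrite -(rmorph1 phi).
have d0 : delta 0 = 0 by rewrite -(rmorph0 phi).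
pose lift (e : B -> E) (x : B) : dual_number E := (chi x, e x).
have liftB e : zmod_morphism e -> zmod_morphism (lift e).
  by move=> eB x y; rewrite /lift rmorphB eB.
have liftM e : e 1 = 0 -> (forall x y, e (x * y) = chi x * e y + chi y * e x) ->
    monoid_morphism (lift e).
  by move=> e1 eM; split=> [|x y]; rewrite /lift ?rmorph1 ?e1 ?rmorphM ?eM.
have zB : zmod_morphism (fun _ : B => 0 : E) by move=> x y; rewrite subr0.
have zM (x y : B) : 0 = chi x * 0 + chi y * 0 :> E by rewrite !mulr0 addr0.
pose w := fun_rmorph (liftB _ dB) (liftM _ d1 dM).
pose w' := fun_rmorph (liftB _ zB) (liftM _ erefl zM).
pose q := fun_rmorph (@dual_fst_zmod E) (@dual_fst_monoid E).
have [|||_ uniq] := et (dual_number E) E q (w \o phi) chi.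
- by move=> d; exists (d, 0).
- move=> [x1 x2] [y1 y2] /= hx hy.
  rewrite /q /fun_rmorph /= in hx hy; subst x1 y1.
  by rewrite /GRing.mul /= /dual_mul /= !mul0r addr0.
- by [].
have : w =1 w'.
  apply: uniq => // a.
  by rewrite /= /w /w' /fun_rmorph /lift dphi.
by move=> /(_ b) [].
Qed.

(** Artin's argument: subtracting [psi i b0] times the relation from its translate by b0 kills the
    coefficient at i, keeps that at j, and leaves fewer nonzero coefficients. *)
Lemma rmorph_independent (B : comPzRingType) (F : fieldType) k
    (psi : 'I_k -> {rmorphism B -> F}) (c : 'I_k -> F) :
  (forall i j, psi i =1 psi j -> i = j) ->
  (forall b, \sum_i c i * psi i b = 0) -> forall i, c i = 0.
Proof.
move=> inj; have [s] := ubnP #|[pred i | c i != 0]|.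
elim: s c => // s IH c cs c0 i; apply/eqP; apply: contraT => ci.
have only j : j != i -> c j = 0.
  move=> ji; apply/eqP; apply: contraT => cj.
  have [b0 b0P] : exists b, psi j b - psi i b != 0.
    apply: contrapT => /forallNP h; case/eqP: ji; apply: inj => b.
    by apply/eqP; rewrite -subr_eq0; have /negP := h b; rewrite negbK.
  suff h l : c l * (psi l b0 - psi i b0) = 0.
    by have /eqP := h j; rewrite mulf_eq0 (negPf cj) (negPf b0P).
  apply: (IH (fun l => c l * (psi l b0 - psi i b0))) => [|b].
    rewrite ltnS in cs; apply: leq_trans cs; apply: proper_card.
    apply/properP; split; last by exists i; rewrite !inE ?subrr ?mulr0 ?eqxx.
    by apply/fintype.subsetP => a; rewrite !inE mulf_eq0 negb_or => /andP[].
  transitivity (\sum_l c l * psi l (b0 * b) - psi i b0 * \sum_l c l * psi l b).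
    rewrite mulr_sumr -sumrB; apply: eq_bigr => a _.
    by rewrite rmorphM; ring.
  by rewrite !c0 mulr0 subr0.
have := c0 1; rewrite (bigD1 i) //= big1 => [|j ji]; last by rewrite only ?mul0r.
by rewrite rmorph1 mulr1 addr0 => /eqP; rewrite (negPf ci).
Qed.

(** The vectors of values on the generators are k independent rows, by independence of characters,
    and they are orthogonal to the r independent rows of relations in F^N. *)
Lemma fibre_points_bound (A B : comPzRingType) (phi : {rmorphism A -> B})
    (N : nat) (g : 'I_N -> B)
    (g_gen : forall y, exists c : 'I_N -> A, y = \sum_(i < N) phi (c i) * g i)
    (L F : fieldType) (alpha : {rmorphism A -> L}) (iota : {rmorphism L -> F})
    r (rho : 'I_r -> 'I_N -> A) k (psi : 'I_k -> {rmorphism B -> F}) :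
  (forall i, relation phi g (rho i)) ->
  row_free (\matrix_(i, k) alpha (rho i k)) ->
  (forall t a, psi t (phi a) = iota (alpha a)) ->
  (forall t t', psi t =1 psi t' -> t = t') -> (r + k <= N)%N.
Proof.
move=> rel free psiA inj.
pose P : 'M[F]_(k, N) := \matrix_(i, l) psi i (g l).
pose Q := map_mx iota (\matrix_(i, k) alpha (rho i k)).
have Pfree : row_free P.
  apply: inj_row_free => v vP; apply/rowP => i; rewrite mxE.
  apply: (rmorph_independent (c := fun i => v 0 i) inj) => b.
  have [c ->] := g_gen b.
  have vPl l : \sum_i0 v 0 i0 * psi i0 (g l) = 0.
    transitivity ((v *m P) 0 l); last by rewrite vP mxE.
    by rewrite mxE; apply: eq_bigr => a _; rewrite mxE.
  under eq_bigr => j _ do rewrite rmorph_sum mulr_sumr.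
  rewrite exchange_big big1 // => l _ /=.
  transitivity (iota (alpha (c l)) * \sum_i0 v 0 i0 * psi i0 (g l)).
    rewrite mulr_sumr; apply: eq_bigr => j _.
    by rewrite rmorphM psiA mulrCA.
  by rewrite vPl mulr0.
have PQ : P *m Q^T = 0.
  apply/matrixP => i l; rewrite !mxE.
  transitivity (psi i (\sum_k0 phi (rho l k0) * g k0)); last by rewrite rel rmorph0.
  rewrite rmorph_sum; apply: eq_bigr => j _.
  by rewrite !mxE rmorphM psiA mulrC.
have := mulmx0_rank_max PQ; rewrite mxrank_tr mxrank_map.
by move: Pfree free; rewrite /row_free => /eqP -> /eqP ->; rewrite addnC.
Qed.

(** * Infinitesimal lifting as Newton's method *)

Lemma peval_rmorph (A B C : comPzRingType) (phi : A -> B) (h : {rmorphism B -> C})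
    n (b : 'I_n -> B) (e : pexpr A n) :
  h (peval phi b e) = peval (h \o phi) (h \o b) e.
Proof.
by elim: e => //= e1 IH1 e2 IH2; rewrite ?rmorphD ?rmorphM /= IH1 IH2.
Qed.

Lemma eq_peval (A B : comPzRingType) (phi phi' : A -> B) n (b b' : 'I_n -> B)
    (e : pexpr A n) :
  phi =1 phi' -> b =1 b' -> peval phi b e = peval phi' b' e.
Proof. by move=> pE bE; elim: e => //= e1 -> e2 ->. Qed.

Fixpoint psubst (A : Type) n (c : 'I_n -> pexpr A n) (e : pexpr A n) :=
  match e with
  | PCst a => PCst n a
  | PVar i => c i
  | PAdd e1 e2 => PAdd (psubst c e1) (psubst c e2)
  | PMul e1 e2 => PMul (psubst c e1) (psubst c e2)
  end.

Lemma peval_subst (A B : comPzRingType) (phi : A -> B) n (b : 'I_n -> B) c e :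
  peval phi b (psubst c e) = peval phi (fun i => peval phi b (c i)) e.
Proof. by elim: e => //= e1 -> e2 ->. Qed.

Section PolynomialQuotient.
Variables (A : comPzRingType) (n : nat) (I : finType) (s : I -> pexpr A n).

Let expr := pexpr A n.
Local Notation PCst := (@PCst A n).

(* Congruence modulo the ideal generated by s in A[X_0, ..., X_(n-1)], where
   polynomial identities are tested in all A-algebras. *)
Definition pcong (e e' : expr) := exists q : I -> expr,
  forall (C : comPzRingType) (psi : {rmorphism A -> C}) (x : 'I_n -> C),
    peval psi x e =
    peval psi x e' + \sum_k peval psi x (q k) * peval psi x (s k).

Lemma pcong_eq (e e' : expr) :
  (forall (C : comPzRingType) (psi : {rmorphism A -> C}) (x : 'I_n -> C),
     peval psi x e = peval psi x e') -> pcong e e'.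
Proof.
move=> h; exists (fun=> PCst 0) => C psi x; rewrite h big1 ?addr0 // => k _ /=.
by rewrite rmorph0 mul0r.
Qed.

Lemma pcong_sym (e e' : expr) : pcong e e' -> pcong e' e.
Proof.
move=> [q qE]; exists (fun k => PMul (PCst (-1)) (q k)) => C psi x.
rewrite qE -addrA -big_split big1 ?addr0 //= => k _.
by rewrite rmorphN1; ring.
Qed.

Lemma pcong_trans (e1 e2 e3 : expr) : pcong e1 e2 -> pcong e2 e3 -> pcong e1 e3.
Proof.
move=> [q qE] [q' q'E]; exists (fun k => PAdd (q k) (q' k)) => C psi x.
rewrite qE q'E -addrA -big_split; congr (_ + _); apply: eq_bigr => k _ /=; ring.
Qed.

Lemma pcong_add (e1 e2 f1 f2 : expr) :
  pcong e1 f1 -> pcong e2 f2 -> pcong (PAdd e1 e2) (PAdd f1 f2).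
Proof.
move=> [q qE] [q' q'E]; exists (fun k => PAdd (q k) (q' k)) => C psi x /=.
rewrite qE q'E addrACA -big_split; congr (_ + _); apply: eq_bigr => k _ /=; ring.
Qed.

Lemma pcong_mul (e1 e2 f1 f2 : expr) :
  pcong e1 f1 -> pcong e2 f2 -> pcong (PMul e1 e2) (PMul f1 f2).
Proof.
move=> [q qE] [q' q'E].
exists (fun k => PAdd (PMul (q k) e2) (PMul f1 (q' k))) => C psi x /=.
rewrite qE q'E mulrDl mulrDr -addrA; congr (_ + _).
under [in RHS]eq_bigr do rewrite mulrDl; rewrite big_split /= addrC; congr (_ + _).
  by rewrite mulr_suml; apply: eq_bigr => k _; ring.
by rewrite mulr_sumr; apply: eq_bigr => k _; ring.
Qed.

(** A model of A[X_0, ..., X_(n-1)]/(s) in which congruence of expressions becomes equality of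
    classes. *)
Definition pquot := {P : set expr | exists e, P = pcong e}.

HB.instance Definition _ := gen_eqMixin pquot.
HB.instance Definition _ := gen_choiceMixin pquot.

Definition pclass (e : expr) : pquot := exist _ (pcong e) (ex_intro _ e erefl).

Lemma pclassP e e' : pclass e = pclass e' <-> pcong e e'.
Proof.
split=> [[->]|h]; first exact: pcong_eq.
apply: eq_exist; apply/funext => f; apply/propext; split; apply: pcong_trans => //.
exact: pcong_sym.
Qed.

Lemma pclass_eq (e e' : expr) :
  (forall (C : comPzRingType) (psi : {rmorphism A -> C}) (x : 'I_n -> C),
     peval psi x e = peval psi x e') -> pclass e = pclass e'.
Proof. by move=> h; apply/pclassP/pcong_eq. Qed.

Definition prepr (x : pquot) : expr := projT1 (cid (projT2 x)).

Lemma preprK x : pclass (prepr x) = x.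
Proof.
by case: x => P hP; rewrite /prepr /=; case: cid => e /= eE; apply: eq_exist.
Qed.

Definition pquot_add x y := pclass (PAdd (prepr x) (prepr y)).
Definition pquot_mul x y := pclass (PMul (prepr x) (prepr y)).
Definition pquot_opp x := pclass (PMul (PCst (-1)) (prepr x)).

Lemma pclassD e f : pclass (PAdd e f) = pquot_add (pclass e) (pclass f).
Proof. by apply/pclassP/pcong_add; apply/pclassP; rewrite preprK. Qed.

Lemma pclassM e f : pclass (PMul e f) = pquot_mul (pclass e) (pclass f).
Proof. by apply/pclassP/pcong_mul; apply/pclassP; rewrite preprK. Qed.

Lemma pquotW (P : pquot -> Prop) : (forall e, P (pclass e)) -> forall x, P x.
Proof. by move=> h x; rewrite -(preprK x). Qed.

Lemma pquot_addA : associative pquot_add.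
Proof.
elim/pquotW => a; elim/pquotW => b; elim/pquotW => c.
by rewrite -!pclassD; apply: pclass_eq => C psi x /=; exact: addrA.
Qed.

Lemma pquot_addC : commutative pquot_add.
Proof.
elim/pquotW => a; elim/pquotW => b.
by rewrite -!pclassD; apply: pclass_eq => C psi x /=; exact: addrC.
Qed.

Lemma pquot_add0 : left_id (pclass (PCst 0)) pquot_add.
Proof.
elim/pquotW => a; rewrite -!pclassD; apply: pclass_eq => C psi x /=.
by rewrite rmorph0 add0r.
Qed.

Lemma pquot_addN : left_inverse (pclass (PCst 0)) pquot_opp pquot_add.
Proof.
elim/pquotW => a; rewrite /pquot_opp pclassM preprK -pclassM -pclassD.
apply: pclass_eq => C psi x /=.
by rewrite rmorphN1 rmorph0; ring.
Qed.

HB.instance Definition _ := GRing.isZmodule.Build pquot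
  pquot_addA pquot_addC pquot_add0 pquot_addN.

Lemma pquotDE e f : pclass e + pclass f = pclass (PAdd e f).
Proof. by rewrite pclassD. Qed.

Lemma pquot_mulA : associative pquot_mul.
Proof.
elim/pquotW => a; elim/pquotW => b; elim/pquotW => c.
by rewrite -!pclassM; apply: pclass_eq => C psi x /=; exact: mulrA.
Qed.

Lemma pquot_mulC : commutative pquot_mul.
Proof.
elim/pquotW => a; elim/pquotW => b.
by rewrite -!pclassM; apply: pclass_eq => C psi x /=; exact: mulrC.
Qed.

Lemma pquot_mul1 : left_id (pclass (PCst 1)) pquot_mul.
Proof.
elim/pquotW => a; rewrite -!pclassM; apply: pclass_eq => C psi x /=.
by rewrite rmorph1 mul1r.
Qed.

Lemma pquot_mulDl : left_distributive pquot_mul +%R.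
Proof.
elim/pquotW => a; elim/pquotW => b; elim/pquotW => c.
rewrite pquotDE -!pclassM pquotDE.
by apply: pclass_eq => C psi x /=; exact: mulrDl.
Qed.

HB.instance Definition _ := GRing.Zmodule_isComPzRing.Build pquot
  pquot_mulA pquot_mulC pquot_mul1 pquot_mulDl.

Lemma pquotME e f : pclass e * pclass f = pclass (PMul e f).
Proof. by rewrite pclassM. Qed.

Lemma pquot_cst_zmod : zmod_morphism (fun a => pclass (PCst a)).
Proof.
move=> a b; apply/eqP; rewrite eq_sym subr_eq; apply/eqP.
rewrite pquotDE; apply: pclass_eq => C psi x /=.
by rewrite -rmorphD subrK.
Qed.

Lemma pquot_cst_monoid : monoid_morphism (fun a => pclass (PCst a)).
Proof.
split=> // a b; rewrite pquotME; apply: pclass_eq => C psi x /=.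
exact: rmorphM.
Qed.

Definition pquot_cst : {rmorphism A -> pquot} :=
  fun_rmorph pquot_cst_zmod pquot_cst_monoid.

Lemma peval_pquot (c : 'I_n -> expr) (e : expr) :
  peval pquot_cst (fun i => pclass (c i)) e = pclass (psubst c e).
Proof.
elim: e => //= e1 -> e2 ->; first by rewrite pclassD.
by rewrite pclassM.
Qed.

Lemma psubst_var (e : expr) : psubst (@PVar A n) e = e.
Proof. by elim: e => //= e1 -> e2 ->. Qed.

Section Evaluation.
Variables (C : comPzRingType) (psi : {rmorphism A -> C}) (x : 'I_n -> C).
Hypothesis s0 : forall k, peval psi x (s k) = 0.

Definition pquot_ev (y : pquot) : C := peval psi x (prepr y).

Lemma pquot_evE e : pquot_ev (pclass e) = peval psi x e.
Proof.
have /pclassP[q qE] := preprK (pclass e).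
by rewrite /pquot_ev qE big1 ?addr0 // => k _; rewrite s0 mulr0.
Qed.

Lemma pquot_ev_zmod : zmod_morphism pquot_ev.
Proof.
move=> y z; apply/eqP; rewrite eq_sym subr_eq; apply/eqP; move: (y - z) (subrK z y).
elim/pquotW => a <-; move: z; elim/pquotW => c.
by rewrite pquotDE !pquot_evE.
Qed.

Lemma pquot_ev_monoid : monoid_morphism pquot_ev.
Proof.
split; first by rewrite /GRing.one /= pquot_evE /= rmorph1.
elim/pquotW => a; elim/pquotW => b.
by rewrite pquotME !pquot_evE.
Qed.

Definition pquot_eval : {rmorphism pquot -> C} :=
  fun_rmorph pquot_ev_zmod pquot_ev_monoid.

End Evaluation.
End PolynomialQuotient.

(* The section B -> A[X]/I^2 given by formal smoothness sends the generators to
   polynomials c_i congruent to X_i modulo I = (r) with r_k(c) in I^2, so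
   x |-> c(x) is a Newton step for the system r = 0. *)
Lemma newton_exprs (A B : comPzRingType) (phi : {rmorphism A -> B})
    n (b : 'I_n -> B) m (r : 'I_m -> pexpr A n) :
  (forall k, peval phi b (r k) = 0) ->
  (forall (C : comPzRingType) (psi : {rmorphism A -> C}) (c : 'I_n -> C),
      (forall k, peval psi c (r k) = 0) ->
      (exists w : {rmorphism B -> C},
         (forall a, w (phi a) = psi a) /\ (forall i, w (b i) = c i)) /\
      (forall w w' : {rmorphism B -> C},
         (forall a, w (phi a) = psi a) -> (forall i, w (b i) = c i) ->
         (forall a, w' (phi a) = psi a) -> (forall i, w' (b i) = c i) ->
         w =1 w')) ->
  formally_etale phi ->
  exists (c : 'I_n -> pexpr A n) (D : 'I_n -> 'I_m -> pexpr A n)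
    (Q : 'I_m -> 'I_m * 'I_m -> pexpr A n),
  forall (C : comPzRingType) (psi : {rmorphism A -> C}) (x : 'I_n -> C),
    (forall i, peval psi x (c i) =
       x i + \sum_l peval psi x (D i l) * peval psi x (r l)) /\
    (forall k, peval psi (fun i => peval psi x (c i)) (r k) =
       \sum_l peval psi x (Q k l) * (peval psi x (r l.1) * peval psi x (r l.2))).
Proof.
move=> r0 univ et.
pose rr (l : 'I_m * 'I_m) := PMul (r l.1) (r l.2).
have rr0 l : peval phi b (rr l) = 0 by rewrite /= r0 mul0r.
have X1r k : peval (pquot_cst r) (fun i => pclass r (PVar A i)) (r k) = 0.
  rewrite peval_pquot psubst_var; apply/pclassP.
  exists (fun l => PCst n ((l == k)%:R)) => C psi x /=.
  rewrite rmorph0 add0r (bigD1 k) //= eqxx rmorph1 mul1r big1 ?addr0 // => l.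
  by move=> /negPf ->; rewrite rmorph0 mul0r.
(* A map B -> A[X]/I under which evaluation at b becomes the projection: a polynomial vanishing at b
   therefore lies in I. *)
have [[w1 [w1A w1b]] _] := univ _ _ _ X1r.
have w1E e : w1 (peval phi b e) = pclass r e.
  rewrite peval_rmorph -[in RHS](psubst_var e) -peval_pquot.
  by apply: eq_peval => [a|i] /=.
have kerE e : peval phi b e = 0 -> pcong r e (PCst n 0).
  by move=> e0; apply/pclassP; rewrite -w1E e0 rmorph0.
pose q := pquot_eval rr0.
have qE e : q (pclass rr e) = peval phi b e by exact: (pquot_evE rr0).
(* By uniqueness in the presentation, the identity of B factors through A[X]/I, so every element of
   B is a polynomial in b. *)
have surj y : exists e, y = peval phi b e.
  have [_ uniq] := univ B phi b r0.
  exists (prepr (w1 y)); rewrite -(pquot_evE r0) preprK.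
  apply: (uniq idfun (pquot_eval r0 \o w1)) => //.
    move=> a /=; rewrite w1A; exact: (pquot_evE r0).
  move=> i /=; rewrite w1b; exact: (pquot_evE r0).
(* The kernel of A[X]/I^2 -> B is I/I^2, of square zero, and the identity of B is lifted along this
   map. *)
have [|||[w [wA qw]] _] := et _ B q (pquot_cst rr) idfun.
- by move=> y; have [e ->] := surj y; exists (pclass rr e).
- elim/pquotW => e; elim/pquotW => f.
  rewrite !qE => /kerE[qe eE] /kerE[qf fE].
  rewrite pquotME; apply/pclassP.
  exists (fun l => PMul (qe l.1) (qf l.2)) => C psi x /=.
  rewrite eE fE /= !rmorph0 !add0r mulr_suml.
  rewrite -(pair_bigA _ (fun i j => peval psi x (qe i) * peval psi x (qf j) *
    (peval psi x (r i) * peval psi x (r j)))) /=.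
  apply: eq_bigr => i _; rewrite mulr_sumr; apply: eq_bigr => j _; ring.
- by move=> a; rewrite qE.
pose c i := prepr (w (b i)).
have cE i : pclass rr (c i) = w (b i) by exact: preprK.
have [D DE] : exists D : 'I_n -> 'I_m -> pexpr A n, forall i
    (C : comPzRingType) (psi : {rmorphism A -> C}) (x : 'I_n -> C),
    peval psi x (c i) = x i + \sum_l peval psi x (D i l) * peval psi x (r l).
  suff h i : pcong r (c i) (PVar A i) by have [D DE] := choice h; exists D.
  have /kerE : peval phi b (PAdd (c i) (PMul (PCst n (-1)) (PVar A i))) = 0.
    by rewrite /= -qE cE qw rmorphN1 mulN1r subrr.
  case=> D DE; exists D => C psi x.
  by have := DE C psi x; rewrite /= rmorphN1 mulN1r rmorph0 add0r => <-; rewrite addrC subrK.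
have [Q QE] : exists Q : 'I_m -> 'I_m * 'I_m -> pexpr A n, forall k
    (C : comPzRingType) (psi : {rmorphism A -> C}) (x : 'I_n -> C),
    peval psi (fun i => peval psi x (c i)) (r k) =
       \sum_l peval psi x (Q k l) * (peval psi x (r l.1) * peval psi x (r l.2)).
  suff h k : pcong rr (psubst c (r k)) (PCst n 0).
    have [Q QE] := choice h; exists Q => k C psi x.
    by rewrite -peval_subst QE /= rmorph0 add0r.
  apply/pclassP; rewrite -peval_pquot.
  transitivity (w (peval phi b (r k))); last by rewrite r0 rmorph0.
  by rewrite peval_rmorph; apply: eq_peval => [a|i] /=; rewrite ?wA ?cE.
by exists c, D, Q => C psi x; split=> [i|k]; [exact: DE | exact: QE].
Qed.

(** * Norms over local fields *)

Section AbsoluteValue.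
Variables (R : realType) (L : localFieldType R).
Implicit Types x y : L.

Lemma absv0 : absv (0 : L) = 0. Proof. exact/absv_eq0. Qed.

Lemma absv1 : absv (1 : L) = 1.
Proof.
have h : absv (1 : L) != 0.
  by apply/eqP => /absv_eq0/eqP; rewrite oner_eq0.
by apply: (mulfI h); rewrite -absvM !mulr1.
Qed.

Lemma absvN x : absv (- x) = absv x.
Proof.
have h : absv (-1 : L) = 1.
  apply/eqP; rewrite -(eqrXn2 (n := 2)) ?absv_ge0 ?ler01 //.
  by rewrite expr2 -absvM mulrNN mulr1 absv1 expr1n.
by rewrite -mulN1r absvM h mul1r.
Qed.

Lemma absvC x y : absv (x - y) = absv (y - x).
Proof. by rewrite -absvN opprB. Qed.

Lemma geometric_tail (x : nat -> L) (K : R) :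
  (forall t, absv (x t.+1 - x t) <= K / 2 ^+ t) ->
  forall t k, absv (x (t + k)%N - x t) <= K * 2 / 2 ^+ t.
Proof.
move=> xK t k.
have K0 : 0 <= K.
  by have := xK 0%N; rewrite expr0 divr1; apply: le_trans; exact: absv_ge0.
have p2 i : 0 < (2 : R) ^+ i by rewrite exprn_gt0.
(* The subtracted term makes the induction go through: the bound is now the exact partial sum of the
   geometric series. *)
suff h : absv (x (t + k)%N - x t) <= K * 2 / 2 ^+ t - K * 2 / 2 ^+ (t + k).
  apply: le_trans h _; rewrite gerBl divr_ge0 ?mulr_ge0 // ltW //.
elim: k => [|k IH]; first by rewrite addn0 !subrr absv0.
have -> : x (t + k.+1)%N - x t = (x (t + k).+1 - x (t + k)%N) + (x (t + k)%N - x t).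
  by rewrite addnS addrA subrK.
apply: le_trans (absvD _ _) _.
apply: le_trans (lerD (xK _) IH) _; rewrite addnS exprS.
have h2 : (2 : R) ^+ (t + k) != 0 by rewrite gt_eqF.
rewrite invfM.
set u := (2 ^+ (t + k))^-1; lra.
Qed.

Lemma pow2_small (K e : R) : 0 < e -> exists t0 : nat,
  forall t, (t0 <= t)%N -> K / 2 ^+ t < e.
Proof.
move=> e0; have [t0 h0] : exists t0 : nat, K / e < t0%:R.
  exists (Num.truncn (`|K / e|)).+1.
  by apply: le_lt_trans (ler_norm _) _; apply: truncnS_gt.
exists t0 => t le.
have p2 : 0 < (2 : R) ^+ t by rewrite exprn_gt0.
rewrite ltr_pdivrMr // mulrC -ltr_pdivrMr //; apply: lt_le_trans h0 _.
rewrite -natrX ler_nat; apply: leq_trans le _; apply: ltnW; exact: ltn_expl.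
Qed.

Lemma local_complete (x : nat -> L) (K : R) :
  (forall t, absv (x t.+1 - x t) <= K / 2 ^+ t) ->
  exists y, forall e, 0 < e -> exists t0 : nat,
    forall t, (t0 <= t)%N -> absv (x t - y) < e.
Proof.
move=> xK; have tail := geometric_tail xK.
have [V V0 [cV _]] : exists2 V : set L, nbhs 0 V & compact V /\ closed V.
  have [V nV cV] := @local_field_compact R L 0 Logic.I.
  exists V => //.
  have nV' : nbhs (0 : L) [set x | [set: L] x -> V x] := nV.
  by apply: filterS nV' => u; apply.
have /absv_nbhs[e0 e0_gt0 eV] := V0.
have [T TP] := pow2_small (K * 2) e0_gt0.
(* Translated to start at 0, a tail of the sequence stays in the compact neighbourhood V. It has a
   cluster point there, and a Cauchy sequence converges to its cluster points. *)
pose z t := x (T + t)%N - x T.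
have zV t : V (z t).
  apply: eV; rewrite sub0r absvN; apply: le_lt_trans (tail _ _) _; exact: TP.
have zoo : (z @ \oo) V by exists 0%N => // t _; exact: zV.
have [z0 [_ clz]] := cV (z @ \oo) _ zoo.
exists (z0 + x T) => e egt0.
have e2 : 0 < e / 2 by rewrite divr_gt0.
have [t1 t1P] := pow2_small (K * 2) e2.
exists (T + t1)%N => t tle.
have [||_ [[k kt1 <-] Bk]] := clz [set z k | k in [set k | (t1 <= k)%N]]
    [set u | absv (z0 - u) < e / 2].
- by exists t1 => // k /= kt; exists k.
- by apply/absv_nbhs; exists (e / 2).
have -> : x t - (z0 + x T) = (x t - x (T + k)%N) + (z k - z0).
  by rewrite /z; ring.
rewrite /= absvC in Bk.
have : absv (x t - x (T + k)%N) < e / 2.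
  have [ltk|gtk] := leqP (T + k) t.
    rewrite -(subnKC ltk); apply: le_lt_trans (tail _ _) _; apply: t1P.
    exact: leq_trans kt1 (leq_addl _ _).
  rewrite absvC -(subnKC (ltnW gtk)); apply: le_lt_trans (tail _ _) _; apply: t1P.
  exact: leq_trans (leq_addl _ _) tle.
move=> h; apply: le_lt_trans (absvD _ _) _; lra.
Qed.

End AbsoluteValue.

(** A complete normed L-algebra inside F, not necessarily a field. The norm of 1 may differ from 1,
    hence the constant in [nm_iota]. Completeness is asked for geometrically convergent sequences,
    the kind that Newton's method produces. *)
Record normed_subring (R : realType) (L : localFieldType R) (F : fieldType)
    (iota : {rmorphism L -> F}) (M : set F) (nm : F -> R) : Prop := NormedSubring {
  ns_iota : forall a, M (iota a);
  nsD : forall x y, M x -> M y -> M (x + y);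
  nsM : forall x y, M x -> M y -> M (x * y);
  nm_ge0 : forall x, 0 <= nm x;
  nm0 : nm 0 = 0;
  nm_eq0 : forall x, M x -> nm x = 0 -> x = 0;
  nmN : forall x, M x -> nm (- x) = nm x;
  nmD : forall x y, M x -> M y -> nm (x + y) <= nm x + nm y;
  nmM : forall x y, M x -> M y -> nm (x * y) <= nm x * nm y;
  nm_iota : exists2 K, 0 <= K & forall a, nm (iota a) <= K * absv a;
  ns_complete : forall (x : nat -> F) (K : R), (forall t, M (x t)) ->
    (forall t, nm (x t.+1 - x t) <= K / 2 ^+ t) ->
    exists2 y, M y & forall e, 0 < e -> exists t0 : nat,
      forall t, (t0 <= t)%N -> nm (x t - y) < e }.

Section Span.
Variables (L F : fieldType) (iota : {rmorphism L -> F}).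

Definition lspan (I : finType) (w : I -> F) : set F :=
  [set x | exists v : I -> L, x = \sum_i iota (v i) * w i].

Section SpanClosure.
Variables (I : finType) (w : I -> F).

Lemma lspanD x y : lspan w x -> lspan w y -> lspan w (x + y).
Proof.
move=> [v ->] [v' ->]; exists (fun i => v i + v' i).
by rewrite -big_split; apply: eq_bigr => i _ /=; rewrite rmorphD mulrDl.
Qed.

Lemma lspanZ a x : lspan w x -> lspan w (iota a * x).
Proof.
move=> [v ->]; exists (fun i => a * v i).
by rewrite mulr_sumr; apply: eq_bigr => i _ /=; rewrite rmorphM mulrA.
Qed.

Lemma lspan0 : lspan w 0.
Proof. by exists (fun=> 0); rewrite big1 // => i _; rewrite rmorph0 mul0r. Qed.

Lemma lspan_sum (J : finType) (f : J -> F) :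
  (forall k, lspan w (f k)) -> lspan w (\sum_k f k).
Proof. by move=> h; elim/big_ind: _ => //; [exact: lspan0 | exact: lspanD]. Qed.

Lemma lspan_gen i : lspan w (w i).
Proof.
exists (fun k => (k == i)%:R); rewrite (bigD1 i) //= eqxx rmorph1 mul1r.
by rewrite big1 ?addr0 // => k /negPf ->; rewrite rmorph0 mul0r.
Qed.

(** A generating family of least length is free: a relation with a nonzero coefficient at i0 would
    allow [e i0] to be dropped. *)
Lemma lspan_basis : exists D (e : 'I_D -> F), lspan e = lspan w /\
  forall v : 'I_D -> L, \sum_i iota (v i) * e i = 0 -> forall i, v i = 0.
Proof.
pose P D := `[< exists e : 'I_D -> F, lspan e = lspan w >].
have exP : exists D, P D.
  exists #|I|; apply/asboolP; exists (w \o enum_val).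
  apply/seteqP; split=> x [v ->].
    by apply: lspan_sum => i; apply: lspanZ; exact: lspan_gen.
  exists (v \o enum_val).
  by rewrite (reindex _ (onW_bij _ (@enum_val_bij I))).
case: (ex_minnP exP) => D /asboolP[e eE] minD; exists D, e; split=> // v v0 i0.
apply/eqP; apply: contraT => vi0.
case: D => [|D] in e eE minD v v0 i0 vi0 *; first by case: i0 vi0.
suff /minD : P D by rewrite ltnn.
apply/asboolP; exists (e \o lift i0); rewrite -eE.
have ei0 : e i0 = \sum_k iota (- (v i0)^-1 * v (lift i0 k)) * e (lift i0 k).
  have iv0 : iota (v i0) != 0 by rewrite fmorph_eq0.
  apply: (mulfI iv0); rewrite mulr_sumr.
  apply/eqP; rewrite -subr_eq0 -sumrN; apply/eqP; rewrite -[RHS]v0.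
  rewrite (bigD1_ord i0) //=; congr (_ + _); apply: eq_bigr => k _.
  by rewrite !rmorphM rmorphN fmorphV; field.
apply/seteqP; split=> x [u ->].
  exists (fun k => if unlift i0 k is Some k' then u k' else 0).
  rewrite (bigD1_ord i0) //= unlift_none rmorph0 mul0r add0r.
  by apply: eq_bigr => k _; rewrite liftK.
exists (fun k => u i0 * (- (v i0)^-1 * v (lift i0 k)) + u (lift i0 k)).
rewrite (bigD1_ord i0) //= ei0 mulr_sumr -big_split /=; apply: eq_bigr => k _.
by rewrite rmorphD mulrDl mulrA -rmorphM.
Qed.

End SpanClosure.
End Span.

Section SplitNorm.
Variables (R : realType) (L : localFieldType R) (F : fieldType).
Variables (iota : {rmorphism L -> F}) (D : nat) (e : 'I_D -> F).
Hypothesis e_free : forall v : 'I_D -> L,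
  \sum_i iota (v i) * e i = 0 -> forall i, v i = 0.

Let M := lspan iota e.

Definition coord (x : F) : 'I_D -> L :=
  if pselect (M x) is left h then projT1 (cid h) else (fun=> 0).

Lemma coordE x : M x -> x = \sum_i iota (coord x i) * e i.
Proof. by rewrite /coord => Mx; case: pselect => // h; case: cid. Qed.

Lemma coord_eq x v : x = \sum_i iota (v i) * e i -> coord x = v.
Proof.
move=> xE; have Mx : M x by exists v.
apply/funext => i; apply/eqP; rewrite -subr_eq0; apply/eqP.
apply: (e_free (v := fun i => coord x i - v i)).
under eq_bigr do rewrite rmorphB mulrBl.
by rewrite sumrB -coordE // -xE subrr.
Qed.

Definition coord_norm (x : F) : R := \sum_i absv (coord x i).

Lemma coord_norm_ge0 x : 0 <= coord_norm x.
Proof. by apply: sumr_ge0 => i _; exact: absv_ge0. Qed.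

Lemma coord_norm_eq0 x : M x -> coord_norm x = 0 -> x = 0.
Proof.
move=> Mx /eqP; rewrite psumr_eq0 => [/allP h|i _]; last exact: absv_ge0.
rewrite (coordE Mx) big1 // => i _.
have /eqP/absv_eq0 -> : absv (coord x i) == 0 by apply: h; rewrite mem_index_enum.
by rewrite rmorph0 mul0r.
Qed.

Lemma coordD x y : M x -> M y -> coord (x + y) = (fun i => coord x i + coord y i).
Proof.
move=> Mx My; apply: coord_eq; rewrite {1}(coordE Mx) {1}(coordE My) -big_split.
by apply: eq_bigr => i _ /=; rewrite rmorphD mulrDl.
Qed.

Lemma coordZ a x : M x -> coord (iota a * x) = (fun i => a * coord x i).
Proof.
move=> Mx; apply: coord_eq; rewrite {1}(coordE Mx) mulr_sumr.
by apply: eq_bigr => i _; rewrite rmorphM mulrA.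
Qed.

Lemma coord_normD x y : M x -> M y -> coord_norm (x + y) <= coord_norm x + coord_norm y.
Proof.
move=> Mx My; rewrite /coord_norm coordD // -big_split; apply: ler_sum => i _.
exact: absvD.
Qed.

Lemma coord_normZ a x : M x -> coord_norm (iota a * x) = absv a * coord_norm x.
Proof.
move=> Mx; rewrite /coord_norm coordZ // mulr_sumr; apply: eq_bigr => i _.
exact: absvM.
Qed.

Lemma coord_norm0 : coord_norm 0 = 0.
Proof.
rewrite /coord_norm (@coord_eq 0 (fun=> 0)).
  by rewrite big1 // => i _; exact: absv0.
by rewrite big1 // => i _; rewrite rmorph0 mul0r.
Qed.

Lemma coord_normN x : M x -> coord_norm (- x) = coord_norm x.
Proof.
move=> Mx; rewrite -mulN1r -(rmorphN1 iota) coord_normZ // absvN absv1.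
exact: mul1r.
Qed.

Lemma coord_norm_sum (I : finType) (f : I -> F) : (forall i, M (f i)) ->
  coord_norm (\sum_i f i) <= \sum_i coord_norm (f i).
Proof.
move=> Mf; suff [] : M (\sum_i f i) /\
    coord_norm (\sum_i f i) <= \sum_i coord_norm (f i) by [].
elim/big_ind2 : _ => [|x1 y1 x2 y2 [M1 h1] [M2 h2]|i _].
- by rewrite coord_norm0; split=> //; exact: lspan0.
- split; first exact: lspanD.
  by apply: le_trans (coord_normD _ _) _ => //; apply: lerD.
- by split.
Qed.

Lemma coord_norm_lcomb (I : finType) (v : I -> L) (f : I -> F) (K : R) :
  (forall i, M (f i)) -> (forall i, coord_norm (f i) <= K) ->
  coord_norm (\sum_i iota (v i) * f i) <= (\sum_i absv (v i)) * K.
Proof.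
move=> Mf fK; have Mvf i : M (iota (v i) * f i) by exact/lspanZ/Mf.
apply: le_trans (coord_norm_sum Mvf) _.
rewrite mulr_suml; apply: ler_sum => i _; rewrite coord_normZ //.
by apply: ler_wpM2l => //; exact: absv_ge0.
Qed.

Hypothesis M1 : M 1.
Hypothesis MM : forall x y, M x -> M y -> M (x * y).

Lemma coord_normed_subring : exists2 C : R, 0 < C &
  normed_subring iota M (fun x => C * coord_norm x).
Proof.
have Me i : M (e i) by exact: lspan_gen.
have Miota a : M (iota a) by rewrite -[iota a]mulr1; exact: lspanZ.
(* C bounds the norms of all products of two basis vectors, so multiplying the coordinate norm by C
   makes it submultiplicative; the summand 1 keeps C positive. *)
pose C := 1 + \sum_i \sum_k coord_norm (e i * e k).
have eC i k : coord_norm (e i * e k) <= C.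
  rewrite /C (bigD1 i) //= (bigD1 k) //=.
  set A := \sum_(i0 | i0 != k) _; set B := \sum_(i0 | i0 != i) _.
  have A0 : 0 <= A by apply: sumr_ge0 => l _; exact: coord_norm_ge0.
  have B0 : 0 <= B.
    by apply: sumr_ge0 => l _; apply: sumr_ge0 => l' _; exact: coord_norm_ge0.
  lra.
have C1 : 1 <= C.
  rewrite lerDl; apply: sumr_ge0 => l _; apply: sumr_ge0 => l' _.
  exact: coord_norm_ge0.
have C0 : 0 < C by lra.
exists C => //; split => //.
- by move=> x y; exact: lspanD.
- by move=> x; rewrite mulr_ge0 ?coord_norm_ge0 // ltW.
- by rewrite coord_norm0 mulr0.
- move=> x Mx /eqP; rewrite mulf_eq0 gt_eqF //= => /eqP; exact: coord_norm_eq0.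
- by move=> x Mx; rewrite coord_normN.
- move=> x y Mx My; rewrite -mulrDr; apply: ler_wpM2l; first exact: ltW.
  exact: coord_normD.
- move=> x y Mx My; rewrite -mulrA; apply: ler_wpM2l; first exact: ltW.
  have eq1 : x * y = \sum_i iota (coord x i) * (e i * y).
    rewrite {1}(coordE Mx) mulr_suml; apply: eq_bigr => i _; exact/esym/mulrA.
  rewrite eq1.
  apply: coord_norm_lcomb => i; first exact: MM.
  have -> : e i * y = \sum_k iota (coord y k) * (e i * e k).
    rewrite {1}(coordE My) mulr_sumr; apply: eq_bigr => k _; exact: mulrCA.
  rewrite [C * _]mulrC; apply: coord_norm_lcomb => k //; exact: MM.
- exists (C * coord_norm 1); first by rewrite mulr_ge0 ?coord_norm_ge0 // ltW.
  move=> a; rewrite -[iota a]mulr1 coord_normZ // -mulrA [absv a * _]mulrC.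
  exact: lexx.
- move=> x K Mx xK.
  have cK i t : absv (coord (x t.+1) i - coord (x t) i) <= (K / C) / 2 ^+ t.
    have -> : coord (x t.+1) i - coord (x t) i = coord (x t.+1 - x t) i.
      have MNx : M (- x t) by rewrite -mulN1r -(rmorphN1 iota); exact/lspanZ/Mx.
      rewrite coordD //; congr (_ + _).
      have -> : - x t = iota (-1) * x t by rewrite rmorphN1 mulN1r.
      by rewrite coordZ // mulN1r.
    rewrite mulrAC ler_pdivlMr // mulrC; apply: le_trans (xK t).
    apply: ler_wpM2l; first exact: ltW.
    rewrite /coord_norm (bigD1 i) //= lerDl.
    by apply: sumr_ge0 => l _; exact: absv_ge0.
  have [y yP] := choice (fun i => local_complete (cK i)).
  exists (\sum_i iota (y i) * e i); first by exists y.
  move=> eps eps0.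
  (* D coordinates each within eps / (C (D + 1)) give a norm strictly below eps, also for D = 0. *)
  have D0 : 0 < C * D.+1%:R by rewrite mulr_gt0.
  have d0 : 0 < eps / (C * D.+1%:R) by rewrite divr_gt0.
  have [t0 t0P] := choice (fun i => yP i _ d0).
  exists (\max_i t0 i) => t tle.
  have -> : x t - \sum_i iota (y i) * e i = \sum_i iota (coord (x t) i - y i) * e i.
    rewrite {1}(coordE (Mx t)) -sumrB; apply: eq_bigr => i _.
    by rewrite rmorphB mulrBl.
  rewrite /coord_norm (coord_eq erefl).
  rewrite mulrC -ltr_pdivlMr //.
  apply: (@le_lt_trans _ _ (\sum_(i < D) eps / (C * D.+1%:R))).
    apply: ler_sum => i _; apply: ltW; apply: t0P.
    by apply: leq_trans tle; exact: leq_bigmax.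
  rewrite sumr_const card_ord -[_ *+ _]mulr_natr invfM mulrA -mulrA gtr_pMr ?divr_gt0 //.
  by rewrite mulrC ltr_pdivrMr // mul1r ltr_nat.
Qed.

End SplitNorm.

(* The products [\prod_t psi t (g (f t))] span the image of the d-th tensor
   power of B, which is the subring generated by all the [psi t b]. *)
Lemma compositum_normed (A B : comPzRingType) (phi : {rmorphism A -> B})
    (N : nat) (g : 'I_N -> B)
    (g_gen : forall y, exists c : 'I_N -> A, y = \sum_(i < N) phi (c i) * g i)
    (R : realType) (L : localFieldType R) (F : fieldType)
    (alpha : {rmorphism A -> L}) (iota : {rmorphism L -> F})
    d (psi : 'I_d -> {rmorphism B -> F}) :
  (forall t a, psi t (phi a) = iota (alpha a)) ->
  exists (M : set F) (nm : F -> R) (K : R),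
  [/\ normed_subring iota M nm, forall t b, M (psi t b), 0 <= K,
      forall sg : {rmorphism F -> F}, (forall c, sg (iota c) = iota c) ->
        (forall t, exists t', forall b, sg (psi t b) = psi t' b) ->
        forall x, M x -> M (sg x) /\ nm (sg x) <= K * nm x &
      forall sg : {rmorphism F -> F}, (forall c, sg (iota c) = iota c) ->
        (forall t b, sg (psi t b) = psi t b) -> forall x, M x -> sg x = x].
Proof.
move=> psiA.
pose w (f : {ffun 'I_d -> 'I_N}) := \prod_t psi t (g (f t)).
have prodM (b : 'I_d -> B) : lspan iota w (\prod_t psi t (b t)).
  have [c cE] := choice (fun t => g_gen (b t)).
  have -> : \prod_t psi t (b t) =
      \prod_t \sum_k iota (alpha (c t k)) * psi t (g k).
    apply: eq_bigr => t _; rewrite [in LHS](cE t) rmorph_sum.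
    by apply: eq_bigr => k _; rewrite rmorphM psiA.
  rewrite bigA_distr_bigA /=; apply: lspan_sum => f.
  rewrite big_split /= -rmorph_prod; apply: lspanZ; exact: lspan_gen.
have wM x y : lspan iota w x -> lspan iota w y -> lspan iota w (x * y).
  move=> [v ->] [v' ->]; rewrite mulr_suml; apply: lspan_sum => f.
  rewrite -mulrA; apply: lspanZ; rewrite mulr_sumr; apply: lspan_sum => f'.
  rewrite mulrCA; apply: lspanZ; rewrite -big_split /=.
  by under eq_bigr do rewrite -rmorphM; exact: prodM.
have [D [e [eE e_free]]] := lspan_basis iota w.
rewrite -eE in wM; have {}prodM b : lspan iota e (\prod_t psi t (b t)) by rewrite eE.
have M1 : lspan iota e 1.
  have := prodM (fun=> 1); rewrite big1 // => t _; exact: rmorph1.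
have [C C0 nsC] := coord_normed_subring e_free M1 wM.
have prodMp (p : {ffun 'I_d -> 'I_d}) (b : 'I_d -> B) :
    lspan iota e (\prod_t psi (p t) (b t)).
  (* The factors are grouped by the value s of p: those with the same s combine into one value of
     [psi s]. *)
  rewrite (partition_big p predT) //=.
  under eq_bigr => s _ do under eq_bigr => t /eqP -> do over.
  by under eq_bigr => s _ do rewrite -rmorph_prod; exact: prodM.
(* An automorphism that maps each psi t to some psi (p t) sends w f to wp (p, f). There are finitely
   many maps p, whence a bound K that is the same for all automorphisms. *)
pose wp (pf : {ffun 'I_d -> 'I_d} * {ffun 'I_d -> 'I_N}) :=
  \prod_t psi (pf.1 t) (g (pf.2 t)).
pose K0 := \sum_pf coord_norm iota e (wp pf).
have wpK pf : coord_norm iota e (wp pf) <= K0.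
  rewrite /K0 (bigD1 pf) //= lerDl; apply: sumr_ge0 => i _; exact: coord_norm_ge0.
have ew i : exists v : {ffun 'I_d -> 'I_N} -> L, e i = \sum_f iota (v f) * w f.
  have : lspan iota w (e i) by rewrite -eE; exact: lspan_gen.
  by [].
have [v vE] := choice ew.
pose K := \sum_i (\sum_f absv (v i f)) * K0.
have K00 : 0 <= K0 by apply: sumr_ge0 => i _; exact: coord_norm_ge0.
have Ki i : 0 <= (\sum_f absv (v i f)) * K0.
  by rewrite mulr_ge0 // sumr_ge0 // => f _; exact: absv_ge0.
have sgw (sg : {rmorphism F -> F}) (p : {ffun 'I_d -> 'I_d}) f :
    (forall t b, sg (psi t b) = psi (p t) b) -> sg (w f) = wp (p, f).
  by move=> sgp; rewrite rmorph_prod; apply: eq_bigr => t _; rewrite sgp.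
have sge (sg : {rmorphism F -> F}) (p : {ffun 'I_d -> 'I_d}) i :
    (forall c, sg (iota c) = iota c) -> (forall t b, sg (psi t b) = psi (p t) b) ->
    sg (e i) = \sum_f iota (v i f) * wp (p, f).
  move=> sgi sgp; rewrite {1}vE rmorph_sum; apply: eq_bigr => f _.
  by rewrite rmorphM sgi (sgw _ _ _ sgp).
have sgx (sg : {rmorphism F -> F}) x : (forall c, sg (iota c) = iota c) ->
    lspan iota e x -> sg x = \sum_i iota (coord iota e x i) * sg (e i).
  move=> sgi Mx; rewrite {1}(coordE Mx) rmorph_sum; apply: eq_bigr => i _.
  by rewrite rmorphM sgi.
exists (lspan iota e), (fun x => C * coord_norm iota e x), K; split => //.
- move=> t b; have := prodM (fun s => if s == t then b else 1).
  rewrite (bigD1 t) //= eqxx big1 ?mulr1 // => s /negPf ->; exact: rmorph1.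
- by apply: sumr_ge0.
- move=> sg sgi /choice[p pP] x Mx.
  pose p' := [ffun t => p t].
  have sgp t b : sg (psi t b) = psi (p' t) b by rewrite ffunE pP.
  have Mwp pf : lspan iota e (wp pf) by exact: prodMp.
  have Msge i : lspan iota e (sg (e i)).
    rewrite (sge _ _ _ sgi sgp); apply: lspan_sum => f; exact: lspanZ.
  rewrite (sgx _ _ sgi Mx); split.
    by apply: lspan_sum => i; exact: lspanZ.
  rewrite mulrCA; apply: ler_wpM2l; first exact: ltW.
  rewrite mulrC; apply: coord_norm_lcomb => // i.
  rewrite (sge _ _ _ sgi sgp); apply: (@le_trans _ _ ((\sum_f absv (v i f)) * K0)).
    by apply: coord_norm_lcomb => // f.
  by rewrite /K (bigD1 i) //= lerDl; apply: sumr_ge0.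
- move=> sg sgi sgp x Mx; rewrite (sgx _ _ sgi Mx) [RHS](coordE Mx).
  apply: eq_bigr => i _; congr (_ * _).
  rewrite (vE i) rmorph_sum; apply: eq_bigr => f _.
  rewrite rmorphM sgi rmorph_prod; congr (_ * _); apply: eq_bigr => t _.
  exact: sgp.
Qed.

(** * Perturbation of solutions *)

Section NormedSubring.
Variables (R : realType) (L : localFieldType R) (F : fieldType).
Variables (iota : {rmorphism L -> F}) (M : set F) (nm : F -> R).
Hypothesis ns : normed_subring iota M nm.

Lemma ns0 : M 0. Proof. by rewrite -(rmorph0 iota); exact: ns_iota ns _. Qed.

Lemma nsN x : M x -> M (- x).
Proof.
by move=> Mx; rewrite -mulN1r -(rmorphN1 iota); apply: (nsM ns) => //; exact: ns_iota ns _.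
Qed.

Lemma nsB x y : M x -> M y -> M (x - y).
Proof. by move=> Mx My; apply: (nsD ns) => //; exact: nsN. Qed.

Lemma nmC x y : M x -> M y -> nm (x - y) = nm (y - x).
Proof. by move=> Mx My; rewrite -(nmN ns) ?opprB //; exact: nsB. Qed.

Lemma nm_triangle x y z : M x -> M y -> M z ->
  nm (x - z) <= nm (x - y) + nm (y - z).
Proof.
move=> Mx My Mz; have -> : x - z = (x - y) + (y - z) by rewrite addrA subrK.
by apply: (nmD ns); exact: nsB.
Qed.

Lemma nm_sum (I : finType) (f : I -> F) : (forall i, M (f i)) ->
  nm (\sum_i f i) <= \sum_i nm (f i).
Proof.
move=> Mf; suff [] : M (\sum_i f i) /\ nm (\sum_i f i) <= \sum_i nm (f i) by [].
elim/big_ind2 : _ => [|x1 y1 x2 y2 [M1 h1] [M2 h2]|i _].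
- by rewrite (nm0 ns); split=> //; exact: ns0.
- split; first exact: (nsD ns).
  by apply: le_trans (nmD ns _ _) _ => //; apply: lerD.
- by split.
Qed.

Lemma nmM_le x y a b : M x -> M y -> nm x <= a -> nm y <= b -> nm (x * y) <= a * b.
Proof.
move=> Mx My xa yb; apply: le_trans (nmM ns Mx My) _.
by apply: ler_pM => //; exact: nm_ge0 ns _.
Qed.

Section Evaluation.
Variables (A : comPzRingType) (n : nat).

Lemma peval_ns (alpha : {rmorphism A -> L}) (x : 'I_n -> F) e :
  (forall i, M (x i)) -> M (peval (iota \o alpha) x e).
Proof.
move=> Mx; elim: e => //= [a|e1 M1 e2 M2|e1 M1 e2 M2].
- exact: ns_iota ns _.
- exact: (nsD ns).
- exact: (nsM ns).
Qed.

Variables (T : Type) (Ft : set_system T).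
Hypothesis FtF : Filter Ft.
Variables (alpha : T -> {rmorphism A -> L}) (alpha0 : {rmorphism A -> L}).
Hypothesis alpha_cv : forall a e, 0 < e ->
  \forall t \near Ft, absv (alpha t a - alpha0 a) < e.
Variable x0 : 'I_n -> F.
Hypothesis Mx0 : forall i, M (x0 i).

Definition unit_ball (x : 'I_n -> F) :=
  forall i, M (x i) /\ nm (x i - x0 i) <= 1.

Local Notation ev t x e := (peval (iota \o alpha t) x e).

Lemma unit_ball_ns x : unit_ball x -> forall i, M (x i).
Proof. by move=> Ux i; have [] := Ux i. Qed.

(** The bound is uniform in t and in x, because the Newton iterations for all t near the limit must
    share one constant. *)
Lemma peval_bound (e : pexpr A n) : exists2 K, 0 <= K &
  \forall t \near Ft, forall x, unit_ball x -> nm (ev t x e) <= K.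
Proof.
elim: e => [a|i|e1 [K1 K10 h1] e2 [K2 K20 h2]|e1 [K1 K10 h1] e2 [K2 K20 h2]].
- have [K K0 KP] := nm_iota ns.
  exists (K * (1 + absv (alpha0 a))).
    by rewrite mulr_ge0 // addr_ge0 // absv_ge0.
  apply: filterS (alpha_cv a ltr01) => t ht x _ /=.
  apply: le_trans (KP _) _; apply: ler_wpM2l => //.
  rewrite -[alpha t a](subrK (alpha0 a)); apply: le_trans (absvD _ _) _.
  by rewrite lerD2r ltW.
- exists (1 + nm (x0 i)); first by rewrite addr_ge0 // (nm_ge0 ns).
  apply: nearW => t x Ux /=; have [Mx hx] := Ux i.
  rewrite -[x i](subrK (x0 i)); apply: le_trans (nmD ns _ _) _ => //.
    exact: nsB.
  by rewrite lerD2r.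
- exists (K1 + K2); first exact: addr_ge0.
  apply: filterS2 h1 h2 => t h1 h2 x Ux /=.
  have Mx := unit_ball_ns Ux.
  apply: le_trans (nmD ns _ _) _; [exact: peval_ns..|].
  by apply: lerD; [exact: h1 | exact: h2].
- exists (K1 * K2); first exact: mulr_ge0.
  apply: filterS2 h1 h2 => t h1 h2 x Ux /=.
  have Mx := unit_ball_ns Ux.
  by apply: nmM_le; [exact: peval_ns..|exact: h1|exact: h2].
Qed.

Lemma peval_lipschitz (e : pexpr A n) : exists2 K, 0 <= K &
  \forall t \near Ft, forall x y, unit_ball x -> unit_ball y ->
    nm (ev t x e - ev t y e) <= K * \sum_i nm (x i - y i).
Proof.
have S0 (x y : 'I_n -> F) : 0 <= \sum_i nm (x i - y i).
  by apply: sumr_ge0 => i _; exact: nm_ge0 ns _.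
elim: e => [a|i|e1 [K1 K10 h1] e2 [K2 K20 h2]|e1 [K1 K10 h1] e2 [K2 K20 h2]].
- exists 0 => //; apply: nearW => t x y _ _ /=.
  by rewrite subrr (nm0 ns) mul0r.
- exists 1 => //; apply: nearW => t x y _ _ /=; rewrite mul1r (bigD1 i) //= lerDl.
  by apply: sumr_ge0 => k _; exact: nm_ge0 ns _.
- exists (K1 + K2); first exact: addr_ge0.
  apply: filterS2 h1 h2 => t h1 h2 x y Ux Uy /=.
  have Mx := unit_ball_ns Ux; have My := unit_ball_ns Uy.
  rewrite opprD addrACA mulrDl; apply: le_trans (nmD ns _ _) _.
  + by apply: nsB; exact: peval_ns.
  + by apply: nsB; exact: peval_ns.
  + by apply: lerD; [exact: h1 | exact: h2].
- have [C1 C10 b1] := peval_bound e1; have [C2 C20 b2] := peval_bound e2.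
  exists (C1 * K2 + K1 * C2); first by rewrite addr_ge0 // mulr_ge0.
  apply: filterS2 (filterI h1 h2) (filterI b1 b2) => t [{}h1 {}h2] [{}b1 {}b2] x y Ux Uy /=.
  have Mx := unit_ball_ns Ux; have My := unit_ball_ns Uy.
  have M1x := peval_ns (alpha t) e1 Mx; have M2x := peval_ns (alpha t) e2 Mx.
  have M1y := peval_ns (alpha t) e1 My; have M2y := peval_ns (alpha t) e2 My.
  have -> : ev t x e1 * ev t x e2 - ev t y e1 * ev t y e2 =
    ev t x e1 * (ev t x e2 - ev t y e2) + (ev t x e1 - ev t y e1) * ev t y e2 by ring.
  rewrite [leRHS]mulrDl; apply: le_trans (nmD ns _ _) _.
  + by apply: (nsM ns) => //; exact: nsB.
  + by apply: (nsM ns) => //; exact: nsB.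
  apply: lerD.
  + by rewrite -mulrA; apply: nmM_le => //; [exact: nsB | exact: b1 | exact: h2].
  + by rewrite mulrAC; apply: nmM_le => //; [exact: nsB | exact: h1 | exact: b2].
Qed.

Lemma peval_cvg (e : pexpr A n) eta : 0 < eta ->
  \forall t \near Ft, nm (ev t x0 e - peval (iota \o alpha0) x0 e) < eta.
Proof.
have U0 : unit_ball x0 by move=> i; rewrite subrr (nm0 ns).
elim: e eta => [a|i|e1 h1 e2 h2|e1 h1 e2 h2] eta eta0.
- have [K K0 KP] := nm_iota ns.
  have K1 : 0 < K + 1 by rewrite ltr_wpDl.
  apply: filterS (alpha_cv a (divr_gt0 eta0 K1)) => t /=.
  rewrite ltr_pdivlMr // mulrC -rmorphB => h; apply: le_lt_trans (KP _) _.
  by apply: le_lt_trans h; rewrite ler_wpM2r ?absv_ge0 // lerDl.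
- by apply: nearW => t /=; rewrite subrr (nm0 ns).
- have eta2 : 0 < eta / 2 by rewrite divr_gt0.
  apply: filterS2 (h1 _ eta2) (h2 _ eta2) => t {}h1 {}h2 /=.
  rewrite opprD addrACA; apply: le_lt_trans (nmD ns _ _) _.
  + by apply: nsB; exact: peval_ns.
  + by apply: nsB; exact: peval_ns.
  + by lra.
- have [C1 C10 b1] := peval_bound e1.
  set C2 := nm (peval (iota \o alpha0) x0 e2).
  have C20 : 0 <= C2 by exact: nm_ge0 ns _.
  have d0 : 0 < eta / (C1 + C2 + 1) by rewrite divr_gt0 // ltr_wpDl // addr_ge0.
  apply: filterS2 (filterI (h1 _ d0) (h2 _ d0)) b1 => t [{}h1 {}h2] {}b1 /=.
  have M1x := peval_ns (alpha t) e1 Mx0; have M2x := peval_ns (alpha t) e2 Mx0.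
  have M1y := peval_ns alpha0 e1 Mx0; have M2y := peval_ns alpha0 e2 Mx0.
  have -> : ev t x0 e1 * ev t x0 e2 - peval (iota \o alpha0) x0 e1 * peval (iota \o alpha0) x0 e2 =
    ev t x0 e1 * (ev t x0 e2 - peval (iota \o alpha0) x0 e2) +
    (ev t x0 e1 - peval (iota \o alpha0) x0 e1) * peval (iota \o alpha0) x0 e2 by ring.
  set d := eta / _ in h1 h2 d0.
  apply: le_lt_trans (_ : C1 * d + d * C2 < eta).
    apply: le_trans (nmD ns _ _) _.
    + by apply: (nsM ns) => //; exact: nsB.
    + by apply: (nsM ns) => //; exact: nsB.
    apply: lerD.
    + by apply: nmM_le => //; [exact: nsB | exact: b1 | exact: ltW].
    + by apply: nmM_le => //; [exact: nsB | exact: ltW].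
  have -> : eta = d * (C1 + C2 + 1).
    by rewrite /d divfK // gt_eqF // ltr_wpDl // addr_ge0.
  rewrite mulrC -mulrDr ltr_pM2l //; lra.
Qed.

End Evaluation.

(** The step c has size O(r) and leaves a residual O(r^2). Of this quadratic convergence only the
    halving of the residual at each step is kept, which 2 K delta <= 1 ensures; the steps then add
    up to at most 2 K delta. *)
Lemma newton_zero n m (x0 : 'I_n -> F) (c : ('I_n -> F) -> 'I_n -> F)
    (r : ('I_n -> F) -> 'I_m -> F) (K delta : R) :
  (forall i, M (x0 i)) ->
  (forall x, (forall i, M (x i)) -> forall k, M (r x k)) ->
  (forall x, (forall i, M (x i)) -> forall i, M (c x i)) ->
  0 < K -> 0 <= delta -> 2 * K * delta <= 1 ->
  (forall x, unit_ball x0 x -> forall i,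
     nm (c x i - x i) <= K * \sum_k nm (r x k)) ->
  (forall x, unit_ball x0 x ->
     \sum_k nm (r (c x) k) <= K * (\sum_k nm (r x k)) ^+ 2) ->
  (forall x y, unit_ball x0 x -> unit_ball x0 y -> forall k,
     nm (r x k - r y k) <= K * \sum_i nm (x i - y i)) ->
  \sum_k nm (r x0 k) <= delta ->
  exists x, [/\ forall i, M (x i), forall k, r x k = 0 &
    forall i, nm (x i - x0 i) <= 2 * K * delta].
Proof.
move=> Mx0 Mr Mc K0 delta0 Kdelta cP rcP rlip r0.
pose z t := iter t c x0.
have Mz t i : M (z t i).
  by elim: t i => [|t IH] i; [exact: Mx0 | exact: Mc].
have p2 t : 0 < (2 : R) ^+ t by rewrite exprn_gt0.
(* The second bound is the partial sum of the step sizes K delta / 2^i; it keeps the iterates in the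
   unit ball, where the estimates hold. *)
have inv t : \sum_k nm (r (z t) k) <= delta / 2 ^+ t /\
    forall i, nm (z t i - x0 i) <= 2 * K * delta * (1 - (2 ^+ t)^-1).
  elim: t => [|t [IHr IHz]].
    by rewrite expr0 divr1; split=> // i; rewrite subrr (nm0 ns) invr1 subrr mulr0.
  have it0 : 0 < (2 ^+ t : R)^-1 by rewrite invr_gt0.
  have it1 : (2 ^+ t : R)^-1 <= 1 by rewrite invf_le1 // exprn_ege1 // ler1n.
  have Uz : unit_ball x0 (z t).
    move=> i; split=> //; apply: le_trans (IHz i) _.
    apply: le_trans (_ : 2 * K * delta * 1 <= 1); last by rewrite mulr1.
    by apply: ler_wpM2l; [rewrite !mulr_ge0 // ltW | rewrite gerBl ltW].
  have r0' : 0 <= \sum_k nm (r (z t) k).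
    by apply: sumr_ge0 => k _; exact: nm_ge0 ns _.
  have e2 : (2 ^+ t.+1 : R)^-1 = (2 ^+ t)^-1 / 2 by rewrite exprSr invfM mulrC.
  split.
    apply: le_trans (rcP _ Uz) _; rewrite e2.
    set s := \sum_k _ in IHr r0' *; set u := (2 ^+ t)^-1 in IHr it0 it1 *.
    have : s ^+ 2 <= (delta * u) ^+ 2 by rewrite ler_pXn2r // nnegrE // mulr_ge0 // ltW.
    move=> /(ler_wpM2l (ltW K0)) h; apply: le_trans h _.
    have -> : K * (delta * u) ^+ 2 = (2 * K * delta) * (u * (delta * u / 2)) by field.
    apply: le_trans (_ : 1 * (u * (delta * u / 2)) <= _).
      by apply: ler_wpM2r => //; rewrite !mulr_ge0 // ltW.
    rewrite mul1r [leRHS]mulrA; apply: ler_piMl => //.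
    by rewrite !mulr_ge0 // ltW.
  move=> i; have -> : z t.+1 i - x0 i = (c (z t) i - z t i) + (z t i - x0 i).
    by rewrite addrA subrK.
  apply: le_trans (nmD ns _ _) _.
  - by apply: nsB => //; exact: Mc.
  - exact: nsB.
  apply: le_trans (lerD (cP _ Uz i) (IHz i)) _; rewrite e2.
  set s := \sum_k _ in IHr r0' *; set u := (2 ^+ t)^-1 in IHr it0 it1 *.
  move: IHr => /(ler_wpM2l (ltW K0)); lra.
have Uz t : unit_ball x0 (z t).
  move=> i; split=> //; apply: le_trans ((inv t).2 i) _.
  apply: le_trans (_ : 2 * K * delta * 1 <= 1); last by rewrite mulr1.
  apply: ler_wpM2l; first by rewrite !mulr_ge0 // ltW.
  by rewrite gerBl ltW // invr_gt0.
have step i t : nm (z t.+1 i - z t i) <= (K * delta) / 2 ^+ t.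
  apply: le_trans (cP _ (Uz t) i) _; rewrite -mulrA.
  by apply: ler_wpM2l; [exact: ltW | exact: (inv t).1].
have lim i : exists y, M y /\ forall e, 0 < e -> exists t0 : nat,
    forall t, (t0 <= t)%N -> nm (z t i - y) < e.
  by have [y My yP] := ns_complete ns (fun t => Mz t i) (step i); exists y.
have [x xP] := choice lim.
have Mx i : M (x i) by have [] := xP i.
have xx0 i : nm (x i - x0 i) <= 2 * K * delta.
  apply/ler_addgt0Pr => e e0; have [t0 t0P] := (xP i).2 _ e0.
  apply: le_trans (nm_triangle (Mx i) (Mz t0 i) (Mx0 i)) _.
  rewrite addrC; apply: lerD; last by rewrite nmC // ltW // t0P.
  apply: le_trans ((inv t0).2 i) _; rewrite -[leRHS]mulr1.
  apply: ler_wpM2l; first by rewrite !mulr_ge0 // ltW.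
  by rewrite gerBl ltW // invr_gt0.
exists x; split=> // k.
have Ux : unit_ball x0 x by move=> i; split=> //; exact: le_trans (xx0 i) _.
apply: (nm_eq0 ns); first exact: Mr.
apply/eqP; rewrite eq_le (nm_ge0 ns) andbT.
(* The residual at the limit is below any e: half of it comes from the residual of a late iterate,
   half from the Lipschitz bound, shared among the n variables. *)
apply/ler_addgt0Pr => e e0; rewrite add0r.
have eta0 : 0 < e / 2 / (K * n.+1%:R) by rewrite !divr_gt0 // mulr_gt0.
have [t0 t0P] := choice (fun i => (xP i).2 _ eta0).
have e2 : 0 < e / 2 by rewrite divr_gt0.
have [t1 t1P] := pow2_small delta e2.
pose t := maxn t1 (\max_i t0 i).
rewrite -[r x k](subrK (r (z t) k)); apply: le_trans (nmD ns _ _) _.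
- by apply: nsB; exact: Mr.
- exact: Mr.
have -> : e = e / 2 + e / 2 by field.
apply: lerD; last first.
  apply: le_trans (_ : _ <= delta / 2 ^+ t) _; last first.
    by apply/ltW/t1P; exact: leq_maxl.
  apply: le_trans _ (inv t).1; rewrite (bigD1 k) //= lerDl.
  by apply: sumr_ge0 => l _; exact: nm_ge0 ns _.
apply: le_trans (rlip _ _ Ux (Uz t) k) _.
rewrite mulrC -ler_pdivlMr //.
apply: (@le_trans _ _ (\sum_(i < n) e / 2 / (K * n.+1%:R))).
  apply: ler_sum => i _; rewrite nmC //; apply/ltW/t0P.
  by apply: leq_trans (leq_maxr _ _); exact: leq_bigmax.
rewrite sumr_const card_ord -[_ *+ _]mulr_natr invfM mulrA -mulrA.
apply: ler_piMr; first by rewrite divr_ge0 // ltW.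
by rewrite mulrC ler_pdivrMr // mul1r ler_nat leqnSn.
Qed.

End NormedSubring.

(** * Convergence in L and openness of full row rank *)

Section AbsoluteConvergence.
Variables (R : realType) (L : localFieldType R).
Variables (T : Type) (Ft : set_system T).
Hypothesis FtF : Filter Ft.

Definition absv_cvg (f : T -> L) (l : L) :=
  forall e : R, 0 < e -> \forall t \near Ft, absv (f t - l) < e.

Lemma absv_cvg_cst l : absv_cvg (fun=> l) l.
Proof. by move=> e e0; apply: nearW => t; rewrite subrr absv0. Qed.

Lemma absv_cvgD f g a b :
  absv_cvg f a -> absv_cvg g b -> absv_cvg (fun t => f t + g t) (a + b).
Proof.
move=> fa gb e e0; have e2 : 0 < e / 2 by rewrite divr_gt0.
apply: filterS2 (fa _ e2) (gb _ e2) => t h1 h2.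
rewrite opprD addrACA; apply: le_lt_trans (absvD _ _) _; lra.
Qed.

Lemma absv_cvgM f g a b :
  absv_cvg f a -> absv_cvg g b -> absv_cvg (fun t => f t * g t) (a * b).
Proof.
move=> fa gb e e0.
have a0 := absv_ge0 a; have b0 := absv_ge0 b.
pose S := absv a + 1 + absv b + 1.
have S0 : 0 < S by rewrite /S; lra.
have d0 : 0 < e / S by rewrite divr_gt0.
apply: filterS2 (filterI (fa _ d0) (fa _ ltr01)) (gb _ d0) => t [h1 h3] h2.
have -> : f t * g t - a * b = f t * (g t - b) + (f t - a) * b by ring.
apply: le_lt_trans (absvD _ _) _; rewrite !absvM.
have fb : absv (f t) <= absv a + 1.
  rewrite -[f t](subrK a) addrC; apply: le_trans (absvD _ _) _; lra.
have -> : e = (absv a + 1) * (e / S) + (absv b + 1) * (e / S).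
  by rewrite -mulrDl addrA -/S mulrC divfK // gt_eqF.
apply: ler_ltD; first by apply: ler_pM; rewrite ?absv_ge0 // ltW.
apply: le_lt_trans (_ : absv b * (e / S) < _).
  by rewrite mulrC; apply: ler_wpM2l => //; exact: ltW.
by rewrite ltr_pM2r // ltrDl.
Qed.

Lemma absv_cvg_sum (I : finType) (f : T -> I -> L) (a : I -> L) (P : pred I) :
  (forall i, absv_cvg (f ^~ i) (a i)) ->
  absv_cvg (fun t => \sum_(i | P i) f t i) (\sum_(i | P i) a i).
Proof.
move=> fa; elim: (index_enum I) => [|i s IH].
  rewrite big_nil; have -> : (fun t => \sum_(i <- [::] | P i) f t i) = (fun=> 0).
    by apply/funext => t; rewrite big_nil.
  exact: absv_cvg_cst.
rewrite big_cons; have -> : (fun t => \sum_(j <- i :: s | P j) f t j) =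
    (fun t => if P i then f t i + \sum_(j <- s | P j) f t j else \sum_(j <- s | P j) f t j).
  by apply/funext => t; rewrite big_cons.
by case: (P i) => //; exact: absv_cvgD.
Qed.

Lemma absv_cvg_prod (I : finType) (f : T -> I -> L) (a : I -> L) :
  (forall i, absv_cvg (f ^~ i) (a i)) ->
  absv_cvg (fun t => \prod_i f t i) (\prod_i a i).
Proof.
move=> fa; elim: (index_enum I) => [|i s IH].
  rewrite big_nil; have -> : (fun t => \prod_(i <- [::]) f t i) = (fun=> 1).
    by apply/funext => t; rewrite big_nil.
  exact: absv_cvg_cst.
rewrite big_cons; have -> : (fun t => \prod_(j <- i :: s) f t j) =
    (fun t => f t i * \prod_(j <- s) f t j).
  by apply/funext => t; rewrite big_cons.
exact: absv_cvgM.
Qed.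

Lemma absv_cvg_det n (f : T -> 'M[L]_n) (a : 'M[L]_n) :
  (forall i k, absv_cvg (fun t => f t i k) (a i k)) ->
  absv_cvg (fun t => \det (f t)) (\det a).
Proof.
move=> fa; apply: absv_cvg_sum => s; apply: absv_cvgM; first exact: absv_cvg_cst.
exact: absv_cvg_prod.
Qed.

(** The product [a *m pinvmx a] is the identity, so the determinant of [f t *m pinvmx a] tends to 1
    and is eventually nonzero. *)
Lemma row_free_near m n (f : T -> 'M[L]_(m, n)) (a : 'M[L]_(m, n)) :
  (forall i k, absv_cvg (fun t => f t i k) (a i k)) -> row_free a ->
  \forall t \near Ft, row_free (f t).
Proof.
move=> fa afree.
have : absv_cvg (fun t => \det (f t *m pinvmx a)) (\det (a *m pinvmx a)).
  apply: absv_cvg_det => i k; rewrite [X in absv_cvg _ X]mxE.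
  have -> : (fun t => (f t *m pinvmx a) i k) =
      (fun t => \sum_j f t i j * pinvmx a j k) by apply/funext => t; rewrite mxE.
  apply: absv_cvg_sum => j; apply: absv_cvgM => //; exact: absv_cvg_cst.
rewrite mulmxVp // det1 => /(_ _ ltr01); apply: filterS => t h.
have : f t *m pinvmx a \in unitmx.
  rewrite unitmxE unitfE; apply: contraTneq h => ->.
  by rewrite sub0r absvN absv1 ltxx.
rewrite -row_free_unit -!row_leq_rank => h'; apply: leq_trans h' _.
exact: mxrankM_maxl.
Qed.

End AbsoluteConvergence.

(** * Local constancy of the stabilizer of the fibre *)

Section FibreStabilizer.
Variables (A B : comPzRingType) (phi : {rmorphism A -> B}).
Variables (L F : fieldType) (iota : {rmorphism L -> F}).

Definition over (alpha : {rmorphism A -> L}) (psi : {rmorphism B -> F}) :=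
  forall a, psi (phi a) = iota (alpha a).

Definition fixes_fibre (alpha : {rmorphism A -> L}) (sg : {rmorphism F -> F}) :=
  forall psi, over alpha psi -> forall b, sg (psi b) = psi b.

(** A further point would give d + 1 distinct ones beside r independent relations, exceeding N = r +
    d. *)
Lemma fibre_points_complete (N : nat) (g : 'I_N -> B)
    (g_gen : forall y, exists c : 'I_N -> A, y = \sum_(i < N) phi (c i) * g i)
    (alpha : {rmorphism A -> L})
    r (rho : 'I_r -> 'I_N -> A) d (psi : 'I_d -> {rmorphism B -> F}) :
  (forall i, relation phi g (rho i)) ->
  row_free (\matrix_(i, k) alpha (rho i k)) ->
  (forall t, over alpha (psi t)) ->
  (forall t t', psi t =1 psi t' -> t = t') -> (r + d = N)%N ->
  forall chi, over alpha chi -> exists t, chi =1 psi t.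
Proof.
move=> rel free psiA inj rdN chi chiA; apply: contrapT => /forallNP no.
pose psi' (i : 'I_d.+1) := if unlift ord_max i is Some k then psi k else chi.
have : (r + d.+1 <= N)%N.
  apply: (fibre_points_bound g_gen rel free (psi := psi') (iota := iota)).
    by move=> t a; rewrite /psi'; case: unliftP => [k _|_]; [exact: psiA | exact: chiA].
  move=> t t'; rewrite /psi'.
  case: unliftP => [k ->|->]; case: unliftP => [k' ->|->] // h.
  - by rewrite (inj _ _ h).
  - by case: (no k) => b; rewrite h.
  - by case: (no k').
by rewrite -rdN leq_add2l ltnn.
Qed.

End FibreStabilizer.

Section LocalConstancy.
Variables (A B : comPzRingType) (phi : {rmorphism A -> B}).
Variables (R : realType) (L : localFieldType R) (F : fieldType).
Variable iota : {rmorphism L -> F}.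
Variables (T : Type) (Ft : set_system T).
Hypothesis FtF : Filter Ft.
Variables (alpha : T -> {rmorphism A -> L}) (alpha0 : {rmorphism A -> L}).
Hypothesis alpha_cv : forall a e, 0 < e ->
  \forall t \near Ft, absv (alpha t a - alpha0 a) < e.
Variables (M : set F) (nm : F -> R).
Hypothesis ns : normed_subring iota M nm.

Lemma solutions_near n m (r : 'I_m -> pexpr A n)
    (c : 'I_n -> pexpr A n) (D : 'I_n -> 'I_m -> pexpr A n)
    (Q : 'I_m -> 'I_m * 'I_m -> pexpr A n) (x0 : 'I_n -> F) (eta : R) :
  (forall (C : comPzRingType) (psi : {rmorphism A -> C}) (x : 'I_n -> C),
    (forall i, peval psi x (c i) =
       x i + \sum_l peval psi x (D i l) * peval psi x (r l)) /\
    (forall k, peval psi (fun i => peval psi x (c i)) (r k) =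
       \sum_l peval psi x (Q k l) * (peval psi x (r l.1) * peval psi x (r l.2)))) ->
  (forall i, M (x0 i)) -> (forall k, peval (iota \o alpha0) x0 (r k) = 0) ->
  0 < eta ->
  \forall t \near Ft, exists x, [/\ forall i, M (x i),
    forall k, peval (iota \o alpha t) x (r k) = 0 &
    forall i, nm (x i - x0 i) <= eta].
Proof.
move=> newton Mx0 rx0 eta0.
(* The constants are chosen for all indices at once; the [let] turns [exists2] into the [exists]
   that [choice] takes. *)
have [KD KDP] := choice (fun il : 'I_n * 'I_m =>
  let: ex_intro2 K K0 h := peval_bound ns FtF alpha_cv Mx0 (D il.1 il.2) in
  ex_intro (fun K => 0 <= K /\ \forall t \near Ft, forall x, unit_ball M nm x0 x ->
    nm (peval (iota \o alpha t) x (D il.1 il.2)) <= K) K (conj K0 h)).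
have [KQ KQP] := choice (fun kl : 'I_m * ('I_m * 'I_m) =>
  let: ex_intro2 K K0 h := peval_bound ns FtF alpha_cv Mx0 (Q kl.1 kl.2) in
  ex_intro (fun K => 0 <= K /\ \forall t \near Ft, forall x, unit_ball M nm x0 x ->
    nm (peval (iota \o alpha t) x (Q kl.1 kl.2)) <= K) K (conj K0 h)).
have [Kr KrP] := choice (fun k : 'I_m =>
  let: ex_intro2 K K0 h := peval_lipschitz ns FtF alpha_cv Mx0 (r k) in
  ex_intro (fun K => 0 <= K /\ \forall t \near Ft, forall x y,
    unit_ball M nm x0 x -> unit_ball M nm x0 y ->
    nm (peval (iota \o alpha t) x (r k) - peval (iota \o alpha t) y (r k)) <=
      K * \sum_i nm (x i - y i)) K (conj K0 h)).
pose SD := \sum_il KD il; pose SQ := \sum_kl KQ kl; pose Sr := \sum_k Kr k.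
have SD0 : 0 <= SD by apply: sumr_ge0 => i _; exact: (KDP i).1.
have SQ0 : 0 <= SQ by apply: sumr_ge0 => i _; exact: (KQP i).1.
have Sr0 : 0 <= Sr by apply: sumr_ge0 => i _; exact: (KrP i).1.
have KD_le il : KD il <= SD.
  by rewrite /SD (bigD1 il) //= lerDl; apply: sumr_ge0 => i _; exact: (KDP i).1.
have Kr_le k : Kr k <= Sr.
  by rewrite /Sr (bigD1 k) //= lerDl; apply: sumr_ge0 => i _; exact: (KrP i).1.
pose K := 1 + SD + SQ + Sr.
have K0 : 0 < K by rewrite /K; lra.
(* The radius 2 K delta will be mu: at most 1, as Newton's method requires, and at most eta, as the
   conclusion requires. *)
pose mu := Num.min 1 eta.
have mu0 : 0 < mu by rewrite lt_min ltr01.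
have mu1 : mu <= 1 by rewrite ge_min lexx.
have mueta : mu <= eta by rewrite ge_min lexx orbT.
pose delta := mu / (2 * K).
have delta0 : 0 < delta by rewrite divr_gt0 // mulr_gt0.
have Kdelta : 2 * K * delta = mu by rewrite /delta mulrC divfK // gt_eqF // mulr_gt0.
(* With each of the m equations within delta / (m + 1), the total residual is at most delta, also
   for m = 0. *)
have dm0 : 0 < delta / m.+1%:R by rewrite divr_gt0.
have nD := filter_forall FtF (fun il => (KDP il).2).
have nQ := filter_forall FtF (fun kl => (KQP kl).2).
have nr := filter_forall FtF (fun k => (KrP k).2).
have nr0 := filter_forall FtF (fun k => peval_cvg ns FtF alpha_cv Mx0 (r k) dm0).
apply: filterS2 (filterI nD nQ) (filterI nr nr0) => t [{}nD {}nQ] [{}nr {}nr0].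
have S0 x : 0 <= \sum_k nm (peval (iota \o alpha t) x (r k)).
  by apply: sumr_ge0 => i _; exact: nm_ge0 ns _.
have le_S x k : nm (peval (iota \o alpha t) x (r k)) <=
    \sum_k nm (peval (iota \o alpha t) x (r k)).
  rewrite (bigD1 k) //= lerDl; apply: sumr_ge0 => i _; exact: nm_ge0 ns _.
have MN := peval_ns ns (alpha t).
have [|||||||x [Mx rx xx0]] := @newton_zero _ _ _ _ _ _ ns n m x0
    (fun x i => peval (iota \o alpha t) x (c i))
    (fun x k => peval (iota \o alpha t) x (r k)) K delta Mx0 _ _ K0 (ltW delta0).
- by move=> x Mx k; exact: MN.
- by move=> x Mx k; exact: MN.
- by rewrite Kdelta.
- move=> x Ux i; have Mx := unit_ball_ns Ux.
  have e := (newton F (iota \o alpha t : {rmorphism A -> F}) x).1 i.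
  have -> : peval (iota \o alpha t) x (c i) - x i = \sum_l
      peval (iota \o alpha t) x (D i l) * peval (iota \o alpha t) x (r l).
    by move: e => /= ->; rewrite addrC addKr.
  apply: le_trans (nm_sum ns _) _ => [l|]; first by apply: (nsM ns); exact: MN.
  apply: le_trans (_ : SD * \sum_k nm (peval (iota \o alpha t) x (r k)) <= _).
    rewrite mulr_sumr; apply: ler_sum => l _; apply: (nmM_le ns); rewrite ?MN //.
    exact: MN. exact: MN.
    exact: le_trans (nD (i, l) x Ux) (KD_le _).
  apply: ler_wpM2r; [exact: S0 | rewrite /K; lra].
- move=> x Ux; have Mx := unit_ball_ns Ux.
  set S := \sum_k nm (peval (iota \o alpha t) x (r k)).
  have SS0 : 0 <= S by exact: S0.
  apply: le_trans (_ : SQ * S ^+ 2 <= _); last first.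
    apply: ler_wpM2r; [exact: sqr_ge0 | rewrite /K; lra].
  have -> : SQ * S ^+ 2 = \sum_k \sum_l KQ (k, l) * S ^+ 2.
    by rewrite pair_bigA /= mulr_suml; apply: eq_bigr => -[].
  apply: ler_sum => k _.
  have e := (newton F (iota \o alpha t : {rmorphism A -> F}) x).2 k.
  move: e => /= ->; apply: le_trans (nm_sum ns _) _ => [l|].
    by apply: (nsM ns); [|apply: (nsM ns)]; exact: MN.
  apply: ler_sum => l _; apply: (nmM_le ns).
  + exact: MN.
  + by apply: (nsM ns); exact: MN.
  + exact: (nQ (k, l) x Ux).
  + by rewrite expr2; apply: (nmM_le ns); rewrite ?le_S //; exact: MN.
- move=> x y Ux Uy k; apply: le_trans (nr k x y Ux Uy) _.
  apply: ler_wpM2r; first by apply: sumr_ge0 => i _; exact: nm_ge0 ns _.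
  by apply: le_trans (Kr_le k) _; rewrite /K; lra.
- apply: le_trans (_ : \sum_(k < m) delta / m.+1%:R <= _).
    by apply: ler_sum => k _; have := nr0 k; rewrite rx0 subr0 => /ltW.
  rewrite sumr_const card_ord -[_ *+ _]mulr_natr -mulrA.
  apply: ler_piMr; first exact: ltW.
  by rewrite mulrC ler_pdivrMr // mul1r ler_nat leqnSn.
exists x; split=> // i; apply: le_trans (xx0 i) _; by rewrite Kdelta.
Qed.

End LocalConstancy.

Theorem fixes_fibre_near (A B : comPzRingType) (phi : {rmorphism A -> B})
    (R : realType) (L : localFieldType R) (F : fieldType)
    (iota : {rmorphism L -> F})
    (F_closed : forall p : {poly F}, separable_poly p -> (1 < size p)%N ->
       exists x, root p x)
    (T : Type) (Ft : set_system T) (FtF : Filter Ft)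
    (alpha : T -> {rmorphism A -> L}) (alpha0 : {rmorphism A -> L}) :
  finite_alg phi -> etale_alg phi ->
  (forall a e, 0 < e -> \forall t \near Ft, absv (alpha t a - alpha0 a) < e) ->
  \forall t \near Ft, forall sg : {rmorphism F -> F},
    (forall c, sg (iota c) = iota c) ->
    (fixes_fibre phi iota (alpha t) sg <-> fixes_fibre phi iota alpha0 sg).
Proof.
move=> [N [g g_gen]] [[n [b [m [r [r0 univ]]]]] et] alpha_cv.
have unr := formally_etale_no_derivation et.
have [p [rho [d [psi [pdN rel free psiA psi_inj]]]]] :=
  unramified_fibre_points g_gen unr alpha0 iota F_closed.
have complete0 := fibre_points_complete g_gen rel free psiA psi_inj pdN.
have [M [nm [K [ns Mpsi K0 Msg Mfix]]]] := compositum_normed g_gen psiA.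
have [c [D [Q newton]]] := newton_exprs r0 univ et.
have free_near : \forall t \near Ft, row_free (\matrix_(i, k) alpha t (rho i k)).
  apply: (row_free_near FtF _ free) => i k e e0.
  by apply: filterS (alpha_cv (rho i k) e e0) => t; rewrite !mxE.
have root0 i k : peval (iota \o alpha0) (fun l => psi i (b l)) (r k) = 0.
  rewrite -(rmorph0 (psi i)) -(r0 k) peval_rmorph; apply: eq_peval => // a.
  by rewrite /= psiA.
(* Morphisms over the same base point are determined by their values on the generators b, so these
   values suffice to separate the points of a fibre. *)
have ext (alp : {rmorphism A -> L}) (chi chi' : {rmorphism B -> F}) :
    over phi iota alp chi -> over phi iota alp chi' ->
    (forall l, chi (b l) = chi' (b l)) -> chi =1 chi'.
  move=> h h' hb.
  have hr k : peval (iota \o alp) (fun l => chi (b l)) (r k) = 0.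
    rewrite -(rmorph0 chi) -(r0 k) peval_rmorph; apply: eq_peval => // a.
    by rewrite /= h.
  have [_ uniq] := univ F (iota \o alp : {rmorphism A -> F}) _ hr.
  by apply: uniq.
pose sep i j := \sum_l nm (psi i (b l) - psi j (b l)).
have sep0 i j : i != j -> 0 < sep i j.
  move=> ij; rewrite lt_def sumr_ge0 ?andbT; last by move=> l _; exact: nm_ge0 ns _.
  apply: contra ij; rewrite psumr_eq0 => [/allP h|l _]; last exact: nm_ge0 ns _.
  apply/eqP/psi_inj/(ext alpha0) => // l; apply/eqP; rewrite -subr_eq0; apply/eqP.
  apply: (nm_eq0 ns); first by apply: (nsB ns).
  by apply/eqP/h; rewrite mem_index_enum.
(* The margin serves two comparisons: points with a common deformation are within 2 eta on each
   generator, and an automorphism fixing the deformations moves a point by at most (K + 1) eta. The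
   factor n + 1 accounts for the sum over the generators. *)
have [eta eta0 etaP] : exists2 eta, 0 < eta &
    forall i j, i != j -> (K + 1) * (eta * n.+1%:R) *+ 2 < sep i j.
  pose f (ij : 'I_d * 'I_d) := if ij.1 != ij.2 then sep ij.1 ij.2 else 1.
  have f0 ij : 0 < f ij by rewrite /f; case: ifPn => // /sep0.
  pose mu := \big[Num.min/1]_ij f ij.
  have mu0 : 0 < mu.
    by rewrite /mu; elim/big_ind: _ => // x y x0 y0; rewrite lt_min x0.
  have muf ij : mu <= f ij by exact: bigmin_le_cond.
  have K1 : 0 < K + 1 by rewrite ltr_wpDl.
  exists (mu / 4 / ((K + 1) * n.+1%:R)).
    by rewrite !divr_gt0 // mulr_gt0.
  move=> i j ij; have := muf (i, j); rewrite /f /= ij; apply: lt_le_trans.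
  have -> : (K + 1) * (mu / 4 / ((K + 1) * n.+1%:R) * n.+1%:R) = mu / 4.
    have u0 : 0 < n.+1%:R :> R by rewrite ltr0n.
    move: n.+1%:R u0 => u u0; field; by rewrite !gt_eqF.
  lra.
have sol := filter_forall FtF (fun i =>
  solutions_near FtF alpha_cv ns newton (fun l => Mpsi i (b l)) (root0 i) eta0).
apply: filterS2 sol free_near => t sol free_t sg sgi.
have [x xP] := choice sol.
have lift i : exists chi : {rmorphism B -> F}, over phi iota (alpha t) chi /\
    forall l, chi (b l) = x i l.
  have [_ xr _] := xP i.
  by have [[w wP] _] := univ F (iota \o alpha t : {rmorphism A -> F}) _ xr; exists w.
have [chi chiP] := choice lift.
have chiA i : over phi iota (alpha t) (chi i) by have [] := chiP i.
have chib i l : chi i (b l) = x i l by have [] := chiP i.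
have Mx i l : M (x i l) by have [h _ _] := xP i; exact: h.
have xnear i l : nm (x i l - psi i (b l)) <= eta.
  by have [_ _ h] := xP i; exact: h.
have K1 : 1 <= K + 1 by rewrite lerDr.
have sep_le i j C : (forall l, nm (psi i (b l) - psi j (b l)) <= C) -> 0 <= C ->
    sep i j <= C * n.+1%:R.
  move=> h C0; apply: le_trans (_ : \sum_(l < n) C <= _); first exact: ler_sum.
  by rewrite sumr_const card_ord -[_ *+ _]mulr_natr ler_wpM2l // ler_nat.
have chi_inj i j : chi i =1 chi j -> i = j.
  move=> h; apply/eqP; apply: contraT => /etaP; rewrite ltNge => /negP[].
  apply: le_trans (@sep_le i j (eta *+ 2) _ _) _.
  - move=> l; apply: le_trans (nm_triangle ns (Mpsi _ _) (Mx i l) (Mpsi _ _)) _.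
    rewrite (nmC ns) // mulr2n; apply: lerD => //.
    by rewrite -chib h chib.
  - by rewrite mulrn_wge0 // ltW.
  rewrite mulrnAl lerMn2r /=.
  by apply: ler_peMl => //; rewrite mulr_ge0 // ltW.
(* The d deformed points are distinct and the r relations are still independent at alpha t, so these
   are all the points over alpha t. *)
have complete_t := fibre_points_complete g_gen rel free_t chiA chi_inj pdN.
split=> fix_sg ps psA.
  (* Here sg permutes the points psi over alpha_0 and fixes the deformed ones. If sg maps psi_i to
     psi_j, both are close to x_i, since x_i - psi_j = sg (x_i - psi_i); hence i = j. *)
  have over_sg s : over phi iota alpha0 (sg \o psi s).
    by move=> a; rewrite /= psiA sgi.
  have perm s : exists s', forall c', sg (psi s c') = psi s' c'.
    by have [s' h] := complete0 _ (over_sg s); exists s' => c'; exact: h.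
  have [i psE] := complete0 ps psA; have [j jE] := perm i.
  move=> c'; rewrite psE jE; suff -> : i = j by [].
  apply/eqP; apply: contraT => /etaP; rewrite ltNge => /negP[].
  apply: le_trans (@sep_le i j ((K + 1) * eta) _ _) _.
  - move=> l; have MB : M (x i l - psi i (b l)) by exact: (nsB ns).
    have [Msx nsx] := Msg sg sgi perm _ MB.
    have e1 : sg (x i l - psi i (b l)) = x i l - psi j (b l).
      by rewrite rmorphB jE -chib fix_sg.
    apply: le_trans (nm_triangle ns (Mpsi _ _) (Mx i l) (Mpsi _ _)) _.
    rewrite addrC mulrDl mul1r; apply: lerD; last by rewrite (nmC ns).
    by rewrite -e1; apply: le_trans nsx _; exact: ler_wpM2l.
  - by rewrite mulr_ge0 // ?ltW //; lra.
  rewrite -mulrA mulr2n lerDl mulr_ge0 //; first lra.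
  by rewrite mulr_ge0 // ltW.
(* The deformed points take values in M on the generators, and an automorphism that fixes every psi
   is trivial on M. *)
have [i psE] := complete_t ps psA.
suff h : sg \o chi i =1 chi i by move=> c'; rewrite psE; exact: h.
apply: (ext (alpha t)) => // [a|l] /=; first by rewrite chiA sgi.
by rewrite chib; apply: (Mfix sg sgi) => // s c'; exact: fix_sg.
Qed.

(** * Points of schemes with values in a field *)

Definition opensI (X : topologicalType) (U V : opens X) : opens X :=
  Opens (openI (opens_open U) (opens_open V)).

Section RingedSpaceLemmas.
Variable X : ringed_space.
Implicit Types U V W : opens X.

Lemma nonvanishing_open U (a : sec X U) : open (nonvanishing a).
Proof.
rewrite openE => x [Ux [V [hVU [Vx inv]]]].
rewrite /interior /= nbhsE; exists V; first by split; [exact: opens_open | exact: Vx].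
by move=> y Vy; split; [exact: (hVU y) | exists V, hVU].
Qed.

Definition basic_open U (a : sec X U) : opens X := Opens (nonvanishing_open a).

Lemma basic_open_sub U (a : sec X U) : basic_open a `<=` U.
Proof. by move=> x []. Qed.

Lemma invertible_at_res U V (h : V `<=` U) (s : sec X U) x :
  V x -> invertible_at (res X h s) x <-> invertible_at s x.
Proof.
move=> Vx; split=> [[W [hW [Wx inv]]]|[W [hW [Wx [b bP]]]]].
  exists W, (subset_trans hW h); split=> //.
  by rewrite -(res_comp h hW).
have hVW : opensI V W `<=` V by move=> y [].
have hWW : opensI V W `<=` W by move=> y [].
exists (opensI V W), hVW; split; first by split.
exists (res X hWW b); rewrite (res_comp h hVW (subset_trans hVW h)).
by rewrite -(res_comp hW hWW) -rmorphM bP rmorph1.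
Qed.

Lemma invertible_atM U (s t : sec X U) x :
  U x -> invertible_at (s * t) x <-> invertible_at s x /\ invertible_at t x.
Proof.
move=> Ux; split=> [[V [h [Vx [b]]]]|[[V [h [Vx [b bP]]]] [W [h' [Wx [c cP]]]]]].
  rewrite rmorphM => bP; split; exists V, h; split=> //.
    by exists (res X h t * b); rewrite mulrA.
  by exists (res X h s * b); rewrite mulrA [_ * res X h s]mulrC.
have hV : opensI V W `<=` V by move=> y [].
have hW : opensI V W `<=` W by move=> y [].
exists (opensI V W), (subset_trans hV h); split; first by split.
exists (res X hV b * res X hW c); rewrite rmorphM.
rewrite -[res X _ s](res_comp h hV) -[res X _ t](res_comp h' hW).
rewrite mulrACA -!rmorphM bP cP; rewrite !rmorph1; exact: mulr1.
Qed.

(** Near x, any section s is a fraction t / a^n of sections over the affine U, so sections over U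
    control all germs at x. *)
Lemma affine_section U V (s : sec X V) x : affine U -> U x -> V x ->
  exists (a t : sec X U) n (hV : basic_open a `<=` V),
    [/\ invertible_at a x,
        res X hV s * res X (@basic_open_sub U a) a ^+ n =
        res X (@basic_open_sub U a) t &
        forall z : sec X U, res X (@basic_open_sub U a) z = 0 ->
          exists m, a ^+ m * z = 0].
Proof.
move=> [_ _ basis loc] Ux Vx.
have sub : opensI V U `<=` U by move=> y [].
have [a [[_ ax] hx]] := basis _ _ sub (conj Vx Ux).
have hV : basic_open a `<=` V by move=> y /hx[].
have [_ surj ker] := loc a (basic_open a) (@basic_open_sub U a) erefl.
by have [t [n e]] := surj (res X hV s); exists a, t, n, hV; split.
Qed.

End RingedSpaceLemmas.

Section KPoints.
Variables (K : fieldType) (X : kscheme K) (F : fieldType) (j : {rmorphism K -> F}).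

Lemma ev_eq0 (x : kpoint X j) (U : opens X) (h : U (pt x)) (s : sec X U) :
  ev h s = 0 <-> ~ invertible_at s (pt x).
Proof.
split=> [s0 [V [hV [Vx [b bP]]]]|ninv].
  have : ev Vx (res X hV s * b) = 1 by rewrite bP rmorph1.
  by rewrite rmorphM (ev_res hV h Vx) s0 mul0r => /eqP; rewrite eq_sym oner_eq0.
by apply/eqP; apply: contraT => /ev_local /ninv.
Qed.

(** The kernel of evaluation on U is the vanishing ideal of the point, which determines it as U is
    affine. The other evaluations follow by writing sections as fractions. *)
Lemma kpoint_ext (x y : kpoint X j) (U : opens X) (hx : U (pt x)) (hy : U (pt y)) :
  affine U -> (forall s, ev hx s = ev hy s) -> x = y.
Proof.
move=> Ua e.
have pxy : pt x = pt y.
  have [_ inj _ _] := Ua; apply: inj => //; apply/funext => s; apply/propext.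
  have vx := ev_eq0 hx s; have vy := ev_eq0 hy s; rewrite e in vx.
  by split=> h; [apply/vy/vx | apply/vx/vy].
have evE (V : opens X) (hVx : V (pt x)) (hVy : V (pt y)) s : ev hVx s = ev hVy s.
  have [a [t [n [hV [ax st _]]]]] := affine_section s Ua hx hVx.
  have Dx : basic_open a (pt x) by split.
  have Dy : basic_open a (pt y) by rewrite -pxy.
  have ex := congr1 (ev Dx) st; have ey := congr1 (ev Dy) st.
  rewrite rmorphM rmorphXn /= !(ev_res _ hx) (ev_res _ hVx) in ex.
  rewrite rmorphM rmorphXn /= !(ev_res _ hy) (ev_res _ hVy) -!e -ex in ey.
  have a0 : ev hx a != 0 by apply/eqP => /ev_eq0.
  by apply: (mulIf (expf_neq0 n a0)).
case: x y pxy evE {hx hy e} => [p e e1 e2 e3] [q f f1 f2 f3] /= pq evE; subst q.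
have ef : e = f.
  apply: functional_extensionality_dep => V.
  apply: functional_extensionality_dep => h.
  by apply: rmorph_ext => s; exact: evE.
subst f; congr KPoint; exact: Prop_irrelevance.
Qed.

Section PointOfMorphism.
Variables (U : opens X) (Ua : affine U) (chi : {rmorphism sec X U -> F}).
Hypothesis chi_scal : forall c, chi (scal U c) = j c.
Variable p : X.
Hypothesis Up : U p.
Hypothesis chi_ker : [set s | chi s = 0] = @vanishing_ideal X U p.

Let chi_neq0 s : chi s != 0 <-> invertible_at s p.
Proof.
have e : (chi s = 0) = ~ invertible_at s p := congr1 (fun P => P s) chi_ker.
split=> [/eqP h|inv]; first by apply: contrapT; rewrite -e.
by apply/eqP; rewrite e.
Qed.

Let res_chi0 (V : opens X) (h : V `<=` U) (z : sec X U) :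
  V p -> res X h z = 0 -> chi z = 0.
Proof.
move=> Vp z0; have [a [t [n [hV [ap _ ker]]]]] := affine_section 0 Ua Up Vp.
have [|m] := ker z; first by rewrite -(res_comp h hV) z0 rmorph0.
move=> /(congr1 chi); rewrite rmorphM rmorphXn rmorph0 => /eqP.
by rewrite mulf_eq0 expf_eq0 (negPf (proj2 (chi_neq0 a) ap)) andbF => /eqP.
Qed.

(** The graph of the extension of chi to the stalk at p: near p, s is the fraction t / c, and y is
    chi t / chi c. As a relation it needs no choice of fraction, and the morphism laws follow from
    uniqueness. *)
Definition germ_value (W : opens X) (s : sec X W) (y : F) :=
  exists (V : opens X) (hU : V `<=` U) (hW : V `<=` W) (c t : sec X U),
  [/\ V p, chi c != 0, res X hU c * res X hW s = res X hU t & chi c * y = chi t].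

Lemma germ_value_ex (W : opens X) (Wp : W p) (s : sec X W) :
  exists y, germ_value s y.
Proof.
have [a [t [n [hV [ap st _]]]]] := affine_section s Ua Up Wp.
have a0 := expf_neq0 n (proj2 (chi_neq0 a) ap).
exists (chi t / chi a ^+ n), (basic_open a), (@basic_open_sub _ U a), hV, (a ^+ n), t.
rewrite !rmorphXn; split=> //; first by rewrite mulrC.
by rewrite mulrC divfK.
Qed.

Lemma germ_value_uniq (W : opens X) (s : sec X W) (y y' : F) :
  germ_value s y -> germ_value s y' -> y = y'.
Proof.
move=> [V [hU [hW [c [t [Vp c0 st cy]]]]]] [V' [hU' [hW' [c' [t' [Vp' c0' st' cy']]]]]].
have hV : opensI V V' `<=` V by move=> z [].
have hV' : opensI V V' `<=` V' by move=> z [].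
have hVU := subset_trans hV hU; have hVW := subset_trans hV hW.
have e := congr1 (res X hV) st; have e' := congr1 (res X hV') st'.
rewrite rmorphM !(res_comp _ hV hVU) (res_comp _ hV hVW) in e.
rewrite rmorphM !(res_comp _ hV' hVU) (res_comp _ hV' hVW) in e'.
have z0 : res X hVU (c' * t - c * t') = 0.
  by rewrite rmorphB !rmorphM -e -e' mulrCA subrr.
have VVp : opensI V V' p by split.
have /eqP := res_chi0 VVp z0.
rewrite rmorphB !rmorphM -cy -cy' subr_eq0 => /eqP h.
by apply: (mulfI c0'); apply: (mulfI c0); rewrite mulrCA h.
Qed.

Lemma germ_valueB (W : opens X) (s s' : sec X W) (y y' : F) :
  germ_value s y -> germ_value s' y' -> germ_value (s - s') (y - y').
Proof.
move=> [V [hU [hW [c [t [Vp c0 st cy]]]]]] [V' [hU' [hW' [c' [t' [Vp' c0' st' cy']]]]]].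
have hV : opensI V V' `<=` V by move=> z [].
have hV' : opensI V V' `<=` V' by move=> z [].
have hVU := subset_trans hV hU; have hVW := subset_trans hV hW.
have e := congr1 (res X hV) st; have e' := congr1 (res X hV') st'.
rewrite rmorphM !(res_comp _ hV hVU) (res_comp _ hV hVW) in e.
rewrite rmorphM !(res_comp _ hV' hVU) (res_comp _ hV' hVW) in e'.
exists (opensI V V'), hVU, hVW, (c * c'), (c' * t - c * t'); split.
- by split.
- by rewrite rmorphM mulf_neq0.
- by rewrite !rmorphB !rmorphM -e -e'; ring.
- by rewrite rmorphB !rmorphM -cy -cy'; ring.
Qed.

Lemma germ_valueM (W : opens X) (s s' : sec X W) (y y' : F) :
  germ_value s y -> germ_value s' y' -> germ_value (s * s') (y * y').
Proof.
move=> [V [hU [hW [c [t [Vp c0 st cy]]]]]] [V' [hU' [hW' [c' [t' [Vp' c0' st' cy']]]]]].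
have hV : opensI V V' `<=` V by move=> z [].
have hV' : opensI V V' `<=` V' by move=> z [].
have hVU := subset_trans hV hU; have hVW := subset_trans hV hW.
have e := congr1 (res X hV) st; have e' := congr1 (res X hV') st'.
rewrite rmorphM !(res_comp _ hV hVU) (res_comp _ hV hVW) in e.
rewrite rmorphM !(res_comp _ hV' hVU) (res_comp _ hV' hVW) in e'.
exists (opensI V V'), hVU, hVW, (c * c'), (t * t'); split.
- by split.
- by rewrite rmorphM mulf_neq0.
- by rewrite !rmorphM -e -e'; ring.
- by rewrite !rmorphM -cy -cy'; ring.
Qed.

Lemma germ_value_res (W : opens X) (h : U `<=` W) (s : sec X W) :
  germ_value s (chi (res X h s)).
Proof.
exists U, (@subset_refl _ U), h, 1, (res X h s).
by split=> //; rewrite ?rmorph1 ?oner_eq0 // ?mul1r // res_id.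
Qed.

Lemma germ_value_sub (W W' : opens X) (h : W' `<=` W) (s : sec X W) y :
  W' p -> germ_value s y -> germ_value (res X h s) y.
Proof.
move=> Wp [V [hU [hW [c [t [Vp c0 st cy]]]]]].
have hV : opensI V W' `<=` V by move=> z [].
have hW' : opensI V W' `<=` W' by move=> z [].
have hVU := subset_trans hV hU.
have e := congr1 (res X hV) st.
have hVW := subset_trans hV hW.
rewrite rmorphM !(res_comp _ hV hVU) (res_comp _ hV hVW) in e.
exists (opensI V W'), hVU, hW', c, t; split=> //.
by rewrite (res_comp h hW' hVW).
Qed.

Definition germ_ev (W : opens X) (Wp : W p) (s : sec X W) : F :=
  projT1 (cid (germ_value_ex Wp s)).

Lemma germ_evP (W : opens X) (Wp : W p) (s : sec X W) : germ_value s (germ_ev Wp s).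
Proof. by rewrite /germ_ev; case: cid. Qed.

Lemma germ_ev_zmod (W : opens X) (Wp : W p) : zmod_morphism (germ_ev Wp).
Proof.
move=> s t; apply: germ_value_uniq (germ_evP _ _) _.
by apply: germ_valueB; exact: germ_evP.
Qed.

Lemma germ_ev_monoid (W : opens X) (Wp : W p) : monoid_morphism (germ_ev Wp).
Proof.
split=> [|s t]; last first.
  apply: germ_value_uniq (germ_evP _ _) _.
  by apply: germ_valueM; exact: germ_evP.
apply: germ_value_uniq (germ_evP _ _) _.
have hU : opensI U W `<=` U by move=> z [].
have hW : opensI U W `<=` W by move=> z [].
exists (opensI U W), hU, hW, 1, 1; split => //.
- by rewrite rmorph1 oner_eq0.
- by rewrite !rmorph1 mulr1.
- by rewrite rmorph1 mulr1.
Qed.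

Definition germ_rmorph (W : opens X) (Wp : W p) : {rmorphism sec X W -> F} :=
  fun_rmorph (germ_ev_zmod Wp) (germ_ev_monoid Wp).

Lemma germ_rmorph_res (W V : opens X) (h : V `<=` W) (hW : W p) (hV : V p)
  (s : sec X W) : germ_rmorph hV (res X h s) = germ_rmorph hW s.
Proof.
apply: germ_value_uniq (germ_evP _ _) _.
by apply: germ_value_sub => //; exact: germ_evP.
Qed.

Lemma germ_rmorph_local (W : opens X) (hW : W p) (s : sec X W) :
  germ_rmorph hW s != 0 -> invertible_at s p.
Proof.
have := germ_evP hW s; rewrite /germ_rmorph /= /fun_rmorph.
move: (germ_ev hW s) => y [V [hU [hV [c [t [Vp c0 st cy]]]]]] y0.
have /chi_neq0 ti : chi t != 0 by rewrite -cy mulf_neq0.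
have : invertible_at (res X hU c * res X hV s) p by rewrite st; apply/invertible_at_res.
by move=> /(invertible_atM _ _ Vp)[_ /(invertible_at_res _ _ Vp)].
Qed.

Lemma germ_rmorph_U (h : U p) (s : sec X U) : germ_rmorph h s = chi s.
Proof.
apply: germ_value_uniq (germ_evP _ _) _.
by have := germ_value_res (@subset_refl _ U) s; rewrite res_id.
Qed.

Lemma germ_rmorph_scal (W : opens X) (hW : W p) c :
  germ_rmorph hW (scal W c) = j c.
Proof.
have hU' : opensI U W `<=` U by move=> z [].
have hW' : opensI U W `<=` W by move=> z [].
have UWp : opensI U W p by split.
rewrite -(germ_rmorph_res hW' hW UWp).
have -> : res X hW' (scal W c) = res X hU' (scal U c).
  have sT : opensI U W `<=` opens_full X by exact: subsetT.
  by rewrite /scal /= (res_comp _ hW' sT) (res_comp _ hU' sT).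
by rewrite (germ_rmorph_res hU' Up) germ_rmorph_U chi_scal.
Qed.

Definition germ_kpoint : kpoint X j :=
  KPoint germ_rmorph_res germ_rmorph_local germ_rmorph_scal.

End PointOfMorphism.

(** The kernel of chi is prime, so it is the vanishing ideal of a point of U, and chi extends to the
    stalk there. *)
Lemma kpoint_of_rmorph (U : opens X) (chi : {rmorphism sec X U -> F}) :
  affine U -> (forall c, chi (scal U c) = j c) ->
  exists (x : kpoint X j) (h : U (pt x)), forall s, ev h s = chi s.
Proof.
move=> Ua chi_scal.
have prime : prime_ideal [set s | chi s = 0].
  split=> /=.
  - exact: rmorph0.
  - by move=> a b a0 b0; rewrite rmorphD a0 b0 addr0.
  - by move=> a b b0; rewrite rmorphM b0 mulr0.
  - by rewrite rmorph1; apply/eqP; exact: oner_neq0.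
  - by move=> a b /eqP; rewrite rmorphM mulf_eq0 => /orP[]/eqP; [left|right].
have [pr _ _ _] := Ua; have [p Up kerE] := pr _ prime.
exists (germ_kpoint Ua chi_scal Up kerE), Up => s.
exact: germ_rmorph_U.
Qed.

End KPoints.

(** * Extension of isomorphisms to the separable closure *)

(** The graph of an isomorphism between subfields of E. With graphs, extension is inclusion and the
    union of a chain is an upper bound; [ig_inj] expresses single-valuedness. *)
Record isom_graph (E : fieldType) (G : set (E * E)) : Prop := IsomGraph {
  ig1 : G (1, 1);
  igB : forall u v, G u -> G v -> G (u.1 - v.1, u.2 - v.2);
  igM : forall u v, G u -> G v -> G (u.1 * v.1, u.2 * v.2);
  igV : forall u, G u -> G (u.1^-1, u.2^-1);
  ig_inj : forall u, G u -> u.1 = 0 -> u.2 = 0 }.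

Section GraphDomain.
Variables (E : fieldType) (G : set (E * E)) (Gg : isom_graph G).

Definition graph_dom : {pred E} := [pred x : E | `[< exists y, G (x, y) >]].

Lemma graph_domP x : reflect (exists y, G (x, y)) (x \in graph_dom).
Proof. exact: asboolP. Qed.

(** The domain tagged with a proof of [isom_graph G], from which the subfield instance is
    inferred. *)
Definition graph_dom_of (_ : isom_graph G) := graph_dom.

Lemma graph_dom_closed : divring_closed (graph_dom_of Gg).
Proof.
split.
- by apply/graph_domP; exists 1; exact: ig1.
- move=> x y /graph_domP[x' Gx] /graph_domP[y' Gy]; apply/graph_domP.
  by exists (x' - y'); exact: (igB Gg Gx Gy).
- move=> x y /graph_domP[x' Gx] /graph_domP[y' Gy]; apply/graph_domP.
  by exists (x' / y'); exact: (igM Gg Gx (igV Gg Gy)).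
Qed.

HB.instance Definition _ :=
  GRing.isDivringClosed.Build E (graph_dom_of Gg) graph_dom_closed.

Record graph_field := GraphField {
  gf_val : E;
  gf_valP : gf_val \in graph_dom_of Gg }.

HB.instance Definition _ := [isSub for gf_val].
HB.instance Definition _ := [Choice of graph_field by <:].
HB.instance Definition _ := [SubChoice_isSubIntegralDomain of graph_field by <:].
HB.instance Definition _ := [SubIntegralDomain_isSubField of graph_field by <:].

Lemma graph_functional x y y' : G (x, y) -> G (x, y') -> y = y'.
Proof.
move=> h h'; apply/eqP; rewrite -subr_eq0; apply/eqP.
by apply: (ig_inj Gg (igB Gg h h')); rewrite /= subrr.
Qed.

Definition graph_fun (x : graph_field) : E := projT1 (cid (graph_domP _ (gf_valP x))).

Lemma graph_funP x : G (gf_val x, graph_fun x).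
Proof. by rewrite /graph_fun; case: cid. Qed.

Lemma graph_fun_eq x y : G (gf_val x, y) -> graph_fun x = y.
Proof. exact/graph_functional/graph_funP. Qed.

Lemma graph_fun_zmod : zmod_morphism graph_fun.
Proof.
by move=> x y; apply: graph_fun_eq; exact: (igB Gg (graph_funP x) (graph_funP y)).
Qed.

Lemma graph_fun_monoid : monoid_morphism graph_fun.
Proof.
split=> [|x y]; apply: graph_fun_eq; first exact: (ig1 Gg).
exact: (igM Gg (graph_funP x) (graph_funP y)).
Qed.

Definition graph_rmorph : {rmorphism graph_field -> E} :=
  fun_rmorph graph_fun_zmod graph_fun_monoid.

Definition graph_incl : {rmorphism graph_field -> E} := \val.

(** Let p be the minimal polynomial of x over the domain. Its image under the isomorphism divides
    that of q, so it is separable and has a root y; the extension consists of the pairs (P(x),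
    P^sigma(y)), P^sigma being the transported polynomial. *)
Lemma graph_ext x (q : {poly graph_field}) :
  (forall p : {poly E}, separable_poly p -> (1 < size p)%N -> exists x, root p x) ->
  q != 0 -> root (map_poly graph_incl q) x -> separable_poly (map_poly graph_rmorph q) ->
  exists G' : set (E * E), [/\ isom_graph G', G `<=` G' & exists y, G' (x, y)].
Proof.
move=> E_closed q0 qx qsep.
pose ev P := (map_poly graph_incl P).[x].
have evM P Q : ev (P * Q) = ev P * ev Q by rewrite /ev rmorphM hornerM.
have evB P Q : ev (P - Q) = ev P - ev Q by rewrite /ev rmorphB hornerD hornerN.
pose bad k := `[< exists P : {poly graph_field}, [/\ P != 0, ev P = 0 & size P = k] >].
have exk : exists k, bad k.
  by exists (size q); apply/asboolP; exists q; split=> //; exact/eqP.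
case: (ex_minnP exk) => _ /asboolP[p [p0 px <-]] minp.
have pdvd P : ev P = 0 -> p %| P.
  move=> P0; have [//|np] := boolP (p %| P).
  have r0 : P %% p != 0 by [].
  have : bad (size (P %% p)).
    apply/asboolP; exists (P %% p); split=> //.
    have -> : P %% p = P - P %/ p * p by rewrite {2}(divp_eq P p) addrC addKr.
    by rewrite evB evM P0 px mulr0 subrr.
  by move=> /minp; rewrite leqNgt ltn_modp p0.
have sp : (1 < size p)%N.
  rewrite ltnNge; apply/negP => /size1_polyC pE.
  move: px p0; rewrite pE /ev map_polyC hornerC /= => h.
  rewrite polyC_eq0 => /eqP; apply; exact: val_inj.
have qp : p %| q by apply: pdvd; exact/eqP.
have [||y py] := E_closed (map_poly graph_rmorph p) _.
- by apply: dvdp_separable qsep; rewrite dvdp_map.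
- by rewrite size_map_poly.
pose ev' P := (map_poly graph_rmorph P).[y].
have ev'M P Q : ev' (P * Q) = ev' P * ev' Q by rewrite /ev' rmorphM hornerM.
have ev'B P Q : ev' (P - Q) = ev' P - ev' Q by rewrite /ev' rmorphB hornerD hornerN.
have ker P : ev P = 0 -> ev' P = 0.
  move=> /pdvd/dvdpP[Q ->]; rewrite ev'M; have -> : ev' p = 0 by exact/eqP.
  by rewrite mulr0.
have ev1 : ev 1 = 1 by rewrite /ev rmorph1 hornerC.
have ev'1 : ev' 1 = 1 by rewrite /ev' rmorph1 hornerC.
exists [set u | exists P, u = (ev P, ev' P)]; split.
- split.
  + by exists 1; rewrite ev1 ev'1.
  + by move=> _ _ [P ->] [Q ->]; exists (P - Q); rewrite evB ev'B.
  + by move=> _ _ [P ->] [Q ->]; exists (P * Q); rewrite evM ev'M.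
  + move=> _ [P ->] /=; have [P0|P0] := eqVneq (ev P) 0.
      exists 0; rewrite P0 (ker _ P0) /ev /ev' !rmorph0 !horner0 invr0 //.
    (* By minimality of p, a P with P(x) nonzero is prime to p, and the Bezout coefficient of P
       inverts both of its values at once. *)
    have cop : coprimep P p.
      have /dvdpP[e pE] := dvdp_gcdr P p.
      have /dvdpP[e' PE] := dvdp_gcdl P p.
      have g0 : ev (gcdp P p) != 0.
        by apply: contraNneq P0 => g0; rewrite PE evM g0 mulr0.
      have e0 : ev e = 0.
        by move: px; rewrite pE evM => /eqP; rewrite mulf_eq0 (negPf g0) orbF => /eqP.
      have en0 : e != 0 by apply: contraNneq p0 => e00; rewrite pE e00 mul0r.
      have gn0 : gcdp P p != 0 by rewrite gcdp_eq0 negb_and p0 orbT.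
      have := dvdp_leq en0 (pdvd _ e0).
      rewrite {1}pE size_mul // /coprimep.
      have : (0 < size (gcdp P p))%N by rewrite size_poly_gt0.
      have : (0 < size e)%N by rewrite size_poly_gt0.
      by move: (size e) (size (gcdp P p)) => a b; lia.
    have /Bezout_eq1_coprimepP[[u v] /= uv] := cop.
    exists u; have uP : ev u * ev P = 1.
      by rewrite -evM -(addrK (v * p) (u * P)) uv evB ev1 evM px mulr0 subr0.
    have u'P : ev' u * ev' P = 1.
      by rewrite -ev'M -(addrK (v * p) (u * P)) uv ev'B ev'1 ev'M (ker _ px) mulr0 subr0.
    have P'0 : ev' P != 0.
      by apply/eqP => e; move/eqP: u'P; rewrite e mulr0 eq_sym oner_eq0.
    by congr (_, _); [apply: (mulIf P0) | apply: (mulIf P'0)]; rewrite mulVf.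
  + by move=> _ [P ->] /=; exact: ker.
- move=> [a b] Gab; have aD : a \in graph_dom_of Gg by apply/graph_domP; exists b.
  exists (GraphField aD)%:P; rewrite /ev /ev' !map_polyC !hornerC /=.
  by congr (_, _); apply/esym/graph_fun_eq.
- exists y, 'X; by rewrite /ev /ev' !map_polyX !hornerX.
Qed.

End GraphDomain.

Section Extension.
Variables (L E : fieldType) (iota : {rmorphism L -> E}).
Hypothesis E_sep : separable_closure iota.

(** An endomorphism over L is injective and preserves the finite set of roots of a polynomial
    satisfied by z, hence permutes it. *)
Lemma sep_closure_endo_surj (sg : {rmorphism E -> E}) :
  (forall c, sg (iota c) = iota c) -> forall z, exists x, sg x = z.
Proof.
move=> sgi z; have [alg closed] := E_sep; have [q [_ qsep qz]] := alg z.
pose q1 := map_poly iota ((lead_coef q)^-1 *: q).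
have lq0 : lead_coef q != 0 by rewrite lead_coef_eq0 separable_poly_neq0.
have q1sep : separable_poly q1.
  rewrite separable_map; have -> // := @eqp_separable _ _ q.
  by apply: eqp_scale; rewrite invr_eq0.
have q1m : q1 \is monic by rewrite map_monic monicE lead_coefZ mulVf.
have [rs urs q1E] := separable_split closed q1sep q1m.
have rsP x : (x \in rs) = root q1 x by rewrite q1E root_prod_XsubC.
have zrs : z \in rs.
  by rewrite rsP /q1 map_polyZ /= rootZ // fmorph_eq0 invr_eq0.
have sg_rs x : x \in rs -> sg x \in rs.
  rewrite !rsP => /(rmorph_root sg); rewrite /q1 -map_poly_comp.
  by rewrite (eq_map_poly (g := iota)) // => c; exact: sgi.
have [|||_ eq_rs] := @uniq_min_size _ (map sg rs) rs.
- by rewrite map_inj_uniq //; exact: fmorph_inj.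
- by move=> _ /mapP[x xrs ->]; exact: sg_rs.
- by rewrite size_map.
by move: zrs; rewrite -eq_rs => /mapP[x _ ->]; exists x.
Qed.

Lemma field_aut_of_endo (sg : {rmorphism E -> E}) :
  (forall c, sg (iota c) = iota c) ->
  exists tau : field_aut iota, forall x, tau x = sg x.
Proof.
move=> sgi; have [g gP] := choice (sep_closure_endo_surj sgi).
have inj := fmorph_inj sg.
have gK : cancel sg g by move=> x; apply: inj; rewrite gP.
have gB : zmod_morphism g by move=> x y; apply: inj; rewrite rmorphB !gP.
have gM : monoid_morphism g.
  by split=> [|x y]; apply: inj; rewrite ?rmorph1 ?rmorphM !gP.
by exists (@FieldAut L E iota sg (fun_rmorph gB gM) gK gP sgi).
Qed.

Lemma extend_embedding (k : fieldType) (i : {rmorphism L -> k})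
    (e1 e2 : {rmorphism k -> E}) :
  (forall c, e1 (i c) = iota c) -> (forall c, e2 (i c) = iota c) ->
  exists tau : field_aut iota, forall x, tau (e1 x) = e2 x.
Proof.
move=> e1i e2i; have [alg closed] := E_sep.
pose base := [set u | exists z, u = (e1 z, e2 z)].
have base_graph : isom_graph base.
  split.
  - by exists 1; rewrite !rmorph1.
  - by move=> _ _ [z ->] [z' ->]; exists (z - z'); rewrite !rmorphB.
  - by move=> _ _ [z ->] [z' ->]; exists (z * z'); rewrite !rmorphM.
  - by move=> _ [z ->]; exists z^-1; rewrite !fmorphV.
  - by move=> _ [z ->] /= /eqP; rewrite fmorph_eq0 => /eqP ->; exact: rmorph0.
pose P (G : set (E * E)) := G = set0 \/ (isom_graph G /\ base `<=` G).
have [G [PG maxG]] : exists G, P G /\ forall G', G `<` G' -> ~ P G'.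
  apply: Zorn_bigcup => C CP Ctot.
  have [[G0 [CG0 G0ne]]|no] := pselect (exists G, C G /\ G <> set0); last first.
    left; apply/seteqP; split=> // u [X CX Xu].
    by case: no; exists X; split=> // X0; rewrite X0 in Xu.
  right; have good X : C X -> X !=set0 -> isom_graph X.
    move=> CX [u Xu]; have [X0|[]//] := CP X CX.
    by rewrite X0 in Xu.
  have ne (X : set (E * E)) u : X u -> X !=set0 by exists u.
  have [//|[gG0 bG0]] := CP G0 CG0.
  have join X Y u v : C X -> C Y -> X u -> Y v -> exists2 Z, C Z & Z u /\ Z v.
    move=> CX CY Xu Yv; have [s|s] := Ctot X Y CX CY.
      by exists Y => //; split=> //; exact: s.
    by exists X => //; split=> //; exact: s.
  split; last by move=> u bu; exists G0 => //; exact: bG0.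
  split.
  - by exists G0 => //; exact: (ig1 gG0).
  - move=> u v [X CX Xu] [Y CY Yv]; have [Z CZ [Zu Zv]] := join _ _ _ _ CX CY Xu Yv.
    by exists Z => //; exact: (igB (good Z CZ (ne _ _ Zu)) Zu Zv).
  - move=> u v [X CX Xu] [Y CY Yv]; have [Z CZ [Zu Zv]] := join _ _ _ _ CX CY Xu Yv.
    by exists Z => //; exact: (igM (good Z CZ (ne _ _ Zu)) Zu Zv).
  - move=> u [X CX Xu]; exists X => //; exact: (igV (good X CX (ne _ _ Xu)) Xu).
  - move=> u [X CX Xu]; exact: (ig_inj (good X CX (ne _ _ Xu)) Xu).
have [Gg bG] : isom_graph G /\ base `<=` G.
  case: PG => // G0; case: (maxG base); last by right; split=> //; exact: subset_refl.
  rewrite G0; split=> // h; exact: (h _ (ig1 base_graph)).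
have Gi c : G (iota c, iota c) by apply: bG; exists (i c); rewrite e1i e2i.
have total x : exists y, G (x, y).
  have [q [_ qsep qx]] := alg x.
  have iD c : iota c \in graph_dom_of Gg by apply/graph_domP; exists (iota c).
  pose l c := GraphField (iD c).
  have lB : zmod_morphism l by move=> a b; apply: val_inj; rewrite /= rmorphB.
  have lM : monoid_morphism l.
    by split=> [|a b]; apply: val_inj; rewrite /= ?rmorph1 ?rmorphM.
  pose lr : {rmorphism L -> graph_field Gg} := fun_rmorph lB lM.
  have [|||G' [G'g GG' [y G'y]]] := @graph_ext E G Gg x (map_poly lr q) closed.
  - by rewrite map_poly_eq0 separable_poly_neq0.
  - by rewrite -map_poly_comp (eq_map_poly (g := iota)).
  - rewrite -map_poly_comp (eq_map_poly (g := iota)) ?separable_map // => c.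
    exact/graph_fun_eq/Gi.
  have [G'G|nG'G] := pselect (G' `<=` G); first by exists y; exact: G'G.
  case: (maxG G'); first by split.
  by right; split=> //; exact: subset_trans GG'.
have [g gP] := choice total.
have gE x y : G (x, y) -> g x = y by move=> h; exact: (graph_functional Gg (gP x) h).
have gB : zmod_morphism g by move=> x y; apply: gE; exact: (igB Gg (gP x) (gP y)).
have gM : monoid_morphism g.
  by split=> [|x y]; apply: gE; [exact: (ig1 Gg) | exact: (igM Gg (gP x) (gP y))].
have [tau tauE] := @field_aut_of_endo (fun_rmorph gB gM) (fun c => gE _ _ (Gi c)).
by exists tau => x; rewrite tauE; apply: gE; apply: bG; exists x.
Qed.

End Extension.

Lemma group_embedding_isom (G : groupType) (T : finGroupType) (f : G -> T) :
  injective f -> {morph f : x y / (x * y)%g} ->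
  exists H : {group T}, group_isomorphic G (subg_of H).
Proof.
move=> inj fM; pose im : {set T} := finset (fun p => `[< exists x, f x = p >]).
have imP p : reflect (exists x, f x = p) (p \in im).
  by rewrite inE; exact: asboolP.
have f1 : f 1%g = 1%g.
  by apply: (mulgI (f 1%g)); rewrite -fM mulg1 mulg1.
have grp : group_set im.
  apply/group_setP; split; first by apply/imP; exists 1%g.
  move=> _ _ /imP[x <-] /imP[y <-]; apply/imP; exists (x * y)%g; exact: fM.
pose H : {group T} := group grp.
have fH x : f x \in H by apply/imP; exists x.
exists H, (fun x => Subg (fH x)); split; last first.
  by move=> x y; apply: val_inj; exact: fM.
have surj (y : subg_of H) : exists x, f x = val y.
  by have /imP := valP y.
have [h hP] := choice surj.
exists h => [x|y]; first by apply: inj; rewrite hP.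
by apply: val_inj; rewrite /= hP.
Qed.

(** An automorphism of the fixed field is extended to Lbar by an arbitrary choice, which need not be
    multiplicative. The permutation of the psi t is nevertheless determined by the automorphism,
    because the psi t take values in the fixed field. *)
Lemma fixed_group_embedding (A B : comPzRingType) (phi : {rmorphism A -> B})
    (L E : fieldType) (iota : {rmorphism L -> E}) (E_sep : separable_closure iota)
    (alpha : {rmorphism A -> L}) d (psi : 'I_d -> {rmorphism B -> E})
    (P : set (field_aut iota)) :
  (forall t a, psi t (phi a) = iota (alpha a)) ->
  (forall t t', psi t =1 psi t' -> t = t') ->
  (forall chi : {rmorphism B -> E}, (forall a, chi (phi a) = iota (alpha a)) ->
     exists t, chi =1 psi t) ->
  P = [set sg : field_aut iota | forall t b, sg (psi t b) = psi t b] ->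
  exists H : {group 'S_d}, group_isomorphic (field_aut (fixed_inj P)) (subg_of H).
Proof.
move=> psiA psi_inj psi_all PE.
have [ext extP] : exists ext : field_aut (fixed_inj P) -> field_aut iota,
    forall tau x, ext tau (\val x) = \val (tau x).
  suff h (tau : field_aut (fixed_inj P)) : exists sg : field_aut iota,
      forall x, sg (\val x) = \val (tau x).
    by have [ext extP] := choice h; exists ext.
  apply: (extend_embedding E_sep (i := fixed_inj P) (e1 := \val) (e2 := \val \o tau)) => //.
  by move=> c; rewrite /= aut_fix.
have [p pP] : exists p : field_aut iota -> 'I_d -> 'I_d,
    forall (sg : field_aut iota) t b, sg (psi t b) = psi (p sg t) b.
  suff h (sgt : field_aut iota * 'I_d) : exists t', forall b,
      sgt.1 (psi sgt.2 b) = psi t' b.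
    by have [p pP] := choice h; exists (fun sg t => p (sg, t)) => sg t b; rewrite -pP.
  have [|t' h] := psi_all (sgt.1 \o psi sgt.2); last by exists t' => b; exact: h.
  by move=> a; rewrite /= psiA aut_fix.
have p_inj sg : injective (p sg).
  move=> t t' e; apply: psi_inj => b; apply: (fmorph_inj sg).
  by rewrite !pP e.
(* Permutations are multiplied from left to right and automorphisms from right to left; the inverse
   restores the order. *)
pose s tau : 'S_d := ((perm (p_inj (ext tau)))^-1)%g.
have in_fixed t b : psi t b \in fixed_pred P.
  by apply/fixed_predP => sg; rewrite PE; exact.
pose ps t b : fixed_field P := FixedField (in_fixed t b).
have pE tau t b : psi (p (ext tau) t) b = \val (tau (ps t b)).
  by rewrite -pP -extP.
apply: (group_embedding_isom (f := s)).
  move=> tau tau' /invg_inj e; apply: field_aut_ext => x; apply: val_inj.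
  have pp t : p (ext tau) t = p (ext tau') t.
    by have := congr1 (fun q : 'S_d => q t) e; rewrite !permE.
  rewrite -!extP.
  (* Extensions inducing the same permutation differ by an element of P, so they agree on the fixed
     field. *)
  pose sg := field_autM (field_autV (ext tau')) (ext tau).
  have : P sg.
    rewrite PE => t b; rewrite /sg /= pP pp -pP; exact: autK.
  move=> Psg; have /fixed_predP/(_ _ Psg) := fixed_valP x.
  by rewrite /sg /= => e'; rewrite -[in RHS]e' /=; exact/esym/autVK.
move=> tau tau'; rewrite /s -invMg; congr (_^-1)%g; apply/permP => t.
rewrite permM !permE; apply: psi_inj => b.
rewrite pE /= -extP.
by rewrite -pP; congr (ext tau _); rewrite pE.
Qed.

(** * Quasi-compactness and the geometric fibre *)

Definition proper_ideal_set (A : comPzRingType) (I : set A) :=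
  [/\ I 0, forall a b, I a -> I b -> I (a + b),
      forall a b, I b -> I (a * b) & ~ I 1].

Lemma prime_ideal_ex (A : comPzRingType) (I : set A) :
  proper_ideal_set I -> exists2 p, prime_ideal p & I `<=` p.
Proof.
move=> Ip; pose P (J : set A) := J = set0 \/ (proper_ideal_set J /\ I `<=` J).
have [m [Pm maxm]] : exists m, P m /\ forall J, m `<` J -> ~ P J.
  apply: Zorn_bigcup => C CP Ctot.
  have [[J0 [CJ0 J0ne]]|no] := pselect (exists J, C J /\ J <> set0); last first.
    left; apply/seteqP; split=> // u [X CX Xu].
    by case: no; exists X; split=> // X0; rewrite X0 in Xu.
  have good X u : C X -> X u -> proper_ideal_set X.
    by move=> CX Xu; have [X0|[]//] := CP X CX; rewrite X0 in Xu.
  have [//|[[J00 JD JM J1] IJ0]] := CP J0 CJ0.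
  right; split; last by move=> u Iu; exists J0 => //; exact: IJ0.
  split.
  - by exists J0.
  - move=> a b [X CX Xa] [Y CY Yb]; have [XY|YX] := Ctot X Y CX CY.
      exists Y => //; have [_ YD _ _] := good _ _ CY Yb.
      by apply: YD => //; exact: XY.
    exists X => //; have [_ XD _ _] := good _ _ CX Xa.
    by apply: XD => //; exact: YX.
  - move=> a b [X CX Xb]; exists X => //.
    by have [_ _ XM _] := good _ _ CX Xb; exact: XM.
  - move=> [X CX X1]; by have [_ _ _] := good _ _ CX X1; apply.
have [[m0 mD mM m1] Im] : proper_ideal_set m /\ I `<=` m.
  case: Pm => // mE; case: (maxm I); last by right; split=> //; exact: subset_refl.
  have [I0 _ _ _] := Ip; rewrite mE; split=> // h; exact: (h _ I0).
exists m => //; split=> // a b mab.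
apply: contrapT => /not_orP[na nb].
pose J := [set z | exists x r, m x /\ z = x + r * a].
have mJ : m `<=` J by move=> x mx; exists x, 0; rewrite mul0r addr0.
case: (maxm J).
  split=> // Jm; apply: na; apply: Jm; exists 0, 1.
  by rewrite mul1r add0r.
right; split; last exact: subset_trans mJ.
split.
- exact: mJ.
- move=> _ _ [x [r [mx ->]]] [y [s [my ->]]]; exists (x + y), (r + s).
  by split; [exact: mD | rewrite mulrDl addrACA].
- move=> c _ [x [r [mx ->]]]; exists (c * x), (c * r).
  by split; [exact: mM | rewrite mulrDr mulrA].
- move=> [x [r [mx e]]]; apply: nb; rewrite -[b]mulr1 e mulrDr.
  by apply: mD; [exact: mM | rewrite mulrCA [b * a]mulrC; exact: mM].
Qed.

(** Quasi-compactness for increasing sequences. The sections a with D(a) inside some W k form an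
    ideal, by locality of the stalks. Were it proper, it would lie in a prime, that is, in the
    vanishing ideal of a point x; but some D(a) around x is inside a W k. *)
Lemma affine_bound (X : scheme) (U : opens X) (W : nat -> set X) :
  affine U -> (forall k, open (W k)) -> (forall k l, (k <= l)%N -> W k `<=` W l) ->
  (forall x, U x -> exists k, W k x) -> exists k, U `<=` W k.
Proof.
move=> Ua Wo Wmono cover; have [Uprime _ basis _] := Ua.
pose I : set (sec X U) := [set a | exists k, nonvanishing a `<=` W k].
have [[k I1]|nI1] := pselect (I 1).
  exists k => x Ux; apply: I1; split=> //; exists U, (@subset_refl _ U).
  by split=> //; exists 1; rewrite rmorph1 mulr1.
have Ip : proper_ideal_set I.
  split=> //.
  - exists 0%N => x [Ux]; by have [] := @sch_local X x U Ux.
  - move=> a b [k ak] [l bl]; exists (maxn k l) => x [Ux abx].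
    have [_ /(_ _ _ abx)[ax|bx]] := @sch_local X x U Ux.
      by apply: (Wmono _ _ (leq_maxl k l)); apply: ak.
    by apply: (Wmono _ _ (leq_maxr k l)); apply: bl.
  - move=> a b [k bk]; exists k => x [Ux /(invertible_atM _ _ Ux)[_ bx]].
    by apply: bk.
have [p pp Ipp] := prime_ideal_ex Ip.
have [x Ux pE] := Uprime p pp.
have [k Wx] := cover x Ux.
have sub : opensI U (Opens (Wo k)) `<=` U by move=> y [].
have [a [[_ ax] hx]] := basis _ _ sub (conj Ux Wx).
have : p a by apply: Ipp; exists k => y /hx[].
by rewrite pE => /(_ ax).
Qed.

Section FibreGroup.
Variables (K : fieldType) (S' S : kscheme K) (f : kmorphism S' S).
Variables (L Lbar : fieldType) (j : {rmorphism K -> L}).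
Variable iota : {rmorphism L -> Lbar}.

(** Points of the geometric fibre at s correspond to morphisms over [ev hs] from the algebra of the
    preimage of U to Lbar, which reduces the kernel to the affine setting. *)
Lemma kernel_fixes_fibre (s : kpoint S j) (U : opens S) (hs : U (pt s)) :
  affine U -> affine (opens_preim (mor_cont f) U) ->
  galois_act_kernel f s =
  [set sg : field_aut iota | fixes_fibre (mor_sec f U) iota (ev hs) sg].
Proof.
move=> Ua Va; apply/seteqP; split=> sg /=.
  move=> ker chi chiA b.
  have [|x [hx xE]] := @kpoint_of_rmorph K S' Lbar (iota \o j) _ chi Va.
    move=> c; rewrite -(mor_scal f U c) chiA.
    by rewrite (ev_scal hs).
  have fx : geom_fibre f s x.
    rewrite /geom_fibre /=.
    apply: (@kpoint_ext _ _ _ _ (point_image f x) (geom_point iota s) U hx hs Ua) => a.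
    by rewrite /= /point_image_ev /= xE chiA.
  have evE (y z : kpoint S' (iota \o j)) (e : y = z)
      (hy : opens_preim (mor_cont f) U (pt y)) (hz : opens_preim (mor_cont f) U (pt z)) :
      ev hy b = ev hz b.
    by subst z; congr (ev _ b); exact: Prop_irrelevance.
  by have := evE _ _ (ker x fx) hx hx; rewrite -xE.
move=> fixP x fx.
have Ux : U (f (pt x)).
  by have := congr1 (fun y => U (pt y)) fx => /= ->.
apply: (@kpoint_ext _ _ _ _ (galois_act sg x) x (opens_preim (mor_cont f) U) Ux Ux Va) => b.
apply: fixP => a.
have evE (y z : kpoint S (iota \o j)) (e : y = z) (hy : U (pt y)) (hz : U (pt z)) :
    ev hy a = ev hz a.
  by subst z; congr (ev _ a); exact: Prop_irrelevance.
exact: (evE _ _ fx Ux hs).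
Qed.

End FibreGroup.

(** * The analytic topology near a point *)

Lemma absv_ball_open (R : realType) (L : localFieldType R) (x : L) (e : R) :
  open [set y | absv (y - x) < e].
Proof.
rewrite openE => y /= yx; apply/absv_nbhs; exists (e - absv (y - x)).
  by rewrite subr_gt0.
move=> z yz /=; have -> : z - x = (z - y) + (y - x) by rewrite addrA subrK.
by apply: le_lt_trans (absvD _ _) _; rewrite -ltrBrDr absvC.
Qed.

Section AnalyticTopology.
Variables (K : fieldType) (R : realType) (L : localFieldType R).
Variables (S : kscheme K) (j : {rmorphism K -> L}).

Lemma analytic_open (U : opens S) (a : sec S U) (W : set L) : open W ->
  open [set s : kpoint S j | exists h : U (pt s), W (ev h a)].
Proof.
move=> Wo; set P := [set s | _].
have PP : analytic_subbase (j := j) P by exists U, a, W.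
exists [set P]; last exact: bigcup_set1.
by move=> _ ->; exact: (finI_from1 id PP).
Qed.

Variables (s0 : kpoint S j) (U : opens S) (h0 : U (pt s0)).

(** The default [ev h0] outside U(L) makes evaluation total on S(L), as filter arguments require,
    without affecting limits at s0. *)
Definition ev_near (s : kpoint S j) : {rmorphism sec S U -> L} :=
  if pselect (U (pt s)) is left h then ev h else ev h0.

Lemma ev_nearE s (h : U (pt s)) : ev_near s = ev h.
Proof.
by rewrite /ev_near; case: pselect => // h'; congr ev; exact: Prop_irrelevance.
Qed.

Lemma ev_near_cvg (a : sec S U) (e : R) : 0 < e ->
  \forall s \near s0, absv (ev_near s a - ev h0 a) < e.
Proof.
move=> e0; have Po := analytic_open a (absv_ball_open (ev h0 a) e).
have Ps0 : exists h : U (pt s0), absv (ev h a - ev h0 a) < e.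
  by exists h0; rewrite subrr absv0.
apply: filterS (open_nbhs_nbhs (conj Po Ps0)) => s [h /=].
by rewrite ev_nearE.
Qed.

Lemma opens_near : \forall s \near s0, U (pt s).
Proof.
have Po := analytic_open (0 : sec S U) (@openT L).
have Ps0 : exists h : U (pt s0), [set: L] (ev h (0 : sec S U)) by exists h0.
by apply: filterS (open_nbhs_nbhs (conj Po Ps0)) => s [].
Qed.

End AnalyticTopology.

(** * Isomorphism classes and the covering *)

Lemma group_isomorphic_sym (G H : groupType) :
  group_isomorphic G H -> group_isomorphic H G.
Proof.
move=> [f [[g fK gK] fM]]; exists g; split; first by exists f.
by move=> x y; apply: (can_inj fK); rewrite fM !gK.
Qed.

Lemma group_isomorphic_trans (G H I : groupType) :
  group_isomorphic G H -> group_isomorphic H I -> group_isomorphic G I.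
Proof.
move=> [f [fb fM]] [g [gb gM]]; exists (g \o f); split; first exact: bij_comp.
by move=> x y /=; rewrite fM gM.
Qed.

(** The sets are indexed by one representative for each isomorphism class of candidates, which makes
    them disjoint; some may be empty. *)
Lemma isomorphism_classes (T : topologicalType) (G : T -> groupType)
    (I : finType) (C : I -> finGroupType) :
  (forall s, exists x, group_isomorphic (G s) (C x)) ->
  (forall s, \forall s' \near s, G s' = G s) ->
  exists (n : nat) (H : 'I_n -> finGroupType) (U : 'I_n -> set T),
    [/\ forall i, open (U i), trivIset [set: 'I_n] U, \bigcup_i U i = [set: T] &
        forall i s, U i s <-> group_isomorphic (G s) (H i)].
Proof.
move=> GC Gloc.
pose iso x y := `[< group_isomorphic (C x) (C y) >].
have iso_refl x : iso x x.
  by apply/asboolP; exists id; split => //; exists id.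
(* [pick] depends only on the class as a predicate, so isomorphic candidates get the same
   representative. *)
pose rep x := odflt x [pick y | iso x y].
have rep_iso x : iso x (rep x).
  by rewrite /rep; case: pickP => //= /(_ x); rewrite iso_refl.
have rep_eq x y : iso x y -> rep x = rep y.
  move=> /asboolP xy; rewrite /rep.
  have -> : [pick z | iso x z] = [pick z | iso y z].
    apply: eq_pick => z; apply/asboolP/asboolP; apply: group_isomorphic_trans => //.
    exact: group_isomorphic_sym.
  by case: pickP => // /(_ y); rewrite iso_refl.
pose D := finset (fun x => rep x == x).
have repD x : rep x \in D by rewrite inE eq_sym; apply/eqP/rep_eq/rep_iso.
exists #|D|, (fun i => C (enum_val i)),
  (fun i => [set s | group_isomorphic (G s) (C (enum_val i))]).
split=> //.
- move=> i; rewrite openE => s /= Gs.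
  by apply: filterS (Gloc s) => s' /= ->.
- move=> i i' _ _ [s [/= h h']]; apply: enum_val_inj.
  have /eqP <- : rep (enum_val i) == enum_val i by have := enum_valP i; rewrite inE.
  have /eqP <- : rep (enum_val i') == enum_val i' by have := enum_valP i'; rewrite inE.
  apply/rep_eq/asboolP; apply: group_isomorphic_trans h'.
  exact: group_isomorphic_sym.
- apply/seteqP; split=> // s _; have [x Gx] := GC s.
  exists (enum_rank_in (repD x) (rep x)) => //=.
  rewrite enum_rankK_in //; apply: group_isomorphic_trans Gx _.
  exact/asboolP/rep_iso.
Qed.

Theorem theorem3p4 (K : fieldType) (S' S : kscheme K) (f : kmorphism S' S)
    (S'_ft : finite_type S') (S_ft : finite_type S)
    (f_fet : finite_etale f) (S_conn : connected [set: S])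
    (R : realType) (L : localFieldType R) (j : {rmorphism K -> L})
    (Lbar : fieldType) (iota : {rmorphism L -> Lbar})
    (Lbar_sep : separable_closure iota) :
  exists (n : nat) (H : 'I_n -> finGroupType) (U : 'I_n -> set (kpoint S j)),
    [/\ forall i, open (U i),
        trivIset [set: 'I_n] U,
        \bigcup_i U i = [set: kpoint S j] &
        forall i (s : kpoint S j),
          U i s <->
          group_isomorphic (fibre_galois_group f iota s) (H i)].
Proof.
have closed := Lbar_sep.2.
(* The index k bounds the number of generators of the algebra over U, hence the number of geometric
   points in the fibres there; quasi-compactness provides one k for all of S. *)
pose good (k : nat) (U : opens S) := [/\ affine U, affine (opens_preim (mor_cont f) U),
  etale_alg (mor_sec f U) & exists2 N, (N <= k)%N &
    exists b : 'I_N -> sec S' (opens_preim (mor_cont f) U), forall y,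
      exists c, y = \sum_(i < N) mor_sec f U (c i) * b i].
pose W k : set S := [set x | exists2 U : opens S, U x & good k U].
have Wo k : open (W k).
  rewrite openE => x [U Ux gU]; rewrite /interior /= nbhsE.
  exists U; first by split; [exact: opens_open | exact: Ux].
  by move=> y Uy; exists U.
have Wmono k l : (k <= l)%N -> W k `<=` W l.
  move=> kl x [U Ux [Ua Va et [N Nk gen]]]; exists U => //; split=> //.
  by exists N => //; exact: leq_trans kl.
have Wcover x : exists k, W k x.
  have [U [Ux Ua Va [N [b gen]] et]] := f_fet x.
  by exists N, U => //; split=> //; exists N => //; exists b.
have [k Wk] : exists k, forall x, W k x.
  have [m [V [Vcover Vaff]]] := S_ft.
  have [k kP] := choice (fun i => affine_bound (Vaff i).1 Wo Wmono (fun x _ => Wcover x)).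
  exists (\max_i k i) => x; have [i Vx] := Vcover x.
  exact: (Wmono _ _ (leq_bigmax i) _ (kP i x Vx)).
(* The candidates are the subgroups of the symmetric groups of degree at most k. *)
apply: (@isomorphism_classes _ (fibre_galois_group f iota)
  {d : 'I_k.+1 & {group 'S_d}} (fun x => subg_of (tagged x))).
- move=> s; have [U hs [Ua Va et [N Nk [g gen]]]] := Wk (pt s).
  have unr := formally_etale_no_derivation et.2.
  have [r [rho [d [psi [rdN rel free psiA psi_inj]]]]] :=
    unramified_fibre_points gen unr (ev hs) iota closed.
  have psi_all := fibre_points_complete gen rel free psiA psi_inj rdN.
  have [|H GH] := fixed_group_embedding (P := galois_act_kernel f s)
    Lbar_sep psiA psi_inj psi_all.
    rewrite (kernel_fixes_fibre iota hs Ua Va); apply/seteqP; split=> sg /= h.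
      by move=> t b; apply: h.
    by move=> chi chiA b; have [t ->] := psi_all chi chiA.
  have dk : (d < k.+1)%N.
    by rewrite ltnS; apply: leq_trans Nk; rewrite -rdN leq_addl.
  by exists (existT _ (Ordinal dk) H).
- move=> s0; have [U h0 [Ua Va et [N Nk gen]]] := Wk (pt s0).
  have fin : finite_alg (mor_sec f U) by exists N.
  have near := @fixes_fibre_near _ _ (mor_sec f U) R L Lbar iota closed _ (nbhs s0)
    (nbhs_filter s0) (ev_near h0) (ev h0) fin et (ev_near_cvg h0).
  apply: filterS2 (opens_near h0) near => s hs fix_near.
  rewrite /fibre_galois_group.
  (* The group depends on s only through the kernel, so equal kernels give equal groups. *)
  suff -> : galois_act_kernel f s = galois_act_kernel f s0 :> set (field_aut iota) by [].
  rewrite (kernel_fixes_fibre iota hs Ua Va) (kernel_fixes_fibre iota h0 Ua Va).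
  apply/seteqP; split=> sg /= h.
    by apply/(fix_near sg (aut_fix sg)); rewrite (ev_nearE h0 hs).
  by have /(fix_near sg (aut_fix sg)) := h; rewrite (ev_nearE h0 hs).
Qed.
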